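(* Let $k\ge1$ be an integer and $r>0$. Suppose the noise family $\mathcal Q_n$ is defined by bounds $0<\varsigma_*(n)\le\varsigma^*(n)$ such that for every $\check\epsilon>0$, $n^{\check\epsilon}\varsigma_*(n)\to+\infty$ and $\varsigma^*(n)/n^{\check\epsilon}\to0$ as $n\to\infty$. Then $$\liminf_{n\to\infty}\ \upsilon_n^{2k/(2k+1)}\inf_{\widehat S_n\in\Pi_n}\ \sup_{S\in W_r^k}\mathcal R_n^*(\widehat S_n,S)\ \ge\ r_k^*,$$ where $\upsilon_n=n/\varsigma^*(n)$ and $$r_k^*=\big((2k+1)r\big)^{1/(2k+1)}\Big(\frac{k}{(k+1)\pi}\Big)^{2k/(2k+1)}.$$
   Context: **Noise.** $\xi_t=\varrho_1L_t+\varrho_2z_t$, $t\ge 0$, where $\varrho_1,\varrho_2\in\mathbb R$. The Lévy process is $L_t=\check\varrho\,w_t+\sqrt{1-\check\varrho^2}\,\check L_t$ with $0\le\check\varrho\le 1$, $w$ a standard Brownian motion, $\check L_t=x*(\mu-\tilde\mu)_t$ a compensated jump integral, $\mu(ds,dx)$ being the jump measure with deterministic compensator $\tilde\mu(ds,dx)=ds\,\Pi(dx)$; $\Pi$ is a positive measure on $\mathbb R$ with $\int x^2\Pi(dx)=1$, $\int x^8\Pi(dx)<\infty$. The jump process is $z_t=\sum_{i=1}^{N_t}Y_i$ with $(Y_i)_{i\ge1}$ i.i.d., $\mathbf EY_i=0$, $\mathbf EY_i^2=1$, $\mathbf EY_i^4<\infty$, and $N_t=\sum_{k\ge1}\mathbf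 1_{\{T_k\le t\}}$, $T_k=\sum_{l=1}^k\tau_l$, with $(\tau_l)_{l\ge1}$ i.i.d. positive integrable with law $\eta$ and mean $\check\tau>0$. The processes $(N_t)$, $(Y_i)$ and $(L_t)$ are independent. **Model, noise family and robust risk.** One observes $dy_t=S(t)\,dt+d\xi_t$, $0\le t\le n$, $S$ being $1$-periodic. $Q$ is the law of $(\xi_t)_{0\le t\le n}$ on the Skorokhod space. With $\sigma_Q=\varrho_1^2+\varrho_2^2/\check\tau$, the family $\mathcal Q_n$ consists of all such laws whose parameters satisfy $\varsigma_*\le\varrho_1^2\le\varsigma^*$, $0\le\check\varrho\le1$, $\varsigma_*\le\sigma_Q\le\varsigma^*$ ($\Pi$, $\eta$ and the law of $Y_1$ being fixed), $\varsigma_*=\varsigma_*(n)$, $\varsigma^*=\varsigma^*(n)$. $\|f\|^2=\int_0^1f^2$, $\mathcal R_Q(\widetilde S,S)=\mathbf E_{Q,S}\|\widetilde S-S\|^2$ ($\mathbf E_{Q,S}$ expectation for the observation process), and $\mathcal R_n^*(\widetilde S,S)=\sup_{Q\in\mathcal Q_n}\mathcal R_Q(\widetilde S,S)$. **Function class and estimators.** $W_r^k=\{f\in C^k_{per}[0,1]:\sum_{j=0}^k\|f^{(j)}\|^2\le r\}$, where $C^k_{per}[0,1]$ is the set of $k$ times continuously differentiable $f:[0,1]\to\mathbb R$ with $f^{(i)}(0)=f^{(i)}(1)$ for all $0\le i\le k$ (extended $1$-periodically). $\Pi_n$ is the set of all estimators $\widehat S_n$ measurable with respect to $\sigma\{y_t:0\le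 t\le n\}$. *)

(* Defs.v *)
From HB Require Import structures.
From mathcomp Require Import all_boot all_order all_algebra finmap.
From mathcomp Require Import all_classical all_reals all_analysis.

Set Implicit Arguments.
Unset Strict Implicit.
Unset Printing Implicit Defensive.

Import Order.TTheory GRing.Theory Num.Theory.
Import numFieldNormedType.Exports.

Local Open Scope classical_set_scope.
Local Open Scope ring_scope.

(* Processes are families indexed by the real line; only times t >= 0 matter. *)

Definition sigma_generated (I T : Type) d' (T' : measurableType d')
    (D : set I) (X : I -> T -> T') : set (set T) :=
  <<s [set A | exists i (B : set T'), [/\ D i, measurable B & A = X i @^-1` B]] >>.

Definition independent4 d (Omega : measurableType d) (R : realType)
    (P : probability Omega R) (F1 F2 F3 F4 : set (set Omega)) : Prop :=
  forall A1 A2 A3 A4, F1 A1 -> F2 A2 -> F3 A3 -> F4 A4 ->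
    P (A1 `&` A2 `&` A3 `&` A4) = (P A1 * P A2 * P A3 * P A4)%E.

Definition iid_with_law d (Omega : measurableType d) (R : realType)
    (P : probability Omega R) (X : nat -> {RV P >-> R})
    (nu : probability (measurableTypeR R) R) : Prop :=
  (forall i (B : set R), measurable B -> P (X i @^-1` B) = nu B) /\
  (forall m (B : nat -> set R), (forall i, measurable (B i)) ->
    P (\big[setI/setT]_(i < m) (X i @^-1` B i)) =
    (\prod_(i < m) P (X i @^-1` B i))%E).

Definition standard_brownian d (Omega : measurableType d) (R : realType)
    (P : probability Omega R) (w : R -> {RV P >-> R}) : Prop :=
  [/\ {ae P, forall om, w 0 om = 0},
      {ae P, forall om, {within `[0, +oo[%classic, continuous (fun t => w t om)}},
      (forall s t (B : set R), 0 <= s -> s < t -> measurable B ->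
        P [set om | B (w t om - w s om)] = normal_prob 0 (Num.sqrt (t - s)) B)
    & (forall s t (A : set Omega) (B : set R), 0 <= s -> s < t ->
        sigma_generated `[0, s]%classic w A -> measurable B ->
        P (A `&` [set om | B (w t om - w s om)]) =
        (P A * P [set om | B (w t om - w s om)%R])%E)].

Definition cadlag (R : realType) (x : R -> R) : Prop :=
  (forall t, 0 <= t -> x u @[u --> t^'+] --> x t) /\
  (forall t, 0 < t -> cvg (x u @[u --> t^'-])).

Definition jump (R : realType) (x : R -> R) (t : R) : R :=
  x t - lim (x u @[u --> t^'-]).

(* mu(]s, t] * B) for the jump measure mu of the path x. *)
Definition jump_measure (R : realType) (x : R -> R) (s t : R) (B : set R) :
    \bar R :=
  counting [set u | [/\ s < u <= t, jump x u != 0 & B (jump x u)]].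

(* The deterministic measure ds Pi(dx) is the compensator of the jump measure
   mu of X, for the filtration of X: for each B not containing 0 with
   Pi(B) < oo, mu(]0, t] * B) - t Pi(B) has centered increments given the
   past. *)
Definition has_jump_compensator d (Omega : measurableType d) (R : realType)
    (P : probability Omega R) (Pi : {measure set (measurableTypeR R) -> \bar R})
    (X : R -> {RV P >-> R}) : Prop :=
  forall s t (F : set Omega) (B : set R), 0 <= s -> s < t ->
    sigma_generated `[0, s]%classic X F ->
    measurable B -> ~ B 0 -> (Pi B < +oo)%E ->
    (\int[P]_(om in F) jump_measure (fun u => X u om) s t B =
     P F * ((t - s)%:E * Pi B))%E.

(* The integral of x against mu - ds Pi(dx) over ]0, t] * {|x| > eps}; a cadlag
   path has finitely many such jumps. *)
Definition compensated_jumps (R : realType)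
    (Pi : {measure set (measurableTypeR R) -> \bar R})
    (x : R -> R) (eps t : R) : R :=
  \sum_(u \in [set u | 0 < u <= t /\ eps < `|jump x u|]) jump x u
  - t * \int[Pi]_(y in [set y : R | eps < `|y|]) y.

(* X_t = x * (mu - ds Pi(dx))_t, mu being the jump measure of X: the stochastic
   integral is the L^2 limit of its truncations. *)
Definition compensated_jump_integral d (Omega : measurableType d)
    (R : realType) (P : probability Omega R)
    (Pi : {measure set (measurableTypeR R) -> \bar R})
    (X : R -> {RV P >-> R}) : Prop :=
  [/\ forall om, cadlag (fun t => X t om),
      has_jump_compensator Pi X
    & forall t, 0 <= t ->
        (\int[P]_om ((X t om - compensated_jumps Pi (fun u => X u om) eps t)
                       ^+ 2)%:E)%E @[eps --> (0 : R)^'+] --> 0%E].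

Definition renewal_time (R : realType) (T : Type) (tau : nat -> T -> R)
    (k : nat) (om : T) : R :=
  \sum_(l < k) tau l om.

(* N_t, the number of k >= 1 with T_k <= t; fset_set makes it 0 on the null
   event where this number is infinite. *)
Definition renewal_count (R : realType) (T : Type) (tau : nat -> T -> R)
    (t : R) (om : T) : nat :=
  #|` fset_set [set k | (0 < k)%N /\ renewal_time tau k om <= t] |.

Definition jump_process (R : realType) (T : Type) (tau Y : nat -> T -> R)
    (t : R) (om : T) : R :=
  \sum_(i < renewal_count tau t om) Y i om.

(* The Levy process L = crho w + sqrt(1 - crho^2) Lj has w as Gaussian part and
   Lj as jump part, hence w and Lj are taken independent (Levy-Ito). *)
Definition noise (R : realType) (T : Type) (w Lj : R -> T -> R)
    (tau Y : nat -> T -> R) (rho1 rho2 crho t : R) (om : T) : R :=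
  rho1 * (crho * w t om + Num.sqrt (1 - crho ^+ 2) * Lj t om)
  + rho2 * jump_process tau Y t om.

(* Paths observed on [0, n], with the sigma-algebra of the coordinates x(t),
   0 <= t <= n. Its trace on the Skorokhod space D[0, n] is the Borel
   sigma-algebra, so laws on D[0, n] are laws on this space, and the measurable
   functions are those of (x(t))_(0 <= t <= n). *)
Definition coordinate_sets (R : realType) (n : nat) : set (set (R -> R)) :=
  [set A | exists t (B : set R),
    [/\ 0 <= t <= n%:R, measurable B & A = [set x : R -> R | B (x t)]]].

Definition path_space (R : realType) (n : nat) :=
  g_sigma_algebraType (@coordinate_sets R n).

(* ctau is the mean of the interarrival times; lo and hi are the bounds
   varsigma_*(n) and varsigma^*(n). *)
Definition noise_family d (Omega : measurableType d) (R : realType)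
    (P : probability Omega R) (w Lj : R -> Omega -> R)
    (tau Y : nat -> Omega -> R) (ctau lo hi : R) (n : nat) :
    set (probability (path_space R n) R) :=
  [set Q | exists rho1 rho2 crho : R,
    [/\ lo <= rho1 ^+ 2 <= hi,
        0 <= crho <= 1,
        lo <= rho1 ^+ 2 + rho2 ^+ 2 / ctau <= hi
      & forall A : set (path_space R n), measurable A ->
          Q A = P [set om | A (fun t => noise w Lj tau Y rho1 rho2 crho t om)]]].

Arguments noise_family {d Omega R} P w Lj tau Y ctau lo hi n _.

(* The observation y_t = \int_0^t S(s) ds + xi_t. *)
Definition observation (R : realType) (S xi : R -> R) : R -> R :=
  fun t => \int[lebesgue_measure]_(s in `[0, t]) S s + xi t.

(* Joint measurability in (y, t) gives a meaning to || Sh - S || and to its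
   expectation. *)
Definition estimators (R : realType) (n : nat) :
    set (path_space R n -> R -> R) :=
  [set Sh | measurable_fun
    ([set: path_space R n] `*` [set t : measurableTypeR R | 0 <= t <= 1])
    (fun p : path_space R n * measurableTypeR R =>
       Sh p.1 p.2 : measurableTypeR R)].

Arguments estimators : clear implicits.

Definition risk (R : realType) (n : nat) (Q : probability (path_space R n) R)
    (Sh : path_space R n -> R -> R) (S : R -> R) : \bar R :=
  (\int[Q]_xi \int[lebesgue_measure]_(t in `[0%R, 1%R])
     ((Sh (observation S xi) t - S t) ^+ 2)%:E)%E.

Definition robust_risk (R : realType) (n : nat)
    (Qn : set (probability (path_space R n) R))
    (Sh : path_space R n -> R -> R) (S : R -> R) : \bar R :=
  ereal_sup [set risk Q Sh S | Q in Qn].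

(* The derivative on [0, 1] is one-sided at 0 and 1. *)
Definition unit_slope (R : realType) (f : R -> R) (t : R) : set_system R :=
  (f s - f t) / (s - t) @[s --> within `[0, 1]%classic (t^')].

Definition unit_derive (R : realType) (f : R -> R) (t : R) : R :=
  lim (unit_slope f t).

Definition unit_deriven (R : realType) (j : nat) (f : R -> R) : R -> R :=
  iter j (@unit_derive R) f.

Definition Ck_per (R : realType) (k : nat) : set (R -> R) :=
  [set f | [/\ forall i t, (i < k)%N -> 0 <= t <= 1 ->
                 cvg (unit_slope (unit_deriven i f) t),
               forall i, (i <= k)%N ->
                 {within `[0, 1]%classic, continuous (unit_deriven i f)}
             & forall i, (i <= k)%N ->
                 unit_deriven i f 0 = unit_deriven i f 1]].

Definition sobolev_ball (R : realType) (k : nat) (r : R) : set (R -> R) :=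
  [set f | [/\ forall t, f (t + 1) = f t,
               Ck_per k f
             & (\sum_(j < k.+1) \int[lebesgue_measure]_(t in `[0%R, 1%R])
                  ((unit_deriven j f t) ^+ 2)%:E <= r%:E)%E]].

Definition pinsker_constant (R : realType) (k : nat) (r : R) : R :=
  ((k.*2.+1)%:R * r) `^ (1 / (k.*2.+1)%:R)
  * (k%:R / ((k.+1)%:R * pi)) `^ ((k.*2)%:R / (k.*2.+1)%:R).

(* Main.v *)
(** The noise is taken Gaussian of maximal variance [sigma ^+ 2 = hi n]. The
    signal is a random trigonometric polynomial of degree [N]: each coefficient
    is an amplitude times a sum of [m] random signs, so that the prior is nearly
    Gaussian but finite. At a fixed time the Bayes risk is bounded below by
    flipping the signs one at a time: the likelihood of the signal deprived of
    its term [e], multiplied by the sign [e], plays the role of a score, and the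
    second moments of these scores are the exponentials of the inner products
    of the terms. Completing a square then gives a bound of Cauchy-Schwarz
    type, which requires likelihoods on finite grids only (Cameron-Martin for
    the Brownian increments), because a bounded measurable function of the path
    is approximated in L^1, under finitely many laws at once, by cylinder
    functions. Summed over the frequencies with Pinsker's variances
    [(N / l) ^+ k - 1], the bound is asymptotically Pinsker's constant, while
    Chernoff's inequality shows that the signal leaves the Sobolev ball with
    probability exponentially small in [N]. *)
Require Import Defs.
From HB Require Import structures.
From mathcomp Require Import all_boot all_order all_algebra finmap.
From mathcomp Require Import all_classical all_reals all_analysis.
From mathcomp Require Import measurable_realfun ring lra.
Set Implicit Arguments.
Unset Strict Implicit.
Unset Printing Implicit Defensive.
Import Order.TTheory GRing.Theory Num.Theory.
Import numFieldNormedType.Exports.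
Local Open Scope classical_set_scope.
Local Open Scope ring_scope.

(** With a Gaussian prior, the Cauchy-Schwarz argument would integrate by parts against the prior
    density. Signs replace this by the flip, a bijection of a finite set, and every prior average by
    a finite sum. The price is that exponentials and hyperbolic sines of the signal-to-noise ratio
    [x] appear where the Gaussian bound has [1 + x]; cutting each coefficient into [m] small signs
    brings them back to [1 + x]. For one [m] to serve all [N], [x] must stay bounded as [N] grows:
    hence the frequencies below [dl * N], where Pinsker's weights are large, carry no signal. A
    finite prior is also bounded, say by [B], so that an arbitrary estimator can be clipped at [B]
    without loss. This yields the bounded function of the path that cylinder functions can
    approximate, and caps the loss at [4 * B ^+ 2] for the signals outside the ball; [B ^+ 2] grows
    at most like [N ^+ 2], which the exponentially small tail absorbs. The bound at a fixed time
    does not depend on the time, because the cosine and the sine of a frequency share one amplitude;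
    integrating it over a period is then immediate. *)

(** * Measures with a density *)

Section weighted_measure.
Context d (T : measurableType d) (R : realType).
Variables (mu : {measure set T -> \bar R}) (D : T -> R).
Hypotheses (mD : measurable_fun setT D) (D0 : forall x, 0 <= D x).

(* mD and D0 are arguments so that the measure instance can be inferred from
   the term. *)
Definition weighted (mD : measurable_fun setT D) (D0 : forall x, 0 <= D x)
  (A : set T) : \bar R := (\int[mu]_(x in A) (D x)%:E)%E.

Let w0 : weighted mD D0 set0 = 0%E.
Proof. by rewrite /weighted integral_set0. Qed.

Let w_ge0 A : (0 <= weighted mD D0 A)%E.
Proof. by apply: integral_ge0 => x _; rewrite lee_fin. Qed.

Let mDE A : measurable_fun A (fun x => (D x)%:E).
Proof. exact/measurable_EFinP/measurable_funTS. Qed.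

Let w_sigma_additive : semi_sigma_additive (weighted mD D0).
Proof.
move=> /= A mA tA mUA; rewrite /weighted ge0_integral_bigcup//; last by move=> x _; rewrite lee_fin.
by apply: is_cvg_ereal_nneg_natsum_cond => n _ _; exact: w_ge0.
Qed.

HB.instance Definition _ := isMeasure.Build _ _ _
  (weighted mD D0) w0 w_ge0 w_sigma_additive.

Import HBNNSimple.

Let weighted_sintegral (h : {nnsfun T >-> R}) :
  sintegral (weighted mD D0) h = (\int[mu]_x ((h x)%:E * (D x)%:E))%E.
Proof.
have ind0 r x : (0 <= (r * \1_(h @^-1` [set r]) x)%:E)%E by exact: nnfun_muleindic_ge0.
have mind (r : R) : measurable_fun setT (fun x => \1_(h @^-1` [set r]) x * D x).
  by apply: measurable_funM => //; exact: measurable_indic.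
have assoc r x : ((r * \1_(h @^-1` [set r]) x)%:E * (D x)%:E =
    r%:E * (\1_(h @^-1` [set r]) x * D x)%:E)%E by rewrite -!EFinM mulrA.
rewrite sintegralE; under [RHS]eq_integral do
  rewrite fimfunE -fsumEFin// ge0_mule_fsuml//.
rewrite ge0_integral_fsum//; last 2 first.
- move=> r; apply/measurable_EFinP/measurable_funM => //.
  by apply: measurable_funM => //; exact: measurable_indic.
- by move=> r x _; apply: mule_ge0 => //; rewrite lee_fin.
apply: eq_fsbigr => _ /set_mem[y _ <-].
under [RHS]eq_integral do rewrite assoc.
rewrite ge0_integralZl ?lee_fin//; last 2 first.
- exact/measurable_EFinP.
- by move=> x _; rewrite lee_fin mulr_ge0.
congr (_ * _)%E; rewrite /= /weighted [LHS]integral_mkcond; apply: eq_integral => x _.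
by rewrite patchE indicE; case: ifP; rewrite ?mul1r ?mul0r.
Qed.

(** Linearity settles simple functions, and monotone convergence on both sides does the rest. It
    serves for the Gaussian density and for [P] tilted by a likelihood. *)
Lemma ge0_integral_weighted (f : T -> \bar R) :
  measurable_fun setT f -> (forall x, (0 <= f x)%E) ->
  (\int[weighted mD D0]_x f x = \int[mu]_x (f x * (D x)%:E))%E.
Proof.
move=> mf f0; have [g [g_nd gf]] := approximation measurableT mf (fun x _ => f0 x).
have g_ndx x : {homo g ^~ x : a b / (a <= b)%N >-> a <= b}.
  by move=> a b ab; exact: (lefP _ _ (g_nd _ _ ab)).
rewrite (nd_ge0_integral_lim _ f0 g_ndx) => [|x]; last exact: gf.
have cvgM : (\int[mu]_x ((g n x)%:E * (D x)%:E))%E @[n --> \oo] -->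
    (\int[mu]_x limn (fun n => (g n x)%:E * (D x)%:E))%E.
  apply: cvg_monotone_convergence => //.
  - by move=> n; apply: emeasurable_funM => //; exact/measurable_EFinP.
  - by move=> n x _; rewrite mule_ge0 ?lee_fin.
  - by move=> x _ a b ab; rewrite lee_wpmul2r ?lee_fin// g_ndx.
transitivity (limn (fun n => \int[mu]_x ((g n x)%:E * (D x)%:E)))%E.
  by congr (limn _); apply/funext => n; exact: weighted_sintegral.
rewrite (cvg_lim _ cvgM)//; apply: eq_integral => x _; apply/cvg_lim => //.
by apply: cvgeMr => //; exact: gf.
Qed.

End weighted_measure.

(** * Expectation of a product of independent variables *)

Section integral_indep.
Context d (T : measurableType d) (R : realType) (P : probability T R).

(* Fubini-Tonelli for the joint law of U and V, a product measure. *)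
Lemma ge0_integral_indep (U V : T -> R) :
  measurable_fun setT U -> measurable_fun setT V ->
  (forall x, 0 <= U x) -> (forall x, 0 <= V x) ->
  (forall A B : set R, measurable A -> measurable B ->
    P ((U @^-1` A) `&` (V @^-1` B)) = (P (U @^-1` A) * P (V @^-1` B))%E) ->
  (\int[P]_x (U x * V x)%:E = (\int[P]_x (U x)%:E) * (\int[P]_x (V x)%:E))%E.
Proof.
move=> mU mV U0 V0 UV.
have mUV : measurable_fun setT (fun x => (U x, V x)) by exact: measurable_fun_pair.
pose PU : {mfun T >-> R} := HB.pack U (isMeasurableFun.Build _ _ _ _ _ mU).
pose PV : {mfun T >-> R} := HB.pack V (isMeasurableFun.Build _ _ _ _ _ mV).
pose PUV : {mfun T >-> (R * R)%type} :=
  HB.pack (fun x => (U x, V x)) (isMeasurableFun.Build _ _ _ _ _ mUV).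
(* Absolute values make the integrand nonnegative on the whole plane, as Tonelli's theorem requires;
   on the range of [(U, V)] they change nothing. *)
pose g : R * R -> \bar R := fun p => (`|p.1| * `|p.2|)%:E.
have mg : measurable_fun setT g.
  apply/measurable_EFinP/measurable_funM; apply: measurableT_comp => //.
have g0 p : (0 <= g p)%E by rewrite lee_fin mulr_ge0.
transitivity (\int[distribution P PUV]_p g p)%E.
  rewrite ge0_integral_distribution//; apply: eq_integral => x _.
  by rewrite /g/= !ger0_norm.
transitivity (\int[(distribution P PU \x distribution P PV)%E]_p g p)%E.
  apply: eq_measure_integral => A mA _; apply/esym.
  by apply: product_measure_unique => // A1 A2 mA1 mA2; exact/esym/UV.
rewrite fubini_tonelli1// /fubini_F.
have mn : measurable_fun [set: R] (fun x : R => `|x|%:E).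
  apply/measurable_EFinP; exact: normr_measurable.
have -> : (\int[P]_x (U x)%:E = \int[distribution P PU]_x `|x|%:E)%E.
  rewrite ge0_integral_distribution//.
  by apply: eq_integral => x _ /=; rewrite ger0_norm.
have -> : (\int[P]_x (V x)%:E = \int[distribution P PV]_x `|x|%:E)%E.
  rewrite ge0_integral_distribution//.
  by apply: eq_integral => x _ /=; rewrite ger0_norm.
have E x : (\int[distribution P PV]_y g (x, y) =
    `|x|%:E * \int[distribution P PV]_y `|y|%:E)%E.
  by rewrite -ge0_integralZl//; apply: eq_integral => y _; rewrite /g EFinM.
under eq_integral => x _ do rewrite E.
by rewrite ge0_integralZr//; apply: integral_ge0.
Qed.

End integral_indep.

(** * Translation of a Gaussian law *)

Section normal_shift.
Context (R : realType).
Local Notation mu := (@lebesgue_measure R).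

Lemma lebesgue_measureD (c : R) (A : set R) : measurable A ->
  pushforward mu ((fun x => x + c) : _ -> measurableTypeR R) A = mu A.
Proof.
have mf : @measurable_fun _ _ (measurableTypeR R) (measurableTypeR R) setT (fun x : R => x + c).
  exact: measurable_funD.
pose f : {mfun measurableTypeR R >-> measurableTypeR R} :=
  HB.pack (fun x : R => x + c) (isMeasurableFun.Build _ _ (measurableTypeR R) (measurableTypeR R) _ mf).
move=> mA; apply/esym/(@lebesgue_measure_unique _ (pushforward mu f)) => // _ [[a b]] _ <-.
rewrite /= /pushforward.
have -> : f @^-1` `]a, b]%classic = `]a - c, b - c]%classic.
  by apply/seteqP; split=> x /=; rewrite !in_itv/= ltrBlDr lerBrDr.
rewrite !lebesgue_measure_itv/= !lte_fin ltrD2r.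
by rewrite -!EFinB opprB addrA subrK.
Qed.

Lemma ge0_integral_shift (c : R) (f : R -> \bar R) :
  measurable_fun setT f -> (forall x, (0 <= f x)%E) ->
  (\int[mu]_x f (x + c)%R = \int[mu]_x f x)%E.
Proof.
have mf : @measurable_fun _ _ (measurableTypeR R) (measurableTypeR R) setT (fun x : R => x + c).
  exact: measurable_funD.
pose s : {mfun measurableTypeR R >-> measurableTypeR R} :=
  HB.pack (fun x : R => x + c) (isMeasurableFun.Build _ _ (measurableTypeR R) (measurableTypeR R) _ mf).
move=> mF f0; transitivity (\int[pushforward mu s]_x f x)%E.
  by rewrite ge0_integral_pushforward.
by apply: eq_measure_integral => A mA _; exact: lebesgue_measureD.
Qed.

Lemma ge0_integral_normal (m s : R) (f : R -> \bar R) :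
  measurable_fun setT f -> (forall x, (0 <= f x)%E) ->
  (\int[normal_prob m s]_x f x = \int[mu]_x (f x * (normal_pdf m s x)%:E))%E.
Proof.
move=> mf f0.
rewrite -(ge0_integral_weighted mu (measurable_normal_pdf m s) (normal_pdf_ge0 m s))//.
Qed.

Lemma normal_pdf_shift (s a x : R) : s != 0 ->
  normal_pdf 0 s (x - a) = normal_pdf 0 s x * expR (a * x / s ^+ 2 - a ^+ 2 / s ^+ 2 / 2).
Proof.
move=> s0; rewrite !normal_pdfE// /normal_fun -[RHS]mulrA -expRD.
congr (_ * expR _); rewrite -mulr_natr; field.
by rewrite s0.
Qed.

(** Cameron-Martin formula in dimension one: by translation invariance of the Lebesgue measure the
    shift moves from [f] to the density, whose logarithm changes by an affine function. *)
Lemma ge0_integral_normal_shift (s a : R) (f : R -> \bar R) : s != 0 ->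
  measurable_fun setT f -> (forall x, (0 <= f x)%E) ->
  (\int[normal_prob 0 s]_x f (x + a)%R =
   \int[normal_prob 0 s]_x (f x * (expR (a * x / s ^+ 2 - a ^+ 2 / s ^+ 2 / 2))%:E))%E.
Proof.
move=> s0 mf f0.
have ms : measurable_fun setT (fun x : R => expR (a * x / s ^+ 2 - a ^+ 2 / s ^+ 2 / 2)).
  apply: measurableT_comp => //; apply: measurable_funB => //.
  by apply: measurable_funM => //; apply: measurable_funM.
have mfs : measurable_fun setT
    (fun x : R => f x * (expR (a * x / s ^+ 2 - a ^+ 2 / s ^+ 2 / 2))%:E)%E.
  by apply: emeasurable_funM => //; exact/measurable_EFinP.
have mfa : measurable_fun setT (fun x : R => f (x + a)).
  by apply: (measurableT_comp mf); exact: measurable_funD.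
have fs0 x : (0 <= f x * (expR (a * x / s ^+ 2 - a ^+ 2 / s ^+ 2 / 2))%:E)%E.
  by rewrite mule_ge0// lee_fin expR_ge0.
rewrite !ge0_integral_normal//.
rewrite -(@ge0_integral_shift a (fun x => f x * (expR _)%:E * _)%E); last 2 first.
- by apply: emeasurable_funM => //; apply: measurableT_comp => //; exact: measurable_normal_pdf.
- by move=> x; rewrite mule_ge0// lee_fin normal_pdf_ge0.
apply: eq_integral => x _; rewrite -muleA; congr (_ * _)%E.
by rewrite -EFinM mulrC -normal_pdf_shift// addrK.
Qed.

Lemma integral_normal_expR (s b : R) : s != 0 ->
  (\int[normal_prob 0 s]_x (expR (b * x))%:E = (expR (b ^+ 2 * s ^+ 2 / 2))%:E)%E.
Proof.
(* This shift turns [a * x / s ^+ 2] into [b * x]: the Laplace transform is the shift formula for a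
   constant function. *)
move=> s0; pose a := b * s ^+ 2.
have := @ge0_integral_normal_shift s a (fun=> (expR (b ^+ 2 * s ^+ 2 / 2))%:E) s0.
rewrite integral_cst//= [X in (_ * X)%E](@integral_normal_pdf R 0 s) mule1 => ->//.
apply: eq_integral => x _; rewrite -EFinM -expRD; congr (expR _)%:E.
by rewrite /a; field.
Qed.

End normal_shift.

(** * Independence of Brownian increments *)

Section brownian_increments.
Context d (Omega : measurableType d) (R : realType) (P : probability Omega R).
Variable w : R -> {RV P >-> R}.
Hypothesis hw : standard_brownian w.

(** A measurable type whose measurable sets are those of [sigma_generated] in [standard_brownian];
    functions of the past can then be treated with the usual composition lemmas. *)
Definition past (s : R) := g_sigma_algebraType
  [set A : set Omega | exists i (B : set R),
     [/\ `[0, s]%classic i, measurable B & A = w i @^-1` B]].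

Lemma measurable_past (s u : R) : 0 <= u <= s ->
  measurable_fun [set: past s] (w u : past s -> R).
Proof.
move=> us _ B mB; rewrite setTI; apply: sub_sigma_algebra.
by exists u, B; split => //; rewrite /= in_itv.
Qed.

Lemma distribution_increment (s u : R) (f : R -> \bar R) : 0 <= s -> s < u ->
  measurable_fun setT f -> (forall x, (0 <= f x)%E) ->
  (\int[P]_om f (w u om - w s om)%R =
   \int[normal_prob 0 (Num.sqrt (u - s))]_x f x)%E.
Proof.
move=> s0 su mf f0.
have mX : @measurable_fun _ _ Omega (measurableTypeR R) setT
    (fun om => w u om - w s om) by exact: measurable_funB.
pose X : {mfun Omega >-> measurableTypeR R} := HB.pack
  (fun om => w u om - w s om)
  (isMeasurableFun.Build _ _ Omega (measurableTypeR R) _ mX).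
rewrite -(ge0_integral_distribution X)//.
apply: eq_measure_integral => B mB _.
have [_ _ e _] := hw; exact: e.
Qed.

(** Induction on [M]: the last increment is independent of the past at time [t M], for which the
    product of the earlier factors is measurable. *)
Lemma ge0_integral_increments (t : nat -> R) (M : nat) (V : nat -> R -> R) :
  0 <= t 0%N -> (forall i, (i < M)%N -> t i < t i.+1) ->
  (forall i, measurable_fun setT (V i)) -> (forall i x, 0 <= V i x) ->
  (\int[P]_om (\prod_(i < M) V i (w (t i.+1) om - w (t i) om))%:E =
   \prod_(i < M) \int[normal_prob 0 (Num.sqrt (t i.+1 - t i))]_x (V i x)%:E)%E.
Proof.
move=> t0 + mV V0; elim: M => [|M IH] ht.
  rewrite big_ord0; under eq_integral do rewrite big_ord0.
  by rewrite integral_cst// mul1e; exact: probability_setT.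
have tM i : (i <= M)%N -> 0 <= t i <= t M.
  move=> iM; have tmono j : (j <= M)%N -> forall l, (l <= j)%N -> t l <= t j.
    elim: j => [|j IHj] jM l; first by rewrite leqn0 => /eqP ->.
    rewrite leq_eqVlt => /predU1P[->//|]; rewrite ltnS => lj.
    by rewrite (le_trans (IHj (ltnW jM) _ lj))// ltW// ht// ltnW.
  by rewrite (le_trans t0 (tmono _ iM _ _))// tmono.
have tM0 : 0 <= t M by have /andP[] := tM M (leqnn _).
have tMS : t M < t M.+1 by exact: ht.
rewrite big_ord_recr/= -IH; last by move=> i iM; rewrite ht// ltnW.
rewrite -distribution_increment//; last 2 first.
- exact/measurable_EFinP.
- by move=> x; rewrite lee_fin.
rewrite -ge0_integral_indep; last 5 first.
- apply: measurable_prod => i _; apply: (measurableT_comp (mV _)).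
  exact: measurable_funB.
- by apply: (measurableT_comp (mV _)); exact: measurable_funB.
- by move=> x; apply: prodr_ge0.
- by move=> x.
- move=> A B mA mB; have [_ _ _ ind] := hw.
  apply: (ind _ _ _ (V M @^-1` B)) => //.
  + have : measurable_fun [set: past (t M)]
      (fun om => \prod_(i < M) V i (w (t i.+1) om - w (t i) om)).
      apply: measurable_prod => i _; apply: (measurableT_comp (mV _)).
      apply: measurable_funB; apply: measurable_past; apply: tM => //.
      exact: ltnW.
    by move=> /(_ measurableT A mA); rewrite setTI.
  + by rewrite -[X in measurable X]setTI; exact: mV.
by apply: eq_integral => om _; rewrite big_ord_recr.
Qed.

End brownian_increments.

(** * Integrable functions with a known integral *)

Section has_integral.
Context d (T : measurableType d) (R : realType) (mu : {measure set T -> \bar R}).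

(** Integrability and value travel together, so that signed finite sums are integrated term by
    term. *)
Definition has_integral (f : T -> R) (r : R) : Prop :=
  mu.-integrable setT (fun x => (f x)%:E) /\ (\int[mu]_x (f x)%:E = r%:E)%E.

Lemma has_integralZ c f r : has_integral f r -> has_integral (fun x => c * f x) (c * r).
Proof.
move=> [fi fr]; split.
  by under eq_fun do rewrite EFinM; exact: integrableZl.
by under eq_integral do rewrite EFinM; rewrite integralZl// fr.
Qed.

Lemma has_integralB f g r s : has_integral f r -> has_integral g s ->
  has_integral (fun x => f x - g x) (r - s).
Proof.
move=> [fi fr] [gi gs]; split.
  by under eq_fun do rewrite EFinB; exact: integrableB.
by under eq_integral do rewrite EFinB; rewrite integralB// fr gs.
Qed.

Lemma has_integral_sum (I : Type) (s : seq I) (f : I -> T -> R) (r : I -> R) :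
  (forall i, has_integral (f i) (r i)) ->
  has_integral (fun x => \sum_(i <- s) f i x) (\sum_(i <- s) r i).
Proof.
move=> h; split.
  under eq_fun do rewrite -sumEFin.
  by apply: integrable_sum => // i _; have [] := h i.
under eq_integral do rewrite -sumEFin.
rewrite integral_sum//; last by move=> i; have [] := h i.
rewrite -sumEFin; apply: eq_bigr => i _; by have [] := h i.
Qed.

Lemma ge0_has_integral (f : T -> R) r : measurable_fun setT f -> (forall x, 0 <= f x) ->
  (\int[mu]_x (f x)%:E = r%:E)%E -> has_integral f r.
Proof.
move=> mf f0 fr; split => //; apply/integrableP; split.
  exact/measurable_EFinP.
by under eq_integral do rewrite gee0_abs ?lee_fin//; rewrite fr ltry.
Qed.

(** [g] may have an infinite integral, so the comparison passes through the positive part of [f],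
    which [g] dominates. *)
Lemma has_integral_le_ge0 (f g : T -> R) r : has_integral f r ->
  measurable_fun setT g -> (forall x, 0 <= g x) -> (forall x, f x <= g x) ->
  (r%:E <= \int[mu]_x (g x)%:E)%E.
Proof.
move=> [fi <-] mg g0 fg; have mf := measurable_int _ fi.
rewrite integralE; apply: (@le_trans _ _ (\int[mu]_x ((fun x => (f x)%:E)^\+ x))%E).
  by rewrite leeBlDr ?leeDl ?integral_ge0// (integrable_neg_fin_num _ fi).
apply: ge0_le_integral => //.
- exact: measurable_funepos.
- exact/measurable_EFinP.
- by move=> x _; rewrite funeposE ge_max !lee_fin fg g0.
Qed.

End has_integral.

(** * Cameron-Martin formula and likelihoods on a finite grid *)

Section grid_likelihood.
Context d (Omega : measurableType d) (R : realType) (P : probability Omega R).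
Variable w : R -> {RV P >-> R}.
Hypothesis hw : standard_brownian w.
Variables (t : nat -> R) (M : nat) (sigma : R).
Hypotheses (t0 : t 0%N = 0) (ht : forall i, (i < M)%N -> t i < t i.+1).
Hypothesis sigma0 : 0 < sigma.

Definition increment (x : R -> R) (i : nat) : R := x (t i.+1) - x (t i).
Definition mesh (i : nat) : R := t i.+1 - t i.

(** Rectangles in the initial value and the increments, rather than in the values: increments are
    independent under [P]. Being stable under intersection, these sets determine a finite
    measure. *)
Definition grid_sets : set (set (R -> R)) :=
  [set C | exists (B0 : set R) (B : nat -> set R),
     [/\ measurable B0, forall i, measurable (B i)
       & C = [set x | B0 (x 0) /\ forall i, (i < M)%N -> B i (increment x i)]]].

Definition grid_space := g_sigma_algebraType grid_sets.

Definition noisy (h : R -> R) (om : Omega) : R -> R :=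
  fun u => h u + sigma * w u om.

(** The density, on the grid, of the law of [h + sigma w] with respect to that of [sigma w],
    evaluated along the path [sigma w]. *)
Definition likelihood (h : R -> R) (om : Omega) : R :=
  expR (\sum_(i < M) (increment h i / sigma * increment (w ^~ om) i / mesh i
                      - (increment h i / sigma) ^+ 2 / mesh i / 2)).

Lemma mesh_gt0 i : (i < M)%N -> 0 < mesh i.
Proof. by move=> iM; rewrite subr_gt0 ht. Qed.

Lemma measurable_increment i : measurable_fun setT (fun om => increment (w ^~ om) i).
Proof. exact: measurable_funB. Qed.

Lemma measurable_likelihood h : measurable_fun setT (likelihood h).
Proof.
apply: measurableT_comp => //; apply: measurable_sum => i.
apply: measurable_funB => //; apply: measurable_funM => //.
by apply: measurable_funM => //; exact: measurable_increment.
Qed.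

Lemma likelihood_ge0 h om : 0 <= likelihood h om.
Proof. exact: expR_ge0. Qed.

Lemma noisy_rectangle h (B0 : set R) (B : nat -> set R) : h 0 = 0 ->
  measurable B0 -> (forall i, measurable (B i)) ->
  measurable (noisy h @^-1` [set x | B0 (x 0) /\ forall i, (i < M)%N -> B i (increment x i)]).
Proof.
move=> h0 mB0 mB.
have -> : noisy h @^-1` [set x | B0 (x 0) /\ forall i, (i < M)%N -> B i (increment x i)] =
   ((fun om => h 0 + sigma * w 0 om) @^-1` B0) `&`
   \bigcap_(i < M) ((fun om => increment (noisy h om) i) @^-1` (B i)).
  by apply/seteqP; split.
have mn u : measurable_fun setT (fun om => h u + sigma * w u om).
  by apply: measurable_funD => //; exact: measurable_funM.
apply: measurableI; first by rewrite -[X in measurable X]setTI; exact: mn.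
apply: bigcap_measurableType => i _.
by rewrite -[X in measurable X]setTI; apply: measurable_funB => //; exact: mn.
Qed.

Lemma increment_noisy h om i :
  increment (noisy h om) i = increment h i + sigma * increment (w ^~ om) i.
Proof. by rewrite /increment /noisy; ring. Qed.

(** The indicator of a rectangle factors over the increments, but only almost surely, since
    [w 0 = 0] holds almost surely. The weights [L] will be 1 for the path with drift, and the
    factors of the likelihood for the path without drift. *)
Lemma ge0_integral_rectangle h (B0 : set R) (B : nat -> set R) (L : nat -> R -> R) :
  h 0 = 0 -> measurable B0 -> (forall i, measurable (B i)) ->
  (forall i, measurable_fun setT (L i)) -> (forall i x, 0 <= L i x) ->
  (\int[P]_om (\1_(noisy h @^-1` [set x | B0 (x 0) /\ forall i, (i < M)%N -> B i (increment x i)]) om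
       * \prod_(i < M) L i (increment (w ^~ om) i))%:E =
  (\1_B0 (0 : R))%:E * \prod_(i < M) \int[normal_prob 0 (Num.sqrt (mesh i))]_x
     (\1_(B i) (increment h i + sigma * x) * L i x)%:E)%E.
Proof.
move=> h0 mB0 mB mL L0; set E := _ @^-1` _.
pose V i x := \1_(B i) (increment h i + sigma * x) * L i x : R.
have mV i : measurable_fun setT (V i).
  apply: measurable_funM => //; apply: measurableT_comp => //.
  by apply: measurable_funD => //; exact: measurable_funM.
have V0 i x : 0 <= V i x by rewrite /V mulr_ge0.
transitivity ((\1_B0 (0 : R))%:E *
    \int[P]_om (\prod_(i < M) V i (increment (w ^~ om) i))%:E)%E; last first.
  by rewrite (ge0_integral_increments hw)// t0.
have mp (U : nat -> R -> R) : (forall i, measurable_fun setT (U i)) ->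
    measurable_fun setT (fun om => \prod_(i < M) U i (increment (w ^~ om) i)).
  move=> mU; apply: measurable_prod => i _; apply: (measurableT_comp (mU _)).
  exact: measurable_increment.
rewrite -ge0_integralZl//=; last 2 first.
- by apply/measurable_EFinP; exact: mp.
- by move=> om _; rewrite lee_fin prodr_ge0.
apply: ge0_ae_eq_integral => //.
- apply/measurable_EFinP/measurable_funM; last exact: mp.
  by apply: measurable_indic; exact: noisy_rectangle.
- by apply: measurable_funeM; apply/measurable_EFinP; exact: mp.
- by move=> om _; rewrite lee_fin mulr_ge0// prodr_ge0.
- by move=> om _; rewrite mule_ge0 ?lee_fin// prodr_ge0.
have [w0 _ _ _] := hw.
apply: filterS w0 => om w0 _ /=.
rewrite -EFinM; congr (_%:E).
rewrite [in RHS]big_split/= mulrA; congr (_ * _).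
rewrite !indicE; have [EE|EE] := boolP (om \in E).
  have [/= b0 b] := set_mem EE.
  have -> : 0 \in B0 by apply/mem_set; move: b0; rewrite /noisy h0 w0 mulr0 addr0.
  rewrite mul1r big1// => i _; rewrite indicE mem_set// -increment_noisy.
  exact: b.
have [b0|b0] := boolP (0 \in B0); last by rewrite mul0r.
move: EE; rewrite notin_setE/= => /not_andP[].
  by rewrite /noisy h0 w0 mulr0 addr0; move/set_mem : b0.
move=> /existsNP[i] /not_implyP[iM bi].
rewrite mul1r; apply/esym/eqP/prodf_eq0; exists (Ordinal iM) => //=.
by rewrite indicE -increment_noisy memNset.
Qed.

Lemma likelihood_prod h om : likelihood h om =
  \prod_(i < M) expR (increment h i / sigma * increment (w ^~ om) i / (Num.sqrt (mesh i)) ^+ 2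
                      - (increment h i / sigma) ^+ 2 / (Num.sqrt (mesh i)) ^+ 2 / 2).
Proof.
rewrite /likelihood expR_sum; apply: eq_bigr => i _.
by rewrite sqr_sqrtr// ltW// mesh_gt0.
Qed.

Lemma measurable_noisy h : h 0 = 0 ->
  measurable_fun setT (noisy h : Omega -> grid_space).
Proof.
move=> h0; apply: (@measurability _ _ Omega grid_space setT (noisy h) grid_sets erefl) => _ [_ [B0 [B [mB0 mB ->]]] <-].
by rewrite setTI; exact: noisy_rectangle.
Qed.

Lemma grid_setsI : setI_closed grid_sets.
Proof.
move=> _ _ [B0 [B [mB0 mB ->]]] [C0 [C [mC0 mC ->]]].
exists (B0 `&` C0), (fun i => B i `&` C i); split.
- exact: measurableI.
- by move=> i; exact: measurableI.
- apply/seteqP; split => x /=.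
    by move=> [[b0 b] [c0 c]]; split=> // i iM; split; [exact: b|exact: c].
  by move=> [[b0 c0] bc]; split; split=> // i /bc[].
Qed.

(** Both sides integrate [F] against finite measures on the grid sigma-algebra, the image of [P] and
    the image of the tilted [P]. It suffices that they agree on rectangles, where the factorization
    leaves one Gaussian shift per increment. *)
Lemma cameron_martin_grid h (F : grid_space -> \bar R) : h 0 = 0 ->
  measurable_fun setT F -> (forall x, (0 <= F x)%E) ->
  (\int[P]_om F (noisy h om) =
   \int[P]_om (F (noisy (fun=> 0%R) om) * (likelihood h om)%:E))%E.
Proof.
move=> h0 mF F0.
pose Q : {measure set Omega -> \bar R} := weighted P (measurable_likelihood h) (likelihood_ge0 h).
pose X := isMeasurableFun.Build _ _ _ _ _ (measurable_noisy h0).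
pose Y := isMeasurableFun.Build _ _ _ _ _ (measurable_noisy (erefl : (fun=> 0 : R) 0 = 0)).
pose Xh : {mfun Omega >-> grid_space} := HB.pack (noisy h) X.
pose X0 : {mfun Omega >-> grid_space} := HB.pack (noisy (fun=> 0%R)) Y.
transitivity (\int[pushforward P Xh]_x F x)%E.
  by rewrite ge0_integral_pushforward.
transitivity (\int[pushforward Q X0]_x F x)%E; last first.
  rewrite ge0_integral_pushforward// ge0_integral_weighted//.
  - by apply: measurableT_comp => //; exact: measurable_noisy.
  - by move=> om; exact: F0.
apply: eq_measure_integral => A mA _.
apply: (@measure_unique _ R grid_space grid_sets (fun=> setT)) => //.
- exact: grid_setsI.
- move=> _; exists setT, (fun=> setT); split => //.
  by apply/seteqP; split.
- by apply/seteqP; split => // x _; exists 0%N.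
- move=> _ [B0 [B [mB0 mB ->]]]; set E := [set x | _].
  rewrite /pushforward /= /Q /weighted.
  have mE k : k 0 = 0 -> measurable (noisy k @^-1` E) by move=> k0; exact: noisy_rectangle.
  transitivity (\int[P]_om (\1_(noisy h @^-1` E) om)%:E)%E.
    by rewrite integral_indic ?setIT//; exact: mE.
  rewrite [RHS]integral_mkcond.
  transitivity (\int[P]_om (\1_(noisy h @^-1` E) om * \prod_(i < M) (fun=> 1 : R) (increment (w ^~ om) i))%:E)%E.
    by apply: eq_integral => om _; rewrite big1 ?mulr1.
  rewrite (@ge0_integral_rectangle h B0 B (fun _ _ => 1))//.
  pose L i x := expR (increment h i / sigma * x / (Num.sqrt (mesh i)) ^+ 2
                      - (increment h i / sigma) ^+ 2 / (Num.sqrt (mesh i)) ^+ 2 / 2).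
  have mL i : measurable_fun setT (L i).
    apply: measurableT_comp => //; apply: measurable_funB => //.
    by apply: measurable_funM => //; apply: measurable_funM.
  transitivity (\int[P]_om (\1_(noisy (fun=> 0%R) @^-1` E) om
      * \prod_(i < M) L i (increment (w ^~ om) i))%:E)%E; last first.
    apply: eq_integral => om _; rewrite patchE indicE -likelihood_prod.
    by case: ifPn; rewrite ?mul1r ?mul0r.
  rewrite ge0_integral_rectangle//; last by move=> i x; exact: expR_ge0.
  congr (_ * _)%E; apply: eq_bigr => i _.
  have mi : Num.sqrt (mesh i) != 0 by rewrite gt_eqF// sqrtr_gt0 mesh_gt0.
  under eq_integral do rewrite mulr1.
  have mG : measurable_fun setT (fun x : R => (\1_(B i) (sigma * x))%:E : \bar R).
    by apply/measurable_EFinP; apply: measurableT_comp => //; exact: measurable_funM.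
  have := @ge0_integral_normal_shift R _ (increment h i / sigma) _ mi mG.
  move=> e; transitivity (\int[normal_prob 0 (Num.sqrt (mesh i))]_x
      (\1_(B i) (sigma * (x + increment h i / sigma)))%:E)%E.
    apply: eq_integral => x _; congr (\1_(B i) _)%:E.
    by field; rewrite gt_eqF.
  rewrite e//; apply: eq_integral => x _.
  by rewrite EFinM /increment subrr add0r.
- by move=> _; exact: (le_lt_trans (@probability_le1 _ _ _ P setT measurableT) (ltry 1)).
Qed.

Lemma has_integral_expR (b : nat -> R) :
  has_integral P (fun om => expR (\sum_(i < M) b i * increment (w ^~ om) i))
    (expR (\sum_(i < M) b i ^+ 2 * mesh i / 2)).
Proof.
apply: ge0_has_integral.
- apply: measurableT_comp => //; apply: measurable_sum => i.
  by apply: measurable_funM => //; exact: measurable_increment.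
- by move=> x; exact: expR_ge0.
under eq_integral do rewrite expR_sum.
have mV i : measurable_fun setT (fun x : R => expR (b i * x)).
  by apply: measurableT_comp => //; exact: measurable_funM.
rewrite (ge0_integral_increments hw (V := fun i x => expR (b i * x)))//; last first.
  by rewrite t0.
rewrite expR_sum -prodEFin; apply: eq_bigr => i _.
rewrite integral_normal_expR ?sqr_sqrtr//; last by rewrite gt_eqF// sqrtr_gt0 mesh_gt0.
by rewrite ltW// mesh_gt0.
Qed.

(** Discretized inner product of the Cameron-Martin space: for smooth [h] and [k], a Riemann sum for
    the integral of [h' k' / sigma^2]. *)
Definition grid_product (h k : R -> R) : R :=
  \sum_(i < M) increment h i * increment k i / (sigma ^+ 2 * mesh i).

Lemma has_integral_likelihood h : has_integral P (likelihood h) 1.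
Proof.
have := has_integralZ (expR (- \sum_(i < M) (increment h i / sigma) ^+ 2 / mesh i / 2))
  (has_integral_expR (fun i => increment h i / sigma / mesh i)).
congr (has_integral _ _ _).
  apply/funext => om; rewrite -expRD /likelihood; congr expR.
  by rewrite addrC -sumrB; apply: eq_bigr => i _; congr (_ - _); ring.
rewrite -expRD -[RHS]expR0; congr expR.
rewrite addrC -sumrB big1// => i _.
by have m0 := mesh_gt0 (ltn_ord i); field; rewrite !gt_eqF.
Qed.

(** The ratio is the exponential of a linear form in the increments; its Laplace transform and the
    deterministic terms combine into the product of the two differences. These are the second
    moments of the scores under the signal [l]. *)
Lemma has_integral_likelihood_ratio h k l :
  has_integral P (fun om => likelihood h om * likelihood k om / likelihood l om)
    (expR (grid_product (fun u => h u - l u) (fun u => k u - l u))).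
Proof.
pose c i := ((increment h i) ^+ 2 + (increment k i) ^+ 2 - (increment l i) ^+ 2) / sigma ^+ 2 / mesh i / 2.
have := has_integralZ (expR (- \sum_(i < M) c i))
  (has_integral_expR (fun i => (increment h i + increment k i - increment l i) / sigma / mesh i)).
congr (has_integral _ _ _).
  apply/funext => om; rewrite /likelihood -expRN -!expRD.
  congr expR; rewrite addrC -!sumrB -big_split/= -sumrB; apply: eq_bigr => i _.
  have m0 := mesh_gt0 (ltn_ord i); rewrite /c; field.
  by rewrite !gt_eqF.
rewrite -expRD; congr expR; rewrite addrC -sumrB; apply: eq_bigr => i _.
rewrite /c /increment.
have m0 := mesh_gt0 (ltn_ord i); field.
by rewrite !gt_eqF.
Qed.

End grid_likelihood.

(** * Averages over a cube of signs *)

Section sign_cube.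
Context (R : realType) (T E : finType) (sgn : T -> E -> R) (flip : E -> T -> T).
Hypothesis sgn_pm : forall o e, sgn o e = 1 \/ sgn o e = -1.
Hypothesis flipK : forall e, involutive (flip e).
Hypothesis sgn_flip : forall e o e',
  sgn (flip e o) e' = if e' == e then - sgn o e' else sgn o e'.

Lemma sgn_sqr o e : sgn o e * sgn o e = 1.
Proof. by case: (sgn_pm o e) => ->; rewrite ?mulrNN mulr1. Qed.

Lemma sum_flip e (F : T -> R) : \sum_o F o = \sum_o F (flip e o).
Proof. by rewrite (reindex_inj (inv_inj (flipK e))). Qed.

(** The flip of [e] permutes the cube and reverses each term. Applied path by path, this says that
    the scores are centered. *)
Lemma sum_sgn_invariant e (F : T -> R) : (forall o, F (flip e o) = F o) ->
  \sum_o sgn o e * F o = 0.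
Proof.
move=> Fe; set S := LHS; suff : S = - S by move=> ?; lra.
rewrite {1}/S (sum_flip e) -sumrN; apply: eq_bigr => o _.
by rewrite sgn_flip eqxx Fe mulNr.
Qed.

Lemma sum_sgn_orthogonal e e' : \sum_o sgn o e * sgn o e' = #|T|%:R * (e == e')%:R.
Proof.
case: eqVneq => [<-|ee']; last first.
  rewrite mulr0; apply: sum_sgn_invariant => o.
  by rewrite sgn_flip eq_sym (negbTE ee').
rewrite mulr1 (eq_bigr (fun=> 1)) => [|o _]; last exact: sgn_sqr.
by rewrite sumr_const.
Qed.

(** The average over the cube of [s * expR (s * K e e')], where [s] is the product of the two signs:
    [s] is 1 on the diagonal and a symmetric sign elsewhere, whence a hyperbolic sine. *)
Definition sign_moment (K : E -> E -> R) (e e' : E) : R :=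
  if e == e' then expR (K e e) else (expR (K e e') - expR (- K e e')) / 2.

Lemma sum_sgn_expR K e e' :
  \sum_o sgn o e * sgn o e' * expR (sgn o e * sgn o e' * K e e') =
  #|T|%:R * sign_moment K e e'.
Proof.
rewrite /sign_moment; case: eqVneq => [<-|ee'].
  rewrite (eq_bigr (fun=> expR (K e e))) => [|o _]; last by rewrite sgn_sqr !mul1r.
  by rewrite sumr_const mulr_natl.
set S := LHS; suff : S + S = #|T|%:R * (expR (K e e') - expR (- K e e')).
  by move=> h; lra.
rewrite {1}/S (sum_flip e) -big_split/= mulr_natl -sumr_const; apply: eq_bigr => o _.
rewrite !sgn_flip eqxx eq_sym (negbTE ee').
by case: (sgn_pm o e) => ->; case: (sgn_pm o e') => ->;
  rewrite ?(mulrNN, mulNr, mulrN, mulr1, mul1r, opprK); ring.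
Qed.

End sign_cube.

(** * Bayes bound for functions of a finite grid *)

Section grid_bayes.
Context d (Omega : measurableType d) (R : realType) (P : probability Omega R).
Variable w : R -> {RV P >-> R}.
Hypothesis hw : standard_brownian w.
Variables (t : nat -> R) (M : nat) (sigma : R).
Hypotheses (t0 : t 0%N = 0) (ht : forall i, (i < M)%N -> t i < t i.+1).
Hypothesis sigma0 : 0 < sigma.
Context (T E : finType) (sgn : T -> E -> R) (flip : E -> T -> T).
Hypothesis sgn_pm : forall o e, sgn o e = 1 \/ sgn o e = -1.
Hypothesis flipK : forall e, involutive (flip e).
Hypothesis sgn_flip : forall e o e',
  sgn (flip e o) e' = if e' == e then - sgn o e' else sgn o e'.
Variable H : E -> R -> R.
Hypothesis H0 : forall e, H e 0 = 0.

Let Hs o u := \sum_e sgn o e * H e u.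
Let Hm o e u := Hs o u - sgn o e * H e u.

Let Hm_flip o e : Hm (flip e o) e = Hm o e.
Proof.
apply/funext => u; rewrite /Hm /Hs (bigD1 e)//= [in RHS](bigD1 e)//=.
rewrite ![_ + \sum_(_ | _) _]addrC !addrK; apply: eq_bigr => e' /negbTE ee'.
by rewrite sgn_flip ee'.
Qed.

Let K e e' := grid_product t M sigma (H e) (H e').

(* With q := sum_e v_e sgn_e L_(without e), expand 0 <= ((g - psi) L + q)^2 / L
   and sum over the signs; the sum of the q vanishes since L_(without e) does
   not see the flip of the sign e. *)
Lemma grid_bayes_bound (g : grid_space t M -> R) (C : R) (psi v : E -> R) :
  measurable_fun setT g -> (forall x, `|g x| <= C) ->
  ((#|T|%:R * (2 * (\sum_e v e * psi e)
      - \sum_e \sum_e' v e * v e' * sign_moment K e e'))%:E <=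
   \sum_o \int[P]_om ((g (noisy w sigma (Hs o) om) - \sum_e sgn o e * psi e) ^+ 2)%:E)%E.
Proof.
move=> mg gC.
have Hs0 o : Hs o 0 = 0 by rewrite /Hs big1// => e _; rewrite H0 mulr0.
pose L h om := likelihood w t M sigma h om.
pose S o := \sum_e sgn o e * psi e.
pose g0 om := g (noisy w sigma (fun=> 0) om).
have L0 h om : 0 < L h om by exact: expR_gt0.
pose q o om := \sum_e v e * sgn o e * L (Hm o e) om.
have mg0 : measurable_fun setT g0.
  exact: (measurableT_comp mg (@measurable_noisy _ _ _ P w t M sigma _ erefl)).
have mL h : measurable_fun setT (L h) by exact: (@measurable_likelihood _ _ _ P).
pose F o om := (g0 om - S o) ^+ 2 * L (Hs o) om.
have F0 o om : 0 <= F o om by rewrite mulr_ge0// ?sqr_ge0// ltW.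
have mF o : measurable_fun setT (F o).
  apply: measurable_funM => //; apply: measurable_funX; exact: measurable_funB.
have -> : (\sum_o \int[P]_om ((g (noisy w sigma (Hs o) om) - S o) ^+ 2)%:E =
    \int[P]_om (\sum_o F o om)%:E)%E.
  under [RHS]eq_integral do rewrite -sumEFin.
  rewrite ge0_integral_sum//; last 2 first.
  - by move=> o; exact/measurable_EFinP.
  - by move=> o om _; rewrite lee_fin.
  apply: eq_bigr => o _.
  rewrite (@cameron_martin_grid _ _ _ _ _ hw _ _ _ t0 ht sigma0 (Hs o)
    (fun x => ((g x - S o) ^+ 2)%:E))//.
  - apply/measurable_EFinP/measurable_funX; exact: measurable_funB.
  - by move=> x; rewrite lee_fin sqr_ge0.
pose G om := \sum_o \sum_e 2 * S o * (v e * sgn o e) * L (Hm o e) om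
  - \sum_o \sum_e \sum_e' (v e * sgn o e) * (v e' * sgn o e')
      * (L (Hm o e) om * L (Hm o e') om / L (Hs o) om).
have GI : has_integral P G (#|T|%:R * (2 * (\sum_e v e * psi e)
      - \sum_e \sum_e' v e * v e' * sign_moment K e e')).
  have -> : #|T|%:R * (2 * (\sum_e v e * psi e)
      - \sum_e \sum_e' v e * v e' * sign_moment K e e') =
      \sum_o \sum_e 2 * S o * (v e * sgn o e) * 1
      - \sum_o \sum_e \sum_e' (v e * sgn o e) * (v e' * sgn o e')
          * expR (sgn o e * sgn o e' * K e e').
    rewrite mulrBr; congr (_ - _).
      rewrite exchange_big/= mulrCA mulr_sumr mulr_sumr; apply: eq_bigr => e _.
      transitivity (\sum_o \sum_e' 2 * v e * psi e' * (sgn o e * sgn o e')).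
        rewrite exchange_big/= (bigD1 e)//= [X in _ = _ + X]big1 => [|e' ee']; last first.
          by rewrite -mulr_sumr (sum_sgn_orthogonal sgn_pm flipK sgn_flip) eq_sym (negbTE ee') !mulr0.
        by rewrite -mulr_sumr (sum_sgn_orthogonal sgn_pm flipK sgn_flip) eqxx mulr1; ring.
      by apply: eq_bigr => o _; rewrite mulr1 /S mulr_sumr mulr_suml; apply: eq_bigr => e' _; ring.
    rewrite [RHS]exchange_big/= mulr_sumr; apply: eq_bigr => e _.
    rewrite [RHS]exchange_big/= mulr_sumr; apply: eq_bigr => e' _.
    rewrite mulrCA -(sum_sgn_expR sgn_pm flipK sgn_flip) mulr_sumr; apply: eq_bigr => o _; ring.
  apply: has_integralB; apply: has_integral_sum => o; apply: has_integral_sum => e.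
    by apply: has_integralZ; exact: has_integral_likelihood.
  apply: has_integral_sum => e'; apply: has_integralZ.
  (* Each difference [Hm o e - Hs o] is minus the term of [e], and the two minus signs cancel in the
     bilinear form. *)
  have -> : sgn o e * sgn o e' * K e e' =
      grid_product t M sigma (fun u => Hm o e u - Hs o u) (fun u => Hm o e' u - Hs o u).
    rewrite /K /grid_product mulr_sumr; apply: eq_bigr => i _.
    by rewrite /increment /Hm; ring.
  exact: has_integral_likelihood_ratio.
apply: (has_integral_le_ge0 GI).
- exact: measurable_sum.
- by move=> om; exact: sumr_ge0.
move=> om; have q0 : \sum_o q o om = 0.
  rewrite /q exchange_big/= big1// => e _.
  rewrite (eq_bigr (fun o => v e * (sgn o e * L (Hm o e) om))) => [|o _]; last by rewrite mulrA.
  rewrite -mulr_sumr (sum_sgn_invariant flipK sgn_flip) ?mulr0// => o.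
  by rewrite Hm_flip.
have {}q0 : \sum_o 2 * g0 om * q o om = 0 by rewrite -mulr_sumr q0 mulr0.
(* [G] is dominated only after summation over the signs. Subtracting this vanishing sum makes the
   comparison true for each [o] separately, where it becomes a completed square. *)
have -> : G om = G om - \sum_o 2 * g0 om * q o om by rewrite q0 subr0.
rewrite /G -!sumrB; apply: ler_sum => o _; rewrite -subr_ge0.
have -> : \sum_e 2 * S o * (v e * sgn o e) * L (Hm o e) om = 2 * S o * q o om.
  by rewrite /q mulr_sumr; apply: eq_bigr => e _; rewrite !mulrA.
have -> : \sum_e \sum_e' v e * sgn o e * (v e' * sgn o e') *
    (L (Hm o e) om * L (Hm o e') om / L (Hs o) om) = q o om ^+ 2 / L (Hs o) om.
  rewrite expr2 {1}/q mulr_suml mulr_suml; apply: eq_bigr => e _.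
  by rewrite /q mulr_sumr mulr_suml; apply: eq_bigr => e' _; ring.
have -> : F o om - (2 * S o * q o om - q o om ^+ 2 / L (Hs o) om - 2 * g0 om * q o om) =
    ((g0 om - S o) * L (Hs o) om + q o om) ^+ 2 / L (Hs o) om.
  by rewrite /F; field; rewrite gt_eqF.
by rewrite divr_ge0 ?sqr_ge0// ltW.
Qed.

End grid_bayes.

(** * Approximation of measurable sets of paths by cylinders *)

Section cylinder_approximation.
Context (R : realType) (n : nat).

Definition cylinder_gens (s : seq R) : set (set (R -> R)) :=
  [set C | exists u (B : set R), [/\ u \in s, measurable B & C = [set x | B (x u)]]].

Definition cylinder_space (s : seq R) := g_sigma_algebraType (cylinder_gens s).

Let cyl (s : seq R) := <<s cylinder_gens s >>.

Definition in_horizon (s : seq R) := all (fun u => (0 <= u) && (u <= n%:R)) s.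

Lemma cylinder_sub s1 s2 : {subset s1 <= s2} -> cyl s1 `<=` cyl s2.
Proof.
move=> s12; apply: smallest_sub; first exact: smallest_sigma_algebra.
move=> _ [u [B [us mB ->]]]; apply: sub_sigma_algebra.
by exists u, B; split => //; exact: s12.
Qed.

Lemma cylinder_measurable s (B : set (path_space R n)) : in_horizon s ->
  cyl s B -> measurable B.
Proof.
move=> /allP sn; apply: smallest_sub; first exact: smallest_sigma_algebra.
move=> _ [u [C [us mC ->]]]; apply: sub_sigma_algebra.
by exists u, C; split => //; exact: sn.
Qed.

Context (I : finType) (m : I -> probability (path_space R n) R).

Let appr (A : set (path_space R n)) := measurable A /\
  forall e : R, 0 < e -> exists s (B : set (path_space R n)), [/\ in_horizon s, cyl s B &
    forall i, (m i (A `+` B) <= e%:E)%E].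

Let mY (A B : set (path_space R n)) : measurable A -> measurable B ->
  measurable (A `+` B).
Proof. by move=> mA mB; apply: measurableU; exact: measurableD. Qed.

Let apprU A1 A2 : appr A1 -> appr A2 -> appr (A1 `|` A2).
Proof.
move=> [mA1 a1] [mA2 a2]; split; first exact: measurableU.
move=> e e0; have e2 : 0 < e / 2 by rewrite divr_gt0.
have [s1 [B1 [h1 c1 d1]]] := a1 _ e2; have [s2 [B2 [h2 c2 d2]]] := a2 _ e2.
have mB1 := cylinder_measurable h1 c1; have mB2 := cylinder_measurable h2 c2.
exists (s1 ++ s2), (B1 `|` B2); split.
- by rewrite /in_horizon all_cat; apply/andP.
- apply: (@measurableU _ (cylinder_space (s1 ++ s2))).
    by apply: cylinder_sub c1 => x; rewrite mem_cat => ->.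
  by apply: cylinder_sub c2 => x; rewrite mem_cat => ->; rewrite orbT.
- move=> i; apply: (@le_trans _ _ (m i ((A1 `+` B1) `|` (A2 `+` B2)))).
    apply: le_measure; rewrite ?inE.
    + by apply: mY; exact: measurableU.
    + by apply: measurableU; exact: mY.
    + by move=> x /=; tauto.
  apply: le_trans (measureU2 _ _ _) _ => /=; [exact: mY|exact: mY|].
  by rewrite [e]splitr EFinD leeD.
Qed.

Let appr0 : appr set0.
Proof.
split => // e e0; exists [::], set0; split => //.
- by have [] := @smallest_sigma_algebra _ setT (cylinder_gens [::]).
- by move=> i; rewrite setYK measure0 lee_fin ltW.
Qed.

Let apprC A : appr A -> appr (~` A).
Proof.
move=> [mA a]; split; first exact: measurableC.
move=> e /a[s [B [h c d]]]; exists s, (~` B); split => //.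
  exact: (@measurableC _ (cylinder_space s)).
move=> i; rewrite (_ : ~` A `+` ~` B = A `+` B)//.
by apply/seteqP; split => x /=; have := pselect (A x); have := pselect (B x); tauto.
Qed.

Let appr_bigcup (A : nat -> set (path_space R n)) :
  (forall k, appr (A k)) -> appr (\bigcup_k A k).
Proof.
move=> a; have mA k : measurable (A k) by have [] := a k.
have mU : measurable (\bigcup_k A k) by exact: bigcup_measurable.
split => // e e0; have e2 : 0 < e / 2 by rewrite divr_gt0.
pose U K := \big[setU/set0]_(k < K) A k.
have mUK K : measurable (U K) by exact: bigsetU_measurable.
pose D K := \bigcup_k A k `\` U K.
have mD K : measurable (D K) by exact: measurableD.
have D0 : \bigcap_K D K = set0.
  apply/seteqP; split => // x Dx; have [[k _ Akx] _] := Dx 0%N Logic.I.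
  have [_] := Dx k.+1 Logic.I; apply; rewrite /U big_ord_recr; by right.
(* Continuity from above gives a rank for each law; since [I] is finite, one rank serves them
   all. *)
have [K DK] : exists K, forall i, (m i (D K) <= (e / 2)%:E)%E.
  suff : \forall K \near \oo, forall i, (m i (D K) <= (e / 2)%:E)%E.
    by move=> /(@filter_ex _ _ _)[K ?]; exists K.
  apply: filter_forall => i.
  have : m i \o D @ \oo --> m i (\bigcap_K D K).
    apply: nonincreasing_cvg_mu => //.
    - exact: le_lt_trans (probability_le1 _ _) (ltry 1).
    - by rewrite D0.
    - move=> K L KL; apply/subsetPset; apply: setDS.
      exact: subset_bigsetU.
  rewrite D0 measure0 => /fine_cvgP[fD /cvgrPdist_le/(_ _ e2)]; apply: filterS2 fD => K fK.
  rewrite sub0r normrN => h; have <- : (fine (m i (D K)))%:E = m i (D K) := fineK fK.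
  by rewrite lee_fin (le_trans _ h)// ler_norm.
have [_ /(_ _ e2)[s [B [h c d]]]] : appr (U K).
  rewrite /U; elim: K {DK} => [|K IH]; first by rewrite big_ord0.
  by rewrite big_ord_recr/=; exact: apprU.
have mB := cylinder_measurable h c.
exists s, B; split => // i.
apply: (@le_trans _ _ (m i (D K `|` (U K `+` B)))).
  apply: le_measure; rewrite ?inE.
  - exact: mY.
  - by apply: measurableU => //; exact: mY.
  - have UKU : U K `<=` \bigcup_k A k by rewrite /U -bigcup_mkord => x [k _ Ak]; exists k.
    by move=> x /=; have := UKU x; rewrite /D /=; have := pselect (U K x); tauto.
apply: le_trans (measureU2 _ _ _) _ => /=; [exact: mD|exact: mY|].
by rewrite [e]splitr EFinD leeD.
Qed.

(** The sets that can be approximated under all the [m i] at once form a sigma-algebra, which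
    contains the coordinate sets. *)
Lemma cylinder_dense (A : set (path_space R n)) (e : R) : measurable A -> 0 < e ->
  exists s (B : set (path_space R n)), [/\ in_horizon s, cyl s B &
    forall i, (m i (A `+` B) <= e%:E)%E].
Proof.
move=> mA; suff : appr A by move=> [_]; apply.
move: mA; apply: smallest_sub; first split.
- exact: appr0.
- by move=> B aB; rewrite setTD; exact: apprC.
- exact: appr_bigcup.
move=> _ [u [B [un mB ->]]]; split.
  by apply: sub_sigma_algebra; exists u, B.
move=> e0; exists [:: u], [set x : R -> R | B (x u)]; split.
- by rewrite /in_horizon/= un.
- by apply: sub_sigma_algebra; exists u, B; rewrite mem_head.
- by move=> i; rewrite setYK measure0 lee_fin ltW.
Qed.

End cylinder_approximation.

(** * Approximation of bounded functions of the path *)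

Section function_approximation.
Context (R : realType) (n : nat).
Context (I : finType) (m : I -> probability (path_space R n) R).

(** The sum is the integer part of [y]. Written with indicators, it discretizes a bounded function
    by its level sets; it will also count the low frequencies removed from the prior. *)
Lemma count_below (L : nat) (y : R) : 0 <= y -> y < L.+1%:R ->
  y - 1 <= \sum_(l < L) (l.+1%:R <= y)%R%:R <= y.
Proof.
move=> y0; elim: L => [|L IH] yL; first by rewrite big_ord0; lra.
have [Ly|Ly] := leP L.+1%:R y; last first.
  by rewrite big_ord_recr/= (leNgt L.+1%:R) Ly/= addr0; exact: IH.
rewrite (eq_bigr (fun=> 1)) => [|l _]; last first.
  by rewrite (le_trans _ Ly)// ler_nat.
rewrite sumr_const card_ord Ly andbT.
by move: yL; rewrite -natr1; lra.
Qed.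

(** Up to 1, the rescaled function [(f + C) * K] counts the level sets [A l] to which the point
    belongs; [g] makes the same count with cylinders close to the [A l]. *)
Lemma cylinder_approximation (f : path_space R n -> R) (C e : R) :
  measurable_fun setT f -> (forall x, `|f x| <= C) -> 0 < e -> e <= 1 ->
  exists s (g : @cylinder_space R s -> R), [/\ in_horizon n s,
    measurable_fun setT g, forall x, `|g x| <= C + 1 &
    forall i, (\int[m i]_x `|f x - g x|%:E <= e%:E)%E].
Proof.
move=> mf fC e0 e1.
have C0 : 0 <= C by exact: le_trans (fC point).
pose K := (Num.truncn (2 / e)).+1.
have K0 : 0 < K%:R :> R by rewrite ltr0n.
have Ke : K%:R^-1 <= e / 2.
  rewrite -[e / 2]invrK lef_pV2 ?posrE ?invr_gt0 ?divr_gt0// invf_div ltW//.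
  by rewrite truncnS_gt.
have fK : 0 < K%:R ^-1 :> R by rewrite invr_gt0.
pose L := Num.truncn (2 * C * K%:R).
pose A (l : 'I_L) := [set x | l.+1%:R <= (f x + C) * K%:R].
have mA l : measurable (A l).
  have -> : A l = setT `&` (fun x => (f x + C) * K%:R) @^-1` `[l.+1%:R, +oo[%classic.
    by apply/seteqP; split=> x; rewrite /A/= in_itv/= andbT => // -[].
  by apply: measurable_funM => //; exact: measurable_funD.
(* Half of the error pays for the discretization, the other half is shared between the [L] level
   sets; [L.+1] avoids a division by zero. *)
pose e' := e / 2 / L.+1%:R.
have e'0 : 0 < e' by rewrite divr_gt0// divr_gt0.
have /choice[sB hsB] : forall l, exists sB : seq R * set (path_space R n),
   [/\ in_horizon n sB.1, <<s cylinder_gens sB.1 >> sB.2 &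
    forall i, (m i (A l `+` sB.2) <= e'%:E)%E].
  by move=> l; have [s [B sBP]] := cylinder_dense m (mA l) e'0; exists (s, B).
pose s := flatten [seq (sB l).1 | l <- enum 'I_L].
pose B l := (sB l).2.
have cB l : <<s cylinder_gens s >> (B l).
  have [_ + _] := hsB l; apply: cylinder_sub => x xs.
  by apply/flatten_mapP; exists l; rewrite ?mem_enum.
have hs : in_horizon n s.
  apply/allP => u /flatten_mapP[l _]; have [/allP + _ _] := hsB l; exact.
pose g (x : @cylinder_space R s) : R := - C + K%:R^-1 * \sum_(l < L) \1_(B l) x.
have f0 x : 0 <= (f x + C) * K%:R.
  by rewrite mulr_ge0 ?ler0n//; have := fC x; rewrite ler_norml; lra.
have fL x : (f x + C) * K%:R < L.+1%:R.
  apply: le_lt_trans (truncnS_gt _); rewrite ler_pM2r//.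
  by have := fC x; rewrite ler_norml; lra.
have fg x : `|f x - g x| <= e / 2 + K%:R^-1 * \sum_(l < L) \1_(A l `+` B l) x.
  have -> : f x - g x = K%:R^-1 * ((f x + C) * K%:R - \sum_(l < L) \1_(A l) x)
      + K%:R^-1 * (\sum_(l < L) (\1_(A l) x - \1_(B l) x)).
    by rewrite /g sumrB; field; rewrite gt_eqF.
  apply: le_trans (ler_normD _ _) _; rewrite !normrM (ger0_norm (ltW fK)).
  apply: lerD.
    apply: le_trans Ke; apply: ler_piMr; first exact: ltW.
    have := count_below (f0 x) (fL x).
    have -> : \sum_(l < L) (l.+1%:R <= (f x + C) * K%:R)%R%:R = \sum_(l < L) \1_(A l) x :> R.
      by apply: eq_bigr => l _; rewrite indicE; congr (nat_of_bool _)%:R; apply/idP/idP; rewrite inE.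
    by rewrite ler_norml; lra.
  rewrite ler_pM2l//; apply: le_trans (ler_norm_sum _ _ _) _; apply: ler_sum => l _.
  rewrite !indicE.
  have [a|a] := boolP (x \in A l); have [b|b] := boolP (x \in B l);
    have [c|c] := boolP (x \in _ `+` _); rewrite /= ?subrr ?subr0 ?sub0r ?normrN ?normr0 ?normr1//;
    move: a b c; rewrite ?inE ?notin_setE /=; tauto.
have mB l : measurable (B l : set (path_space R n)).
  by have [h c _] := hsB l; exact: cylinder_measurable c.
have mg : measurable_fun [set: path_space R n] (g : path_space R n -> R).
  by apply: measurable_funD => //; apply: measurable_funM => //; apply: measurable_sum => l; apply: measurable_indic.
exists s, g; split => //.
- apply: measurable_funD => //; apply: measurable_funM => //; apply: measurable_sum => l.
  by apply: measurable_indic; exact: cB.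
- move=> x; rewrite /g.
  have s0 : 0 <= \sum_(l < L) \1_(B l) x :> R by apply: sumr_ge0.
  have sL : \sum_(l < L) \1_(B l) x <= L%:R :> R.
    rewrite -[L in leRHS]card_ord -sumr_const; apply: ler_sum => l _.
    by rewrite indicE lern1 leq_b1.
  have : K%:R^-1 * (\sum_(l < L) \1_(B l) x) <= 2 * C :> R.
    rewrite mulrC ler_pdivrMr// (le_trans sL)// truncn_le// mulr_ge0//.
      by rewrite mulr_ge0.
  have : 0 <= K%:R^-1 * (\sum_(l < L) \1_(B l) x) :> R by rewrite mulr_ge0// ltW.
  by rewrite ler_norml; lra.
move=> i; apply: (@le_trans _ _ (\int[m i]_x ((e / 2)%:E + K%:R^-1%:E * \sum_(l < L) (\1_(A l `+` B l) x)%:E))%E).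
  apply: ge0_le_integral => //.
  - apply/measurable_EFinP; apply: measurableT_comp => //; exact: measurable_funB.
  - apply: emeasurable_funD => //; apply: measurable_funeM.
    apply: emeasurable_sum => l; apply/measurable_EFinP/measurable_indic.
    by apply: measurableU; exact: measurableD.
  - by move=> x _; rewrite sumEFin -EFinM -EFinD lee_fin.
have mY l : measurable (A l `+` B l) by apply: measurableU; exact: measurableD.
have mYi l : measurable_fun setT (fun x => (\1_(A l `+` B l) x)%:E : \bar R).
  by apply/measurable_EFinP/measurable_indic.
rewrite ge0_integralD//; last 3 first.
- by move=> x _; rewrite lee_fin divr_ge0// ltW.
- move=> x _; rewrite sumEFin -EFinM lee_fin; apply: mulr_ge0; first exact: ltW.
  exact: sumr_ge0.
- by apply: measurable_funeM; exact: emeasurable_sum.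
rewrite integral_cst// [X in (_ * X + _)%E](@probability_setT _ _ _ (m i)) mule1.
rewrite ge0_integralZl//; [|exact: emeasurable_sum|by move=> *; rewrite ?sumEFin lee_fin ?sumr_ge0// ltW].
rewrite ge0_integral_sum//.
have : (\sum_(l < L) \int[m i]_x (\1_(A l `+` B l) x)%:E <= (e / 2)%:E)%E.
  apply: (@le_trans _ _ (\sum_(l < L) e'%:E)%E).
    apply: lee_sum => l _; rewrite integral_indic// setIT.
    by have [_ _] := hsB l; apply.
  rewrite sumEFin sumr_const card_ord lee_fin /e' -[_ *+ L]mulr_natr.
  have -> : e / 2 / L.+1%:R * L%:R = e / 2 * (L%:R / L.+1%:R) by ring.
  apply: ler_piMr; first by rewrite divr_ge0// ltW.
  by rewrite ler_pdivrMr ?ltr0n// mul1r ler_nat.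
move=> h; rewrite [leRHS](_ : _ = ((e / 2) + (e / 2))%R%:E); last by rewrite -splitr.
rewrite EFinD leeD2l//; apply: le_trans h.
rewrite -[leRHS]mul1e lee_wpmul2r ?lee_fin ?invf_le1 ?ler1n//.
by apply: sume_ge0 => l _; exact: integral_ge0.
Qed.

End function_approximation.

(** * Refining grids *)

Section grids.
Context (R : realType) (n : nat).
Hypothesis n0 : (0 < n)%N.

Definition is_grid (t : nat -> R) (M : nat) (e : R) : Prop :=
  [/\ t 0%N = 0, t M = n%:R, forall i, (i < M)%N -> t i < t i.+1
    & forall i, (i < M)%N -> t i.+1 - t i <= e].

Lemma grid_between (t : nat -> R) (M : nat) (u : R) :
  t 0%N <= u <= t M -> (exists2 j, (j <= M)%N & u = t j) \/
  exists2 j, (j < M)%N & t j < u < t j.+1.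
Proof.
elim: M => [|M IH] /andP[u0 uM].
  by left; exists 0%N => //; apply/eqP; rewrite eq_le uM.
have [uM'|uM'] := leP u (t M).
  have [|[j jM ->]|[j jM jj]] := IH; first by rewrite u0.
    by left; exists j => //; exact: leqW.
  by right; exists j => //; exact: ltnW.
move: uM; rewrite le_eqVlt => /predU1P[->|uM]; first by left; exists M.+1.
by right; exists M => //; rewrite uM'.
Qed.

Lemma grid_insert (t : nat -> R) (M : nat) (e u : R) : is_grid t M e ->
  0 <= u <= n%:R -> exists t' M', [/\ is_grid t' M' e,
    (exists2 j, (j <= M')%N & u = t' j) &
    forall j, (j <= M)%N -> exists2 j', (j' <= M')%N & t j = t' j'].
Proof.
move=> [t0 tM tinc te] un.
have [|[j jM uj]|[j jM /andP[tju utj]]] := @grid_between t M u; first by rewrite t0 tM.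
- exists t, M; split => //; first by exists j.
  by move=> i iM; exists i.
pose t' i := if (i <= j)%N then t i else if i == j.+1 then u else t i.-1.
have tj1 : t' j.+1 = u by rewrite /t' ltnn eqxx.
have tlt i : (i <= j)%N -> t' i = t i by rewrite /t' => ->.
have tgt i : (j < i)%N -> t' i.+1 = t i.
  by move=> ji; rewrite /t' leqNgt ltnS (ltnW ji)/= eqSS gtn_eqF.
have step i : (i < M.+1)%N -> 0 < t' i.+1 - t' i <= e.
  move=> iM; have [ij|ij|ij] := ltngtP i j.
  - rewrite (tlt i.+1)// (tlt i) ?(ltnW ij)//.
    have iM' : (i < M)%N by exact: ltn_trans jM.
    by rewrite subr_gt0 tinc//= te.
  - have [ij'|ij'] := eqVneq i j.+1.
      rewrite ij' (tgt j.+1)// tj1 subr_gt0 utj/=.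
      by apply: le_trans (te _ jM); rewrite lerB// ltW.
    case: i iM ij ij' => // i; rewrite ltnS => iM ij ij'.
    have {ij ij'}ij : (j < i)%N by rewrite ltn_neqAle eq_sym -eqSS ij'.
    by rewrite !tgt// ?(ltnW ij)// ?subr_gt0 ?tinc//= ?te// leqW.
  - rewrite ij tj1 tlt// subr_gt0 tju/=.
    by apply: le_trans (te _ jM); rewrite lerB// ltW.
exists t', M.+1; split.
- split.
  + by rewrite tlt.
  + by rewrite tgt.
  + by move=> i /step/andP[]; rewrite subr_gt0.
  + by move=> i /step/andP[].
- by exists j.+1 => //; exact: leqW.
- move=> i iM; have [ij|ij] := leqP i j; first by exists i; rewrite ?tlt// leqW.
  by exists i.+1; rewrite // tgt.
Qed.

Lemma grid_uniform (e : R) : 0 < e -> exists t M, is_grid t M e.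
Proof.
move=> e0; pose M := (Num.truncn (n%:R / e)).+1.
have M0 : 0 < M%:R :> R by rewrite ltr0n.
exists (fun i => i%:R * (n%:R / M%:R)), M.
have d0 : 0 < n%:R / M%:R :> R by rewrite divr_gt0// ltr0n.
split.
- by rewrite mul0r.
- by field; rewrite gt_eqF.
- by move=> i _; rewrite ltr_pM2r// ltr_nat.
- move=> i _; rewrite -mulrBl -natrB// subSnn mul1r ler_pdivrMr//.
  by rewrite mulrC -ler_pdivrMr// ltW// truncnS_gt.
Qed.

(** One grid must both contain the times of a cylinder function and be fine enough for the grid
    products to be near their limits: the times are inserted one by one into a uniform grid. *)
Lemma grid_refining (s : seq R) (e : R) : 0 < e -> in_horizon n s ->
  exists t M, is_grid t M e /\ forall u, u \in s -> exists2 j, (j <= M)%N & u = t j.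
Proof.
move=> e0; elim: s => [|u s IH] /=.
  by have [t [M tM]] := grid_uniform e0; exists t, M.
move=> /andP[un /IH[t [M [tM ts]]]].
have [t' [M' [tM' [j jM uj] tt']]] := grid_insert tM un.
exists t', M'; split => // v; rewrite inE => /predU1P[->|/ts[i iM ->]]; first by exists j.
exact: tt'.
Qed.

Lemma grid_le (t : nat -> R) (M : nat) (e : R) : is_grid t M e ->
  forall i, (i <= M)%N -> 0 <= t i <= n%:R.
Proof.
move=> [t0 tM tinc _].
have mono j : (j <= M)%N -> forall i, (i <= j)%N -> t i <= t j.
  elim: j => [|j IH] jM i; first by rewrite leqn0 => /eqP ->.
  rewrite leq_eqVlt => /predU1P[->//|]; rewrite ltnS => ij.
  by rewrite (le_trans (IH (ltnW jM) _ ij))// ltW// tinc.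
by move=> i iM; rewrite -{1}t0 -tM !mono.
Qed.

(** The value at a grid point is the initial value plus finitely many increments. *)
Lemma cylinder_sub_grid (s : seq R) (t : nat -> R) (M : nat) :
  t 0%N = 0 -> (forall u, u \in s -> exists2 j, (j <= M)%N & u = t j) ->
  <<s cylinder_gens s >> `<=` <<s grid_sets t M >>.
Proof.
move=> t0 st; apply: smallest_sub; first exact: smallest_sigma_algebra.
have mi i : (i < M)%N -> measurable_fun setT (fun x : grid_space t M => increment t x i).
  move=> iM _ B mB; rewrite setTI; apply: sub_sigma_algebra.
  exists setT, (fun k => if k == i then B else setT); split => //.
    by move=> k; case: ifP.
  apply/seteqP; split => x /=.
    by move=> Bx; split => // k kM; case: eqP => // ->.
  by move=> [_ /(_ i iM)]; rewrite eqxx.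
have m0 : measurable_fun setT (fun x : grid_space t M => x (t 0%N)).
  move=> _ B mB; rewrite setTI; apply: sub_sigma_algebra.
  exists B, (fun=> setT); split => //; rewrite t0.
  by apply/seteqP; split => x /=; [|case].
have mj j : (j <= M)%N -> measurable_fun setT (fun x : grid_space t M => x (t j)).
  elim: j => // j IH jM.
  have -> : (fun x : grid_space t M => x (t j.+1)) = (fun x => x (t j) + increment t x j).
    by apply/funext => x; rewrite /increment addrC subrK.
  by apply: measurable_funD; [apply: IH; exact: ltnW|exact: mi].
move=> _ [_ [B [/st[j jM ->] mB ->]]].
by have := mj _ jM measurableT B mB; rewrite setTI.
Qed.

End grids.

(** * Bayes bound for functions of the whole path *)

Section bayes_bound.
Context d (Omega : measurableType d) (R : realType) (P : probability Omega R).
Variable w : R -> {RV P >-> R}.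
Hypothesis hw : standard_brownian w.
Variables (n : nat) (sigma : R).
Hypotheses (n0 : (0 < n)%N) (sigma0 : 0 < sigma).

Lemma measurable_noisy_path (h : R -> R) :
  measurable_fun setT (noisy w sigma h : Omega -> path_space R n).
Proof.
apply: (@measurability _ _ Omega (path_space R n) setT _ (@coordinate_sets R n) erefl).
move=> _ [_ [u [B [_ mB ->]]] <-].
have mn : measurable_fun setT (fun om => h u + sigma * w u om).
  by apply: measurable_funD => //; exact: measurable_funM.
exact: mn.
Qed.

Context (T E : finType) (sgn : T -> E -> R) (flip : E -> T -> T).
Hypothesis sgn_pm : forall o e, sgn o e = 1 \/ sgn o e = -1.
Hypothesis flipK : forall e, involutive (flip e).
Hypothesis sgn_flip : forall e o e',
  sgn (flip e o) e' = if e' == e then - sgn o e' else sgn o e'.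
Variables (H : E -> R -> R) (K : E -> E -> R).
Hypothesis H0 : forall e, H e 0 = 0.
Hypothesis HK : forall eps : R, 0 < eps -> exists2 dl : R, 0 < dl &
  forall t M, is_grid n t M dl -> forall e e',
    `|grid_product t M sigma (H e) (H e') - K e e'| <= eps.

Let Hs o u := \sum_e sgn o e * H e u.

(** A finite sum of continuous functions of the entries of [K]; only this side is needed, the
    quadratic form being subtracted in the Bayes bound. *)
Lemma sign_moment_continuous (v : E -> R) (eta : R) : 0 < eta ->
  exists2 eps : R, 0 < eps & forall K' : E -> E -> R,
    (forall e e', `|K' e e' - K e e'| <= eps) ->
    \sum_e \sum_e' v e * v e' * sign_moment K' e e' <=
    \sum_e \sum_e' v e * v e' * sign_moment K e e' + eta.
Proof.
move=> eta0.
pose f (p : E * E) (x : R) : R := v p.1 * v p.2 *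
  (if p.1 == p.2 then expR x else (expR x - expR (- x)) / 2).
pose N := #|{: E * E}|.
have N0 : 0 < N.+1%:R :> R by rewrite ltr0n.
have fc p : continuous (f p).
  move=> x; rewrite /f; apply: cvgM; first exact: cvg_cst.
  case: ifP => _; first exact: continuous_expR.
  apply: cvgM; last exact: cvg_cst.
  apply: cvgB; first exact: continuous_expR.
  by apply: continuous_comp; [exact: opp_continuous|exact: continuous_expR].
have : \forall eps \near (0 : R)^'+, forall p x, `|x - K p.1 p.2| <= eps ->
    f p x <= f p (K p.1 p.2) + eta / N.+1%:R.
  apply: filter_forall => p.
  have /cvgrPdist_le/(_ (eta / N.+1%:R)) := fc p (K p.1 p.2).
  rewrite divr_gt0// => /(_ isT)/nbhs_ballP[r /= r0 hr].
  apply: (filterS _ (nbhs_right_lt r0)) => eps er x xe.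
  have : ball (K p.1 p.2) r x by rewrite /ball/= distrC (le_lt_trans xe).
  by move=> /hr/=; rewrite ler_norml => /andP[+ _]; rewrite lerNl opprB lerBlDl.
move=> /(filterI (nbhs_right_gt 0))/filter_ex[eps [/= e0 he]].
exists eps => // K' hK'.
rewrite !pair_big/=.
have -> : eta = N.+1%:R * (eta / N.+1%:R) by field; rewrite gt_eqF.
apply: (@le_trans _ _ (\sum_(p : E * E) (v p.1 * v p.2 * sign_moment K p.1 p.2 + eta / N.+1%:R))).
  apply: ler_sum => p _.
  have := he p (K' p.1 p.2) (hK' _ _); rewrite /f /sign_moment.
  by case: eqP => [->|].
rewrite big_split/= lerD2l sumr_const -[_ *+ #|_|]mulr_natl ler_pM2r ?divr_gt0// ler_nat.
exact: leqW.
Qed.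

(** Half of [eta] pays for replacing [f] by a cylinder function under the laws of all the
    observations, the other half for replacing [K] by the grid products of a grid on which that
    function is measurable. *)
Lemma bayes_bound (f : path_space R n -> R) (C : R) (psi v : E -> R) :
  measurable_fun setT f -> (forall x, `|f x| <= C) ->
  ((#|T|%:R * (2 * (\sum_e v e * psi e)
      - \sum_e \sum_e' v e * v e' * sign_moment K e e'))%:E <=
   \sum_o \int[P]_om ((f (noisy w sigma (Hs o) om) - \sum_e sgn o e * psi e) ^+ 2)%:E)%E.
Proof.
move=> mf fC; have C0 : 0 <= C by exact: le_trans (fC point).
pose S o := \sum_e sgn o e * psi e.
(* Lipschitz constant of the squared loss: it bounds [a + b - 2 * c] when [a] is a value of [f], [b]
   one of the cylinder function, bounded by [C + 1], and [c] one of [S]. *)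
pose D := 2 * C + 1 + 2 * \sum_e `|psi e|.
have SD o : `|S o| <= \sum_e `|psi e|.
  apply: le_trans (ler_norm_sum _ _ _) _; apply: ler_sum => e _.
  by rewrite normrM; case: (sgn_pm o e) => ->; rewrite ?normrN normr1 mul1r.
have D0 : 0 < D.
  have : 0 <= \sum_e `|psi e| by exact: sumr_ge0.
  by rewrite /D; lra.
apply/lee_addgt0Pr => eta eta0.
pose N := #|T|%:R + 1 : R.
have N0 : 0 < N by rewrite /N ltr_wpDl.
have e20 : 0 < eta / (2 * N) by rewrite divr_gt0// mulr_gt0.
have [eps eps0 heps] := sign_moment_continuous v e20.
have [dl dl0 hdl] := HK eps0.
pose m (o : T) := distribution P (HB.pack_for {mfun Omega >-> path_space R n}
  (noisy w sigma (Hs o) : Omega -> path_space R n)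
  (isMeasurableFun.Build _ _ _ _ _ (measurable_noisy_path (Hs o)))).
(* Each of the [#|T|] terms then costs at most [D * eg], hence less than [eta / 2] in all. *)
pose eg := Num.min 1 (eta / (2 * N * D)).
have eg0 : 0 < eg by rewrite lt_min ltr01/= divr_gt0// !mulr_gt0.
have eg1 : eg <= 1 by rewrite ge_min lexx.
have [s [g [hs mg gC fg]]] := cylinder_approximation m mf fC eg0 eg1.
have [t [M [tM st]]] := grid_refining n0 dl0 hs.
have [t0 tMn tinc _] := tM.
have mg' : measurable_fun setT (g : grid_space t M -> R).
  by move=> _ B mB; rewrite setTI; apply: (cylinder_sub_grid t0 st); rewrite -[X in <<s _ >> X]setTI; exact: mg.
have mgp : measurable_fun setT (g : path_space R n -> R).
  move=> _ B mB; rewrite setTI; apply: (cylinder_measurable hs).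
  by rewrite -[X in <<s _ >> X]setTI; exact: mg.
have := grid_bayes_bound hw t0 tinc sigma0 sgn_pm flipK sgn_flip H0 psi v mg' gC.
set K' := grid_product t M sigma.
have hK' := heps (fun e e' => K' (H e) (H e')) (hdl _ _ tM).
move=> hb; apply: (@le_trans _ _ ((#|T|%:R * (2 * (\sum_e v e * psi e)
      - \sum_e \sum_e' v e * v e' * sign_moment (fun e e' => K' (H e) (H e')) e e') + eta / 2)%:E)).
  rewrite lee_fin.
  have : #|T|%:R * (eta / (2 * N)) <= eta / 2.
    rewrite [leRHS](_ : _ = N * (eta / (2 * N))); last by field; rewrite gt_eqF.
    by rewrite ler_pM2r// /N lerDl.
  have : 0 <= #|T|%:R :> R by [].
  move: (#|T|%:R : R) hK' => c; set A := \sum_e _; set B := \sum_e _; set B' := \sum_e _.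
  move=> h c0 hc; have : c * A <= c * (B + eta / (2 * N)) by rewrite ler_wpM2l.
  by lra.
rewrite EFinD [in leRHS](splitr eta) EFinD addeA leeD2r//.
apply: le_trans hb _.
apply: (@le_trans _ _ (\sum_o (\int[P]_om ((f (noisy w sigma (Hs o) om) - S o) ^+ 2)%:E
   + (D * eg)%:E))%E).
  apply: lee_sum => o _.
  have mc (k : path_space R n -> R) : measurable_fun setT k ->
      measurable_fun setT (fun om => k (noisy w sigma (Hs o) om)).
    by move=> mk; exact: (measurableT_comp mk (measurable_noisy_path (Hs o))).
  have m1 : measurable_fun setT (fun om => ((f (noisy w sigma (Hs o) om) - S o) ^+ 2)%:E).
    by apply/measurable_EFinP/measurable_funX/measurable_funB => //; exact: mc.
  have m2 : measurable_fun setT (fun om => `|f (noisy w sigma (Hs o) om) - g (noisy w sigma (Hs o) om)|%:E : \bar R).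
    apply/measurable_EFinP; apply: measurableT_comp => //.
    by apply: measurable_funB; exact: mc.
  apply: (@le_trans _ _ (\int[P]_om (((f (noisy w sigma (Hs o) om) - S o) ^+ 2)%:E
     + D%:E * `|f (noisy w sigma (Hs o) om) - g (noisy w sigma (Hs o) om)|%:E))%E).
    apply: ge0_le_integral => //.
    - by move=> om _; rewrite lee_fin sqr_ge0.
    - by apply/measurable_EFinP/measurable_funX/measurable_funB => //; exact: mc.
    - by apply: emeasurable_funD => //; exact: measurable_funeM.
    - move=> om _; rewrite -EFinM -EFinD lee_fin -/(S o).
      move: (fC (noisy w sigma (Hs o) om)) (gC (noisy w sigma (Hs o) om)) (SD o).
      move: (f _) (g _) (S o) => a b c; set B := \sum_e _ => ha hb hc.
      rewrite -subr_ge0.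
      have -> : (a - c) ^+ 2 + D * `|a - b| - (b - c) ^+ 2 =
         (a - b) * (a + b - 2 * c) + D * `|a - b| by ring.
      have : `|(a - b) * (a + b - 2 * c)| <= D * `|a - b|.
        rewrite normrM mulrC ler_wpM2r//.
        apply: le_trans (ler_normB _ _) _; apply: le_trans (lerD (ler_normD _ _) (lexx _)) _.
        by rewrite normrM ger0_norm// /D -/B; lra.
      by rewrite ler_norml; lra.
  rewrite ge0_integralD//; last 3 first.
  - by move=> om _; rewrite lee_fin sqr_ge0.
  - by move=> om _; rewrite -EFinM lee_fin mulr_ge0// ltW.
  - exact: measurable_funeM.
  rewrite leeD2l// ge0_integralZl// ?lee_fin ?(ltW D0)// EFinM lee_wpmul2l ?lee_fin ?(ltW D0)//.
  have := fg o; rewrite /m ge0_integral_distribution//.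
  by apply/measurable_EFinP; apply: measurableT_comp => //; exact: measurable_funB.
rewrite big_split/= leeD2l// sumEFin sumr_const lee_fin -[_ *+ _]mulr_natr.
have : D * eg <= eta / (2 * N).
  apply: (@le_trans _ _ (D * (eta / (2 * N * D)))).
    by rewrite ler_pM2l// ge_min lexx orbT.
  by rewrite le_eqVlt; apply/orP; left; apply/eqP; field; rewrite !gt_eqF.
move=> h; apply: (@le_trans _ _ (eta / (2 * N) * #|T|%:R)); first by rewrite ler_wpM2r.
rewrite [leRHS](_ : _ = eta / (2 * N) * N); last by field; rewrite gt_eqF.
by rewrite ler_pM2l// lerDl.
Qed.

End bayes_bound.

(** * Derivatives on the line and one-sided derivatives on the unit interval *)

Section primitives.
Context (R : realType).
Implicit Types F G f g : R -> R.

Definition has_deriv F f : Prop := forall x : R, is_derive x 1 F (f x).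

Lemma has_deriv_ext F G f g : has_deriv F f -> F =1 G -> f =1 g -> has_deriv G g.
Proof. by move=> h /funext <- /funext <-. Qed.

Lemma has_deriv_cst c : has_deriv (fun=> c) (fun=> 0).
Proof. by move=> x; exact: is_derive_cst. Qed.

Lemma has_deriv_id : has_deriv (fun x => x) (fun=> 1).
Proof. by move=> x; exact: is_derive_id. Qed.

Lemma has_derivD F G f g : has_deriv F f -> has_deriv G g ->
  has_deriv (fun x => F x + G x) (fun x => f x + g x).
Proof. by move=> hF hG x; exact: is_deriveD. Qed.

Lemma has_derivB F G f g : has_deriv F f -> has_deriv G g ->
  has_deriv (fun x => F x - G x) (fun x => f x - g x).
Proof. by move=> hF hG x; exact: is_deriveB. Qed.

Lemma has_derivZ c F f : has_deriv F f ->
  has_deriv (fun x => c * F x) (fun x => c * f x).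
Proof. by move=> hF x; exact: is_deriveZ. Qed.

Lemma has_deriv_sum (I : Type) (s : seq I) (F f : I -> R -> R) :
  (forall i, has_deriv (F i) (f i)) ->
  has_deriv (fun x => \sum_(i <- s) F i x) (fun x => \sum_(i <- s) f i x).
Proof.
move=> h; elim: s => [|i s IH].
  by apply: has_deriv_ext (has_deriv_cst 0) _ _ => x; rewrite big_nil.
by apply: has_deriv_ext (has_derivD (h i) IH) _ _ => x; rewrite big_cons.
Qed.

Lemma has_deriv_sin a : has_deriv (fun x => sin (a * x)) (fun x => a * cos (a * x)).
Proof.
move=> x; rewrite mulrC.
apply: (@is_derive1_comp _ sin (fun y => a * y)).
by apply: is_derive_eq (has_derivZ a has_deriv_id x) _; rewrite mulr1.
Qed.

Lemma has_deriv_cos a : has_deriv (fun x => cos (a * x)) (fun x => - (a * sin (a * x))).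
Proof.
move=> x; rewrite -mulrN mulrC.
apply: (@is_derive1_comp _ cos (fun y => a * y)).
by apply: is_derive_eq (has_derivZ a has_deriv_id x) _; rewrite mulr1.
Qed.

Lemma has_deriv_continuous F f : has_deriv F f -> continuous F.
Proof.
move=> h x; apply/differentiable_continuous; rewrite -derivable1_diffP.
by have [] := h x.
Qed.

Lemma has_deriv_MVT F f a b : has_deriv F f -> a <= b ->
  exists2 c, a <= c <= b & F b - F a = f c * (b - a).
Proof.
move=> h ab; have [|c cab ->] := @MVT_segment _ F f a b ab (fun x _ => h x).
  by apply: continuous_subspaceT; exact: has_deriv_continuous h.
by exists c => //; move: cab; rewrite in_itv.
Qed.

Lemma has_deriv_FTC F f a b : has_deriv F f -> continuous f -> a <= b ->
  (\int[lebesgue_measure]_(x in `[a, b]) (f x)%:E = (F b - F a)%:E)%E.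
Proof.
move=> h cf; rewrite le_eqVlt => /predU1P[->|ab].
  by rewrite set_itv1 integral_set1 subrr.
have cF := has_deriv_continuous h.
rewrite (@continuous_FTC2 _ f F)//.
- exact: continuous_subspaceT.
- split.
  + by move=> x _; have [] := h x.
  + by apply: cvg_at_right_filter; exact: cF.
  + by apply: cvg_at_left_filter; exact: cF.
- by move=> x _; rewrite derive1E; have [_] := h x.
Qed.

(** The function [f'] is to be an iterated [unit_derive], which is known only on the unit interval;
    the slopes of [unit_slope] never leave that interval. *)
Lemma has_deriv_slope F f (f' : R -> R) t : has_deriv F f -> 0 <= t <= 1 ->
  (forall s, 0 <= s <= 1 -> f' s = F s) ->
  unit_slope f' t --> f t.
Proof.
move=> h t01 fF; apply/cvgrPdist_lt => e e0.
have [/cvg_ex[l hl] hv] := h t.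
have {hl} : (fun h0 => h0^-1 *: ((F \o shift t) (h0 *: 1) - F t)) @ 0^' --> f t.
  have := hl; rewrite -hv /derive => hl'; have -> := cvg_lim _ hl' => //.
move=> /cvgrPdist_lt/(_ _ e0); rewrite /within/= !near_withinE => /nbhs_ballP[r /= r0 hr].
rewrite near_simpl /=.
apply/nbhs_ballP; exists r => //= s ts sne s01.
have := hr (s - t); rewrite /ball/= sub0r normrN distrC => /(_ ts).
rewrite subr_eq0 => /(_ sne); rewrite !fF//.
by rewrite /= scaler1 subrK /shift/= [X in f t - X]mulrC.
Qed.

Lemma within_unit_proper (t : R) : 0 <= t <= 1 -> ProperFilter (within `[0, 1]%classic (t^')).
Proof.
move=> t01; apply: Build_ProperFilter; rewrite /within/= => /nbhs_ballP[r /= r0 hr].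
(* A point near [t] but different from it, taken on the side where a move of at most 1/2 stays in
   the unit interval. *)
pose s := if t < 1/2 then t + Num.min (r / 2) (1/2) else t - Num.min (r / 2) (1/2).
have m0 : 0 < Num.min (r / 2) (1 / 2) :> R by rewrite lt_min !divr_gt0.
have mr : Num.min (r / 2) (1 / 2) < r :> R by rewrite gt_min; apply/orP; left; lra.
have m2 : Num.min (r / 2) (1 / 2) <= 1 / 2 :> R by rewrite ge_min lexx orbT.
apply: (hr s); rewrite /ball/= /s; case: (ltP t (1 / 2)) => t12; move: m0 mr m2; set q := Num.min _ _ => m0 mr m2.
- by rewrite opprD addrA subrr sub0r normrN gtr0_norm.
- by rewrite opprB addrC subrK gtr0_norm.
- by rewrite -subr_eq0 addrAC subrr add0r gt_eqF.
- by rewrite -subr_eq0 addrAC subrr add0r oppr_eq0 gt_eqF.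
- by rewrite in_itv/=; lra.
- by rewrite in_itv/=; lra.
Qed.

Lemma unit_deriven_eq (F : nat -> R -> R) (f : R -> R) :
  (forall j, has_deriv (F j) (F j.+1)) ->
  (forall s, 0 <= s <= 1 -> f s = F 0%N s) ->
  forall j s, 0 <= s <= 1 -> unit_deriven j f s = F j s.
Proof.
move=> h f0; elim=> [|j IH] s s01; first exact: f0.
rewrite /unit_deriven iterS /unit_derive -/(unit_deriven j f).
have := within_unit_proper s01 => pf.
by apply/cvg_lim => //; exact: (has_deriv_slope (h j)).
Qed.

Lemma Ck_per_primitive k (F : nat -> R -> R) :
  (forall j, has_deriv (F j) (F j.+1)) -> (forall j, F j 0 = F j 1) ->
  Ck_per k (F 0%N).
Proof.
move=> h per; have e := unit_deriven_eq h (fun s _ => erefl).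
split.
- move=> i t _ t01; apply/cvg_ex; exists (F i.+1 t).
  exact: (has_deriv_slope (h i) t01 (e i)).
- move=> i _; apply: (@subspace_eq_continuous _ _ _ (F i)).
    by move=> s; rewrite inE /mkset in_itv => /(e i s).
  by apply: continuous_subspaceT; exact: has_deriv_continuous (h i).
- by move=> i _; rewrite !e// ?lexx ?ler01.
Qed.

End primitives.

(** * Trigonometric polynomials *)

Section trigonometric.
Context (R : realType).

(** The index [l] stands for the frequency [l + 1]: the constant function is left out. *)
Definition freq (l : nat) : R := 2 * pi * l.+1%:R.

Definition trig (p : nat * bool) (x : R) : R :=
  if p.2 then cos (freq p.1 * x) else sin (freq p.1 * x).

Definition trig_prim (p : nat * bool) (x : R) : R :=
  if p.2 then (freq p.1)^-1 * sin (freq p.1 * x)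
  else (freq p.1)^-1 * (1 - cos (freq p.1 * x)).

Lemma freq_gt0 l : 0 < freq l.
Proof. by rewrite /freq !mulr_gt0// ?pi_gt0// ltr0n. Qed.

Lemma cos_2pi_nat (k : nat) (x : R) : cos (x + 2 * pi * k%:R) = cos x.
Proof. by rewrite mulr_natr mulr_natl periodicn//; exact: cosD2pi. Qed.

Lemma sin_2pi_nat (k : nat) (x : R) : sin (x + 2 * pi * k%:R) = sin x.
Proof. by rewrite mulr_natr mulr_natl periodicn//; exact: sinD2pi. Qed.

Lemma trig_periodic p x : trig p (x + 1) = trig p x.
Proof.
rewrite /trig mulrDr mulr1 /freq.
by case: ifP => _; [exact: cos_2pi_nat|exact: sin_2pi_nat].
Qed.

Lemma trig_prim0 p : trig_prim p 0 = 0.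
Proof. by rewrite /trig_prim mulr0 sin0 cos0 subrr mulr0 if_same. Qed.

Lemma has_deriv_trig_prim p : has_deriv (trig_prim p) (trig p).
Proof.
have f0 : freq p.1 != 0 by rewrite gt_eqF// freq_gt0.
rewrite /trig_prim /trig; case: p.2.
  by apply: has_deriv_ext (has_derivZ (freq p.1)^-1 (has_deriv_sin (freq p.1))) _ _ => x//; field.
apply: has_deriv_ext (has_derivZ (freq p.1)^-1 (has_derivB (has_deriv_cst 1) (has_deriv_cos (freq p.1)))) _ _ => x//.
by field.
Qed.

Lemma has_deriv_trig p : has_deriv (trig p)
  (fun x => if p.2 then - (freq p.1 * trig (p.1, false) x) else freq p.1 * trig (p.1, true) x).
Proof.
by rewrite /trig /=; case: p.2; [exact: has_deriv_cos|exact: has_deriv_sin].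
Qed.

Lemma trig_le1 p x : `|trig p x| <= 1.
Proof.
rewrite /trig; case: p.2; rewrite ler_norml.
  by rewrite cos_geN1 cos_le1.
by rewrite sin_geN1 sin_le1.
Qed.

(* Primitives of cos (a x) and sin (a x), in a form also valid for a = 0. *)
Definition prim_cos (a x : R) : R := if a == 0 then x else a^-1 * sin (a * x).
Definition prim_sin (a x : R) : R := if a == 0 then 0 else - a^-1 * cos (a * x).

Lemma has_deriv_prim_cos a : has_deriv (prim_cos a) (fun x => cos (a * x)).
Proof.
rewrite /prim_cos; case: eqVneq => [->|a0] /=.
  by apply: has_deriv_ext (@has_deriv_id R) _ _ => x; rewrite // mul0r cos0.
by apply: has_deriv_ext (has_derivZ a^-1 (has_deriv_sin a)) _ _ => x //; field.
Qed.

Lemma has_deriv_prim_sin a : has_deriv (prim_sin a) (fun x => sin (a * x)).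
Proof.
rewrite /prim_sin; case: eqVneq => [->|a0] /=.
  by apply: has_deriv_ext (has_deriv_cst 0) _ _ => x; rewrite // mul0r sin0.
by apply: has_deriv_ext (has_derivZ (- a^-1) (has_deriv_cos a)) _ _ => x //; field.
Qed.

Lemma cos_sin_2pi_int (z : int) (n : nat) :
  cos (2 * pi * z%:~R * n%:R : R) = 1 /\ sin (2 * pi * z%:~R * n%:R : R) = 0.
Proof.
have e (k : nat) : cos (2 * pi * k%:R : R) = 1 /\ sin (2 * pi * k%:R : R) = 0.
  by rewrite -[2 * pi * k%:R]add0r cos_2pi_nat sin_2pi_nat cos0 sin0.
case: z => k; first by rewrite -mulrA -natrM.
rewrite NegzE mulrNz mulrN mulNr cosN sinN -mulrA -natrM.
by have [-> ->] := e (k.+1 * n)%N; rewrite oppr0.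
Qed.

Lemma prim_cos_2pi (z : int) (n : nat) :
  prim_cos (2 * pi * z%:~R) n%:R - prim_cos (2 * pi * z%:~R) 0 =
  n%:R * (z == 0)%:R.
Proof.
have p0 : 2 * pi != 0 :> R by rewrite mulf_neq0// gt_eqF// pi_gt0.
rewrite /prim_cos mulf_eq0 (negbTE p0)/= intr_eq0; case: eqP => [_|_].
  by rewrite subr0 mulr1.
by have [_ ->] := cos_sin_2pi_int z n; rewrite !mulr0 sin0 !mulr0 subr0.
Qed.

Lemma prim_sin_2pi (z : int) (n : nat) :
  prim_sin (2 * pi * z%:~R) n%:R - prim_sin (2 * pi * z%:~R) 0 = 0.
Proof.
rewrite /prim_sin; case: eqP => _; first by rewrite subr0.
by have [-> _] := cos_sin_2pi_int z n; rewrite mulr0 cos0 subrr.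
Qed.

(** Orthogonality over [n] periods, by the product-to-sum formulas. It is stated with a primitive
    because the grid sums are compared with its increments. The sum of two frequencies is never
    zero, and their difference vanishes only when [l = k]. *)
Lemma trig_product_prim p q : exists2 Psi : R -> R,
  has_deriv Psi (fun x => trig p x * trig q x) &
  forall n : nat, Psi n%:R - Psi 0 = n%:R / 2 * (p == q)%:R.
Proof.
case: p q => [l b] [k c].
pose a : int := (l%:Z - k%:Z)%R; pose s : int := (l.+1 + k.+1)%N%:Z.
have fa : freq l - freq k = 2 * pi * a%:~R.
  by rewrite /freq /a intrB -!pmulrn -!natr1; ring.
have fs : freq l + freq k = 2 * pi * s%:~R.
  by rewrite /freq /s -pmulrn natrD; ring.
have a0 : (a == 0) = (l == k) by rewrite /a subr_eq0 eqz_nat.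
have s0 : (s == 0) = false by [].
have hc z := has_deriv_prim_cos (2 * pi * z%:~R : R).
have hs z := has_deriv_prim_sin (2 * pi * z%:~R : R).
have cB x : cos (2 * pi * a%:~R * x : R) = cos (freq l * x) * cos (freq k * x) + sin (freq l * x) * sin (freq k * x).
  by rewrite -fa mulrBl cosB.
have cD x : cos (2 * pi * s%:~R * x : R) = cos (freq l * x) * cos (freq k * x) - sin (freq l * x) * sin (freq k * x).
  by rewrite -fs mulrDl cosD.
have sB x : sin (2 * pi * a%:~R * x : R) = sin (freq l * x) * cos (freq k * x) - cos (freq l * x) * sin (freq k * x).
  by rewrite -fa mulrBl sinB.
have sD x : sin (2 * pi * s%:~R * x : R) = sin (freq l * x) * cos (freq k * x) + cos (freq l * x) * sin (freq k * x).
  by rewrite -fs mulrDl sinD.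
have pc := prim_cos_2pi; have ps := prim_sin_2pi.
rewrite xpair_eqE /trig/=; case: b; case: c; rewrite ?andbT ?andbF /=.
- exists (fun x => 2^-1 * (prim_cos (2 * pi * a%:~R) x + prim_cos (2 * pi * s%:~R) x)).
    apply: has_deriv_ext (has_derivZ _ (has_derivD (hc a) (hc s))) _ _ => x //.
    by rewrite cB cD; field.
  move=> n; have := pc a n; have := pc s n; rewrite a0 s0/= => h1 h2; lra.
- exists (fun x => 2^-1 * (prim_sin (2 * pi * s%:~R) x - prim_sin (2 * pi * a%:~R) x)).
    apply: has_deriv_ext (has_derivZ _ (has_derivB (hs s) (hs a))) _ _ => x //.
    by rewrite sB sD; field.
  by move=> n; have := ps a n; have := ps s n => h1 h2; lra.
- exists (fun x => 2^-1 * (prim_sin (2 * pi * s%:~R) x + prim_sin (2 * pi * a%:~R) x)).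
    apply: has_deriv_ext (has_derivZ _ (has_derivD (hs s) (hs a))) _ _ => x //.
    by rewrite sB sD; field.
  by move=> n; have := ps a n; have := ps s n => h1 h2; lra.
- exists (fun x => 2^-1 * (prim_cos (2 * pi * a%:~R) x - prim_cos (2 * pi * s%:~R) x)).
    apply: has_deriv_ext (has_derivZ _ (has_derivB (hc a) (hc s))) _ _ => x //.
    by rewrite cB cD; field.
  move=> n; have := pc a n; have := pc s n; rewrite a0 s0/= => h1 h2; lra.
Qed.

Lemma trig_lipschitz p x y : x <= y -> `|trig p y - trig p x| <= freq p.1 * (y - x).
Proof.
move=> xy; have [c _ ->] := has_deriv_MVT (has_deriv_trig p) xy.
rewrite normrM [X in _ * X]ger0_norm ?subr_ge0// ler_wpM2r ?subr_ge0//.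
by case: p.2; rewrite ?normrN normrM (gtr0_norm (freq_gt0 _)) ler_piMr ?(ltW (freq_gt0 _)) ?trig_le1.
Qed.

Lemma telescope_ord (f : nat -> R) (M : nat) :
  \sum_(i < M) (f i.+1 - f i) = f M - f 0%N.
Proof.
elim: M => [|M IH]; first by rewrite big_ord0 subrr.
by rewrite big_ord_recr/= IH addrC subrKA.
Qed.

(* Each term of the grid product is an increment of a primitive of the product
   of the derivatives, up to an error of the order of the square of the mesh. *)
Lemma grid_product_cvg (n : nat) (sigma : R) p q : 0 < sigma -> (0 < n)%N ->
  forall eps : R, 0 < eps -> exists2 dl : R, 0 < dl &
  forall t M dl', is_grid n t M dl' -> dl' <= dl ->
    `|grid_product t M sigma (trig_prim p) (trig_prim q)
      - n%:R / 2 * (p == q)%:R / sigma ^+ 2| <= eps.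
Proof.
move=> sigma0 n0 eps eps0; have [Psi hPsi PsiE] := trig_product_prim p q.
pose B := 2 * (freq p.1 + freq q.1).
have B0 : 0 < B by rewrite mulr_gt0// addr_gt0// freq_gt0.
have nR : 0 < n%:R :> R by rewrite ltr0n.
(* A term errs by at most [B * dl / sigma ^+ 2] times its step, and the steps add up to [n]. *)
exists (eps * sigma ^+ 2 / B / n%:R); first by rewrite !divr_gt0// mulr_gt0// exprn_gt0.
move=> t M dl [t0 tM tinc te] dle.
have -> : n%:R / 2 * (p == q)%:R / sigma ^+ 2 =
    \sum_(i < M) (Psi (t i.+1) - Psi (t i)) / sigma ^+ 2.
  rewrite -mulr_suml -PsiE; have /= -> := telescope_ord (Psi \o t) M.
  by rewrite t0 tM.
rewrite -sumrB; apply: le_trans (ler_norm_sum _ _ _) _.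
have -> : eps = \sum_(i < M) eps / n%:R * (t i.+1 - t i).
  rewrite -mulr_sumr telescope_ord.
  by rewrite t0 tM subr0; field; rewrite gt_eqF.
apply: ler_sum => i _.
have ti : t i < t i.+1 by exact: tinc.
have D0 : 0 < t i.+1 - t i by rewrite subr_gt0.
have [c1 /andP[c1a c1b] e1] := has_deriv_MVT (has_deriv_trig_prim p) (ltW ti).
have [c2 /andP[c2a c2b] e2] := has_deriv_MVT (has_deriv_trig_prim q) (ltW ti).
have [c3 /andP[c3a c3b] e3] := has_deriv_MVT hPsi (ltW ti).
rewrite /increment /mesh e1 e2 e3.
have -> : trig p c1 * (t i.+1 - t i) * (trig q c2 * (t i.+1 - t i)) / (sigma ^+ 2 * (t i.+1 - t i))
    - trig p c3 * trig q c3 * (t i.+1 - t i) / sigma ^+ 2 =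
    ((trig p c1 - trig p c3) * trig q c2 + trig p c3 * (trig q c2 - trig q c3))
    * ((t i.+1 - t i) / sigma ^+ 2).
  by field; rewrite !gt_eqF.
have lip r x y : t i <= x -> x <= t i.+1 -> t i <= y -> y <= t i.+1 ->
    `|trig r x - trig r y| <= freq r.1 * (t i.+1 - t i).
  move=> x1 x2 y1 y2; have [xy|/ltW xy] := leP y x; last rewrite distrC.
    by apply: le_trans (trig_lipschitz _ xy) _; rewrite ler_pM2l ?freq_gt0// lerB.
  by apply: le_trans (trig_lipschitz _ xy) _; rewrite ler_pM2l ?freq_gt0// lerB.
rewrite normrM [X in _ * X]gtr0_norm; last by rewrite divr_gt0// exprn_gt0.
apply: (@le_trans _ _ (B * dl * ((t i.+1 - t i) / sigma ^+ 2))).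
  rewrite ler_wpM2r ?divr_ge0 ?(ltW D0) ?sqr_ge0//.
  apply: le_trans (ler_normD _ _) _; rewrite !normrM.
  apply: (@le_trans _ _ (freq p.1 * (t i.+1 - t i) * 1 + 1 * (freq q.1 * (t i.+1 - t i)))).
    by apply: lerD; apply: ler_pM => //; rewrite ?trig_le1//; exact: lip.
  rewrite mulr1 mul1r -mulrDl; apply: (@le_trans _ _ ((freq p.1 + freq q.1) * dl)).
    by rewrite ler_wpM2l ?te// addr_ge0 ?(ltW (freq_gt0 _)).
  have dl0 : 0 <= dl by rewrite (le_trans (ltW D0)) ?te.
  by rewrite ler_wpM2r// /B; have := freq_gt0 p.1; have := freq_gt0 q.1; lra.
have -> : eps / n%:R * (t i.+1 - t i) =
    B * (eps * sigma ^+ 2 / B / n%:R) * ((t i.+1 - t i) / sigma ^+ 2).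
  by field; rewrite !gt_eqF.
by rewrite ler_wpM2r ?divr_ge0 ?(ltW D0) ?sqr_ge0// ler_pM2l.
Qed.

Section trig_poly.
Variable N : nat.
Implicit Types c : 'I_N * bool -> R.

Definition tpoly c (x : R) : R := \sum_p c p * trig (nat_of_ord p.1, p.2) x.

Definition tderiv c (p : 'I_N * bool) : R :=
  if p.2 then freq p.1 * c (p.1, false) else - (freq p.1 * c (p.1, true)).

Lemma sum_pair_bool (F : 'I_N * bool -> R) :
  \sum_p F p = \sum_(l < N) (F (l, true) + F (l, false)).
Proof.
rewrite (eq_bigr (fun p => F (p.1, p.2))); last by case.
rewrite -(pair_big xpredT xpredT (fun l b => F (l, b)))/=.
by apply: eq_bigr => l _; rewrite big_bool.
Qed.

Lemma has_deriv_tpoly c : has_deriv (tpoly c) (tpoly (tderiv c)).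
Proof.
have := @has_deriv_sum R _ (index_enum _) _ _ (fun p : 'I_N * bool =>
   has_derivZ (c p) (has_deriv_trig (nat_of_ord p.1, p.2))).
move=> h; apply: has_deriv_ext h _ _ => // x.
rewrite /tpoly !sum_pair_bool; apply: eq_bigr => l _ /=.
by rewrite /tderiv/=; ring.
Qed.

Lemma tpoly_periodic c x : tpoly c (x + 1) = tpoly c x.
Proof. by apply: eq_bigr => p _; rewrite trig_periodic. Qed.

Lemma tpoly_continuous c : continuous (tpoly c).
Proof. exact: has_deriv_continuous (has_deriv_tpoly c). Qed.

Lemma tpoly_norm c : (\int[lebesgue_measure]_(t in `[0%R, 1%R])
  ((tpoly c t) ^+ 2)%:E = (2^-1 * \sum_p c p ^+ 2)%:E)%E.
Proof.
have /choice[Psi hPsi] : forall pq : ('I_N * bool) * ('I_N * bool), exists Psi : R -> R,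
    has_deriv Psi (fun x => trig (nat_of_ord pq.1.1, pq.1.2) x * trig (nat_of_ord pq.2.1, pq.2.2) x) /\
    Psi 1 - Psi 0 = 1 / 2 * (pq.1 == pq.2)%:R.
  move=> [[l b] [k e]]; have [Psi h1 h2] := trig_product_prim (nat_of_ord l, b) (nat_of_ord k, e).
  by exists Psi; split => //=; rewrite (h2 1%N).
pose F x := \sum_pq c pq.1 * c pq.2 * Psi pq x.
have hF : has_deriv F (fun x => (tpoly c x) ^+ 2).
  have := @has_deriv_sum R _ (index_enum _) _ _ (fun pq : ('I_N * bool) * ('I_N * bool) =>
     has_derivZ (c pq.1 * c pq.2) (hPsi pq).1).
  move=> h; apply: has_deriv_ext h _ _ => // x.
  rewrite expr2 {1}/tpoly mulr_suml -(pair_big xpredT xpredT (fun p q =>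
    c p * c q * (trig (nat_of_ord p.1, p.2) x * trig (nat_of_ord q.1, q.2) x)))/=.
  by apply: eq_bigr => p _; rewrite mulr_sumr; apply: eq_bigr => q _; ring.
rewrite (has_deriv_FTC hF)//; last first.
  move=> x; rewrite (_ : (fun x => _) = (fun x => tpoly c x * tpoly c x)); last first.
    by apply/funext => y; rewrite expr2.
  by apply: cvgM; exact: tpoly_continuous.
congr (_%:E); rewrite /F -sumrB mulr_sumr.
pose G p q := c p * c q * (1 / 2 * (p == q)%:R).
rewrite (eq_bigr (fun pq => G pq.1 pq.2)) => [|pq _]; last first.
  by rewrite -mulrBr (hPsi pq).2.
rewrite -(pair_big xpredT xpredT G)/=.
apply: eq_bigr => p _; rewrite (bigD1 p)//= big1 ?addr0 => [|q qp]; last first.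
  by rewrite /G eq_sym (negbTE qp) !mulr0.
by rewrite /G eqxx mulr1 div1r; ring.
Qed.

(** Differentiation rotates the two coefficients of a frequency and scales them by [freq l]; by
    Parseval, the Sobolev norm becomes a weighted sum of squares. *)
Lemma tpoly_sobolev (k : nat) (r : R) c :
  2^-1 * (\sum_(l < N) (\sum_(j < k.+1) freq l ^+ j.*2)
     * (c (l, true) ^+ 2 + c (l, false) ^+ 2)) <= r ->
  sobolev_ball k r (tpoly c).
Proof.
move=> hr; pose F j := tpoly (iter j tderiv c).
have hF j : has_deriv (F j) (F j.+1) by exact: has_deriv_tpoly.
split.
- exact: tpoly_periodic.
- apply: (@Ck_per_primitive R k F) => // j.
  by rewrite /F -[1]add0r tpoly_periodic.
- have e := unit_deriven_eq hF (fun s _ => erefl).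
  have sq j l : iter j tderiv c (l, true) ^+ 2 + iter j tderiv c (l, false) ^+ 2 =
      freq l ^+ j.*2 * (c (l, true) ^+ 2 + c (l, false) ^+ 2).
    elim: j => [|j IH]; first by rewrite mul1r.
    transitivity (freq l ^+ 2 * (iter j tderiv c (l, true) ^+ 2 + iter j tderiv c (l, false) ^+ 2)).
      have t1 c' : tderiv c' (l, true) = freq l * c' (l, false) by [].
      have t2 c' : tderiv c' (l, false) = - (freq l * c' (l, true)) by [].
      by rewrite !iterS t1 t2; ring.
    by rewrite IH doubleS (exprS _ j.*2.+1) (exprS _ j.*2); ring.
  rewrite (eq_bigr (fun j : 'I_k.+1 => (2^-1 * \sum_p iter j tderiv c p ^+ 2)%:E)).
    rewrite sumEFin lee_fin -mulr_sumr; apply: le_trans hr; rewrite ler_pM2l ?invr_gt0//.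
    rewrite (eq_bigr (fun j : 'I_k.+1 => \sum_(l < N) freq l ^+ j.*2 * (c (l, true) ^+ 2 + c (l, false) ^+ 2))).
      by rewrite exchange_big/=; apply: ler_sum => l _; rewrite mulr_suml.
    by move=> j _; rewrite sum_pair_bool; apply: eq_bigr => l _; exact: sq.
  move=> j _; rewrite -tpoly_norm; apply: eq_integral => t.
  by rewrite inE /mkset in_itv => /(e j t) ->.
Qed.

Lemma tpoly_integral c (t : R) : 0 <= t ->
  \int[lebesgue_measure]_(s in `[0, t]) tpoly c s =
  \sum_p c p * trig_prim (nat_of_ord p.1, p.2) t.
Proof.
move=> t0; pose F x := \sum_p c p * trig_prim (nat_of_ord p.1, p.2) x.
have hF : has_deriv F (tpoly c).
  apply: has_deriv_sum => p; apply: has_derivZ; exact: has_deriv_trig_prim.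
rewrite /Rintegral (has_deriv_FTC hF)//; last exact: tpoly_continuous.
by rewrite /= /F [X in _ - X]big1 ?subr0// => p _; rewrite trig_prim0 mulr0.
Qed.

End trig_poly.
End trigonometric.

(** * Arrays of signs and the tail of their energies *)

Section sign_array.
Context (R : realType) (L : finType) (m : nat).

Definition row := {ffun 'I_m -> bool}.
Definition array := {ffun L -> row}.

Definition row_sign (x : row) (i : 'I_m) : R := (-1) ^+ x i.
Definition row_flip (i : 'I_m) (x : row) : row :=
  [ffun j => if j == i then ~~ x j else x j].

Definition array_sign (o : array) (e : L * 'I_m) : R := row_sign (o e.1) e.2.
Definition array_flip (e : L * 'I_m) (o : array) : array :=
  [ffun p => if p == e.1 then row_flip e.2 (o p) else o p].

Lemma row_sign_pm x i : row_sign x i = 1 \/ row_sign x i = -1.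
Proof. by rewrite /row_sign; case: (x i); [right|left]; rewrite ?expr1 ?expr0. Qed.

Lemma row_flipK i : involutive (row_flip i).
Proof.
by move=> x; apply/ffunP => j; rewrite !ffunE; case: (j == i); rewrite ?negbK.
Qed.

Lemma row_sign_flip i x j :
  row_sign (row_flip i x) j = if j == i then - row_sign x j else row_sign x j.
Proof. by rewrite /row_sign ffunE; case: ifP => // _; rewrite signrN. Qed.

Lemma array_sign_pm o e : array_sign o e = 1 \/ array_sign o e = -1.
Proof. exact: row_sign_pm. Qed.

Lemma array_flipK e : involutive (array_flip e).
Proof.
by move=> o; apply/ffunP => p; rewrite !ffunE; case: (p == e.1); rewrite ?row_flipK.
Qed.

Lemma array_sign_flip e o e' :
  array_sign (array_flip e o) e' = if e' == e then - array_sign o e' else array_sign o e'.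
Proof.
case: e e' => [p i] [q j]; rewrite /array_sign ffunE/= xpair_eqE.
by case: eqP => [->|] //=; rewrite row_sign_flip.
Qed.

(** The square of a normalized sum of signs: nearly the square of a standard normal variable, of
    mean 1, yet bounded by [m]. *)
Definition energy (x : row) : R := (\sum_i row_sign x i) ^+ 2 / m%:R.

Hypothesis m0 : (0 < m)%N.

Lemma energy_ge0 x : 0 <= energy x.
Proof. by rewrite divr_ge0// sqr_ge0. Qed.

Lemma energy_le x : energy x <= m%:R.
Proof.
have mR : 0 < m%:R :> R by rewrite ltr0n.
rewrite ler_pdivrMr// -expr2 -[leLHS]ger0_norm ?sqr_ge0// normrX.
rewrite lerXn2r ?nnegrE//; apply: le_trans (ler_norm_sum _ _ _) _.
rewrite -[m in leRHS]card_ord -sumr_const; apply: ler_sum => i _.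
by case: (row_sign_pm x i) => ->; rewrite ?normrN normr1.
Qed.

Lemma sum_energy : \sum_x energy x = #|row|%:R.
Proof.
have mR : 0 < m%:R :> R by rewrite ltr0n.
rewrite -mulr_suml; apply: (canLR (mulfK _)); first by rewrite gt_eqF.
rewrite (eq_bigr (fun x => \sum_i \sum_j row_sign x i * row_sign x j)); last first.
  by move=> x _; rewrite expr2 mulr_suml; apply: eq_bigr => i _; rewrite mulr_sumr.
rewrite exchange_big/= (eq_bigr (fun=> #|row|%:R)) => [|i _]; last first.
  rewrite exchange_big/= (bigD1 i)//= [X in _ + X]big1 => [|j ji]; last first.
    by rewrite (sum_sgn_orthogonal row_sign_pm row_flipK row_sign_flip) eq_sym (negbTE ji) mulr0.
  by rewrite (sum_sgn_orthogonal row_sign_pm row_flipK row_sign_flip) eqxx mulr1 addr0.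
by rewrite sumr_const card_ord mulr_natr.
Qed.

(** Inverting [1 - y <= expR (- y)] reduces the claim to [1 <= (1 + y + 2 y^2) (1 - y)], which is
    where [y <= 1 / 2] enters. *)
Lemma expR_le_quadratic (y : R) : 0 <= y <= 1 / 2 -> expR y <= 1 + y + 2 * y ^+ 2.
Proof.
move=> /andP[y0 y1]; have e := expR_ge1Dx (- y).
have y1' : 0 < 1 - y by lra.
have -> : expR y = (expR (- y))^-1 by rewrite expRN invrK.
apply: (@le_trans _ _ (1 - y)^-1).
  by rewrite lef_pV2 ?posrE ?expR_gt0.
rewrite -[leLHS]div1r ler_pdivrMr//.
have -> : (1 + y + 2 * y ^+ 2) * (1 - y) = 1 + y ^+ 2 * (1 - 2 * y) by ring.
by rewrite lerDl mulr_ge0 ?sqr_ge0//; lra.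
Qed.

(** The square of an energy is at most [m] times the energy, so the mean 1 also controls the
    second-order term. *)
Lemma sum_row_expR (y : R) : 0 <= y -> y * m%:R <= 1 / 2 ->
  \sum_x expR (y * energy x) <= #|row|%:R * expR (y + 2 * y ^+ 2 * m%:R).
Proof.
move=> y0 ym.
apply: (@le_trans _ _ (\sum_x (1 + (y + 2 * y ^+ 2 * m%:R) * energy x))).
  apply: ler_sum => x _; have e0 := energy_ge0 x; have em := energy_le x.
  apply: le_trans (expR_le_quadratic _) _.
    by rewrite mulr_ge0//= (le_trans _ ym)// ler_wpM2l.
  have : (y * energy x) ^+ 2 <= y ^+ 2 * m%:R * energy x.
    by rewrite exprMn -mulrA ler_wpM2l ?sqr_ge0// expr2 ler_wpM2r.
  by lra.
rewrite big_split/= sumr_const -mulr_sumr sum_energy.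
rewrite [leLHS](_ : _ = #|row|%:R * (1 + (y + 2 * y ^+ 2 * m%:R))); last by ring.
by rewrite ler_wpM2l// expR_ge1Dx.
Qed.

(* Chernoff's bound for the weighted sum of the independent energies. *)
Lemma energy_tail (b : L -> R) (y r : R) : (forall p, 0 <= b p) -> 0 <= y ->
  (forall p, y * b p * m%:R <= 1 / 2) ->
  #|[pred o : array | r < \sum_p b p * energy (o p)]|%:R <=
  #|{: array}|%:R * expR (y * (\sum_p b p - r) + 2 * y ^+ 2 * m%:R * \sum_p b p ^+ 2).
Proof.
move=> b0 y0 bm; set A := [pred _ | _].
apply: (@le_trans _ _ (\sum_(o : array) expR (y * (\sum_p b p * energy (o p) - r)))).
  rewrite -sum1_card natr_sum [leRHS](bigID (mem A))/= ler_wpDr//.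
    by apply: sumr_ge0 => o _; exact: expR_ge0.
  apply: ler_sum => o; rewrite inE => ro.
  by rewrite -[leLHS]expR0 ler_expR mulr_ge0// subr_ge0 ltW.
rewrite (eq_bigr (fun o : array => expR (- (y * r)) * \prod_p expR (y * b p * energy (o p)))).
  rewrite -mulr_sumr -(bigA_distr_bigA (fun p x => expR (y * b p * energy x))).
  have : \prod_p \sum_x expR (y * b p * energy x) <=
      \prod_(p : L) (#|row|%:R * expR (y * b p + 2 * (y * b p) ^+ 2 * m%:R)).
    apply: ler_prod => p _; rewrite sumr_ge0 => [/=|x _]; last exact: expR_ge0.
    by apply: sum_row_expR => //; rewrite mulr_ge0.
  move=> /(ler_wpM2l (expR_ge0 (- (y * r)))) h; apply: le_trans h _.
  rewrite big_split/= prodr_const -natrX -expR_sum mulrCA -expRD.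
  rewrite le_eqVlt; apply/orP; left; apply/eqP; congr (_ * expR _).
    by have -> : #|{: array}| = (#|row| ^ #|L|)%N by exact: card_ffun.
  rewrite big_split/= -mulr_sumr.
  have -> : \sum_i 2 * (y * b i) ^+ 2 * m%:R = 2 * y ^+ 2 * m%:R * \sum_p b p ^+ 2.
    by rewrite mulr_sumr; apply: eq_bigr => p _; ring.
  ring.
move=> o _; rewrite -expR_sum -expRD; congr expR.
by rewrite mulrBr mulr_sumr addrC; congr (_ + _); apply: eq_bigr => p _; rewrite mulrA.
Qed.

End sign_array.

(** * The random trigonometric polynomial and its Bayes risk *)

Section prior.
Context d (Omega : measurableType d) (R : realType) (P : probability Omega R).
Variable w : R -> {RV P >-> R}.
Hypothesis hw : standard_brownian w.
Variables (n : nat) (sigma : R).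
Hypotheses (n0 : (0 < n)%N) (sigma0 : 0 < sigma).
Variables (N m : nat) (x : nat -> R).
Hypotheses (m0 : (0 < m)%N) (x0 : forall l, 0 <= x l).

Let v : R := n%:R / sigma ^+ 2.
Let L := ('I_N * bool)%type.
Let E := (L * 'I_m)%type.
Let tidx (p : L) : nat * bool := (nat_of_ord p.1, p.2).

(** A coefficient, [m] signs times this, has variance [2 * x l / v]. As [2 / v] is the variance of
    the noise on a coefficient in the unnormalized trigonometric basis, [x l] is the signal-to-noise
    ratio of the frequency. *)
Definition amplitude (l : nat) : R := Num.sqrt (2 * (x l / m%:R) / v).

(* The sum of sign_moment K (p, i) (p, j) over j, for p of frequency l. *)
Definition variance_factor (l : nat) : R :=
  expR (x l / m%:R) + (m%:R - 1) * ((expR (x l / m%:R) - expR (- (x l / m%:R))) / 2).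

Definition random_coef (o : array L m) (p : L) : R :=
  amplitude p.1 * \sum_i row_sign R (o p) i.

(* The drift of an observation vanishes at negative times. *)
Let direction (e : E) (u : R) : R := amplitude e.1.1 * trig_prim (tidx e.1) (Num.max u 0).

Let v0 : 0 < v.
Proof. by rewrite divr_gt0 ?ltr0n// exprn_gt0. Qed.

Let mR : 0 < m%:R :> R.
Proof. by rewrite ltr0n. Qed.

Lemma amplitude_sqr l : amplitude l ^+ 2 = 2 * (x l / m%:R) / v.
Proof. by rewrite sqr_sqrtr// divr_ge0 ?(ltW v0)// mulr_ge0// divr_ge0. Qed.

Lemma amplitude_ge0 l : 0 <= amplitude l.
Proof. exact: sqrtr_ge0. Qed.

Lemma variance_factor_gt0 l : 0 < variance_factor l.
Proof.
rewrite /variance_factor ltr_pwDl ?expR_gt0//.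
apply: mulr_ge0; first by rewrite subr_ge0 ler1n.
by rewrite divr_ge0// subr_ge0 ler_expR lerNl -subr_ge0 opprK addr_ge0// divr_ge0.
Qed.

(** Limit of the grid products: orthogonality separates the coefficients, and within one of them the
    value is the squared amplitude times [v / 2], whatever the indices of the signs. *)
Let K (e e' : E) : R := if e.1 == e'.1 then x e.1.1 / m%:R else 0.

Let direction0 e : direction e 0 = 0.
Proof. by rewrite /direction maxxx trig_prim0 mulr0. Qed.

Let grid_direction (eps : R) : 0 < eps -> exists2 dl : R, 0 < dl &
  forall t M, is_grid n t M dl -> forall e e',
    `|grid_product t M sigma (direction e) (direction e') - K e e'| <= eps.
Proof.
move=> eps0.
have : \forall dl \near (0 : R)^'+, forall ee : E * E, forall t M, is_grid n t M dl ->
    `|grid_product t M sigma (direction ee.1) (direction ee.2) - K ee.1 ee.2| <= eps.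
  apply: filter_forall => -[e e'].
  pose c := amplitude e.1.1 * amplitude e'.1.1.
  have c0 : 0 <= c by rewrite mulr_ge0 ?amplitude_ge0.
  have c1 : 0 < c + 1 by rewrite ltr_wpDl.
  (* [c + 1] instead of [c], since an amplitude may vanish. *)
  have [dl dl0 hdl] := grid_product_cvg (tidx e.1) (tidx e'.1) sigma0 n0 (divr_gt0 eps0 c1).
  apply: (filterS _ (nbhs_right_le dl0)) => dl' dle t M tM.
  have {hdl} := hdl t M dl' tM dle.
  have -> : grid_product t M sigma (direction e) (direction e') =
      c * grid_product t M sigma (trig_prim (tidx e.1)) (trig_prim (tidx e'.1)).
    rewrite /grid_product mulr_sumr; apply: eq_bigr => i _.
    have t1 : 0 <= t i by have /andP[] := grid_le tM (ltnW (ltn_ord i)).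
    have t2 : 0 <= t i.+1 by have /andP[] := grid_le tM (ltn_ord i).
    by rewrite /increment /direction !max_l// /c; ring.
  have -> : K e e' = c * (n%:R / 2 * (tidx e.1 == tidx e'.1)%:R / sigma ^+ 2).
    rewrite /K; have -> : (tidx e.1 == tidx e'.1) = (e.1 == e'.1).
      by case: e.1 e'.1 => [l b] [k b']; rewrite !xpair_eqE.
    case: eqP => [ee|_]; last by rewrite mulr0 mul0r mulr0.
    rewrite /c -ee -expr2 amplitude_sqr /v mulr1; field.
    by rewrite !gt_eqF// ltr0n.
  rewrite -mulrBr normrM (ger0_norm c0) => h.
  apply: le_trans (ler_wpM2l c0 h) _.
  rewrite mulrCA ler_piMr ?(ltW eps0)// ler_pdivrMr// mul1r lerDl//.
move=> /(filterI (nbhs_right_gt 0))/filter_ex[dl [/= dl0 hdl]].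
by exists dl => // t M tM e e'; exact: (hdl (e, e')).
Qed.

Let sum_array (F : L -> 'I_m -> R) : \sum_(e : E) F e.1 e.2 = \sum_p \sum_i F p i.
Proof. by rewrite pair_big. Qed.

Lemma sum_direction (o : array L m) u :
  \sum_e array_sign R o e * direction e u =
  \sum_p random_coef o p * trig_prim (tidx p) (Num.max u 0).
Proof.
rewrite (sum_array (fun p i => array_sign R o (p, i) * direction (p, i) u)).
apply: eq_bigr => p _; rewrite /random_coef mulr_sumr mulr_suml.
by apply: eq_bigr => i _; rewrite /array_sign /direction/=; ring.
Qed.

Lemma tpoly_random_coef (o : array L m) t :
  tpoly (random_coef o) t = \sum_(e : E) array_sign R o e * (amplitude e.1.1 * trig (tidx e.1) t).
Proof.
rewrite (sum_array (fun p i => array_sign R o (p, i) * (amplitude p.1 * trig (tidx p) t))).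
apply: eq_bigr => p _; rewrite /random_coef mulr_sumr mulr_suml.
by apply: eq_bigr => i _; rewrite /array_sign/=; ring.
Qed.

Lemma tpoly_random_coef_le (o : array L m) t :
  `|tpoly (random_coef o) t| <= \sum_(e : E) amplitude e.1.1.
Proof.
rewrite tpoly_random_coef; apply: le_trans (ler_norm_sum _ _ _) _; apply: ler_sum => e _.
rewrite !normrM (ger0_norm (amplitude_ge0 _)).
have -> : `|array_sign R o e| = 1 by case: (array_sign_pm R o e) => ->; rewrite ?normrN normr1.
by rewrite mul1r ler_piMr ?amplitude_ge0// trig_le1.
Qed.

(** As [m] grows this approaches the sum of [2 / v * x l / (1 + x l)], the Bayes risk for
    independent Gaussian coefficients. *)
Definition bayes_value : R := \sum_(l < N) 2 * x l / v / variance_factor l.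

(** With the multipliers [u] the quadratic form equals the linear one, so the bound is the sum of
    [u e * psi e]. The cosine and the sine of a frequency contribute together a sum of squares equal
    to 1, which removes [t]. *)
Lemma array_bayes (f : path_space R n -> R) (C t : R) :
  measurable_fun setT f -> (forall y, `|f y| <= C) ->
  ((#|{: array L m}|%:R * bayes_value)%:E <=
   \sum_(o : array L m) \int[P]_om ((f (noisy w sigma
     (fun u => (\sum_p random_coef o p * trig_prim (tidx p) (Num.max u 0))%R) om)
      - tpoly (random_coef o) t) ^+ 2)%:E)%E.
Proof.
move=> mf fC.
pose psi (e : E) := amplitude e.1.1 * trig (tidx e.1) t.
(* Stationary point of the quadratic bound: [psi] does not depend on the index of the sign, so the
   matrix of sign moments acts on it as multiplication by [variance_factor]. *)
pose u (e : E) := psi e / variance_factor e.1.1.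
have := bayes_bound hw n0 sigma0 (@array_sign_pm R L m) (@array_flipK L m)
  (@array_sign_flip R L m) direction0 grid_direction psi u mf fC.
have -> : \sum_e \sum_e' u e * u e' * sign_moment K e e' = \sum_e u e * psi e.
  rewrite (sum_array (fun p i => \sum_e' u (p, i) * u e' * sign_moment K (p, i) e')).
  rewrite (sum_array (fun p i => u (p, i) * psi (p, i))).
  apply: eq_bigr => p _.
  have inner i : \sum_e' u (p, i) * u e' * sign_moment K (p, i) e' = u (p, i) * psi (p, i).
    rewrite (sum_array (fun q j => u (p, i) * u (q, j) * sign_moment K (p, i) (q, j))).
    rewrite (bigD1 p)//= [X in _ + X]big1 ?addr0 => [|q qp]; last first.
      rewrite big1// => j _; rewrite /sign_moment xpair_eqE eq_sym (negbTE qp)/=.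
      by rewrite /K/= eq_sym (negbTE qp) oppr0 subrr mul0r mulr0.
    rewrite (bigD1 i)//= /sign_moment eqxx /K/= eqxx.
    rewrite (eq_bigr (fun=> u (p, i) * u (p, i) * ((expR (x p.1 / m%:R) - expR (- (x p.1 / m%:R))) / 2))); last first.
      by move=> j ji; rewrite xpair_eqE eqxx/= eq_sym (negbTE ji).
    rewrite sumr_const cardC1 card_ord -[_ *+ m.-1]mulr_natr.
    have -> : (m.-1)%:R = m%:R - 1 :> R by rewrite -subn1 natrB.
    transitivity (u (p, i) * (u (p, i) * variance_factor p.1)).
      by rewrite /variance_factor; ring.
    by rewrite {2}/u/= divfK// gt_eqF// variance_factor_gt0.
  by apply: eq_bigr => i _; rewrite inner.
have -> : 2 * (\sum_e u e * psi e) - \sum_e u e * psi e = bayes_value.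
  rewrite (_ : 2 * _ - _ = \sum_e u e * psi e); last by ring.
  rewrite (sum_array (fun p i => u (p, i) * psi (p, i))).
  rewrite (eq_bigr (fun p => m%:R * (psi (p, Ordinal m0) ^+ 2 / variance_factor p.1))); last first.
    move=> p _; rewrite (eq_bigr (fun=> psi (p, Ordinal m0) ^+ 2 / variance_factor p.1)).
      by rewrite sumr_const card_ord mulr_natl.
    by move=> i _; rewrite /u /psi/=; ring.
  rewrite sum_pair_bool; apply: eq_bigr => l _; rewrite /psi /trig/=.
  have -> : 2 * x l / v / variance_factor l = m%:R * (amplitude l ^+ 2 / variance_factor l) *
      (cos (freq R l * t) ^+ 2 + sin (freq R l * t) ^+ 2).
    by rewrite cos2Dsin2 amplitude_sqr; field; rewrite !gt_eqF ?variance_factor_gt0.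
  by ring.
move=> h; apply: le_trans h _; apply: lee_sum => o _.
rewrite tpoly_random_coef le_eqVlt; apply/orP; left; apply/eqP.
apply: eq_integral => om _; congr ((f (noisy _ _ _ _) - _) ^+ 2)%:E.
by apply/funext => z; exact: sum_direction.
Qed.

End prior.

(** * From the Bayes risk to the minimax risk over the Sobolev ball *)

Section minimax.
Context d (Omega : measurableType d) (R : realType) (P : probability Omega R).
Variable w : R -> {RV P >-> R}.
Hypothesis hw : standard_brownian w.
Variables (n : nat) (sigma : R).
Hypotheses (n0 : (0 < n)%N) (sigma0 : 0 < sigma).
Variables (Lj : R -> Omega -> R) (tau Y : nat -> Omega -> R) (ctau lo hi : R).
Hypotheses (hlo : lo <= hi) (hhi : sigma ^+ 2 = hi).

Lemma brownian_in_family : exists2 Q : probability (path_space R n) R,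
  noise_family P w Lj tau Y ctau lo hi n Q &
  forall f : path_space R n -> \bar R, measurable_fun setT f -> (forall y, (0 <= f y)%E) ->
    (\int[Q]_y f y = \int[P]_om f (noisy w sigma (fun=> 0%R) om))%E.
Proof.
pose X : {mfun Omega >-> path_space R n} := HB.pack (noisy w sigma (fun=> 0%R) : Omega -> path_space R n)
  (isMeasurableFun.Build _ _ _ _ _ (@measurable_noisy_path _ _ _ P w n sigma (fun=> 0%R))).
exists (distribution P X); last by move=> f mf f0; rewrite ge0_integral_distribution.
(* No compound jump process, and a Levy process reduced to its Brownian part; the two constrained
   variances are then both [sigma ^+ 2]. *)
exists sigma, 0, 1; split.
- by rewrite hhi hlo lexx.
- by rewrite ler01 lexx.
- by rewrite expr0n/= mul0r addr0 hhi hlo lexx.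
move=> A mA; rewrite /distribution /pushforward; congr (P _).
apply/seteqP; split => om /=; rewrite /noisy /noise => h.
  congr (A _) : h; apply/funext => u.
  by rewrite expr1n subrr sqrtr0 mul0r mul0r !addr0 mul1r add0r.
congr (A _) : h; apply/funext => u.
by rewrite expr1n subrr sqrtr0 mul0r mul0r !addr0 mul1r add0r.
Qed.

Lemma measurable_observation (S : R -> R) :
  measurable_fun setT (observation S : path_space R n -> path_space R n).
Proof.
apply: (@measurability _ _ _ (path_space R n) setT _ (@coordinate_sets R n) erefl).
move=> _ [_ [u [B [un mB ->]]] <-].
have mu : measurable_fun setT (fun y : path_space R n => y u : R).
  by move=> _ C mC; rewrite setTI; apply: sub_sigma_algebra; exists u, C.
have mo : measurable_fun setT (fun y : path_space R n =>
    (\int[lebesgue_measure]_(s in `[0, u]) S s)%R + y u) by exact: measurable_funD.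
exact: mo.
Qed.

(** Projection on [[- C, C]]: it brings an estimator closer to any signal bounded by [C], and makes
    it bounded. *)
Definition clip (C a : R) : R := Num.max (- C) (Num.min C a).

Lemma clip_le C a : 0 <= C -> `|clip C a| <= C.
Proof.
move=> C0; rewrite ler_norml /clip le_max lexx/= ge_max ge_min lexx/= andbT.
by rewrite (le_trans _ C0)// oppr_le0.
Qed.

Lemma clip_sqr_le C a s : `|s| <= C -> (clip C a - s) ^+ 2 <= (a - s) ^+ 2.
Proof.
rewrite ler_norml => /andP[s1 s2]; rewrite /clip.
rewrite -[leRHS]real_normK ?num_real// -[leLHS]real_normK ?num_real//.
rewrite lerXn2r ?nnegrE//.
case: (leP C a) => aC.
  by rewrite max_r ?ger0_norm; lra.
case: (leP (- C) a) => c1; first exact: lexx.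
by rewrite !ler0_norm; lra.
Qed.

Variables (N m : nat) (x : nat -> R).
Hypotheses (m0 : (0 < m)%N) (x0 : forall l, 0 <= x l).
Let v : R := n%:R / sigma ^+ 2.
Let L := ('I_N * bool)%type.
Let T := array L m.
Let coef (o : T) := random_coef n sigma x o.
Let B : R := \sum_(e : L * 'I_m) amplitude n sigma m x e.1.1.

Let v0 : 0 < v.
Proof. by rewrite divr_gt0 ?ltr0n// exprn_gt0. Qed.

Lemma observation_tpoly (o : T) om :
  observation (tpoly (coef o)) (noisy w sigma (fun=> 0) om) =
  noisy w sigma (fun u => \sum_p coef o p * trig_prim (nat_of_ord p.1, p.2) (Num.max u 0)) om.
Proof.
apply/funext => u; rewrite /observation /noisy add0r; congr (_ + _) => /=.
have [u0|u0] := leP 0 u; first by rewrite tpoly_integral.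
rewrite set_itv_ge ?Rintegral_set0; last by rewrite bnd_simp -ltNge.
by rewrite big1// => p _; rewrite trig_prim0 mulr0.
Qed.

Definition sobolev_weight (k : nat) (p : L) : R :=
  (\sum_(j < k.+1) freq R p.1 ^+ j.*2) * x p.1 / v.

Lemma good_sobolev k r (o : T) :
  \sum_p sobolev_weight k p * energy R (o p) <= r -> sobolev_ball k r (tpoly (coef o)).
Proof.
move=> h; apply: tpoly_sobolev; apply: le_trans h; rewrite sum_pair_bool mulr_sumr.
rewrite le_eqVlt; apply/orP; left; apply/eqP; apply: eq_bigr => l _.
rewrite /coef /random_coef /sobolev_weight /energy/= !exprMn amplitude_sqr//.
have mR : 0 < m%:R :> R by rewrite ltr0n.
by rewrite -/v; field; rewrite !gt_eqF.
Qed.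

(** The supremum dominates the risk at each signal of the prior lying in the ball, while the Bayes
    bound controls the sum over all signals. The others, a fraction [eps] at most, are charged the
    maximal loss of a clipped estimator. *)
Lemma minimax_lower_bound k r eps (Sh : path_space R n -> R -> R) :
  0 <= r -> estimators R n Sh ->
  #|[pred o : T | r < \sum_p sobolev_weight k p * energy R (o p)]|%:R <= eps * #|{: T}|%:R ->
  0 <= bayes_value n sigma N m x - 4 * B ^+ 2 * eps ->
  ((bayes_value n sigma N m x - 4 * B ^+ 2 * eps)%:E <=
   ereal_sup [set robust_risk (noise_family P w Lj tau Y ctau lo hi n) Sh S
             | S in sobolev_ball k r])%E.
Proof.
move=> r0 mSh hbad hpos; set s := ereal_sup _; set V := bayes_value _ _ _ _ _.
have [Q QF QE] := brownian_in_family.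
have B0 : 0 <= B by apply: sumr_ge0 => e _; exact: amplitude_ge0.
pose D01 := [set: path_space R n] `*` [set t : measurableTypeR R | 0 <= t <= 1].
have mI : measurable [set t : measurableTypeR R | 0 <= t <= 1].
  have -> : [set t : measurableTypeR R | 0 <= t <= 1] = `[0, 1]%classic.
    by apply/seteqP; split => t /=; rewrite in_itv.
  exact: (@measurable_itv R `[0, 1]).
have mD : measurable D01 by exact: measurableX.
(* An estimator is jointly measurable only for times in the unit interval; its extension by zero is
   measurable everywhere. *)
pose G (p : path_space R n * measurableTypeR R) : measurableTypeR R :=
  ((fun q => Sh q.1 q.2 : measurableTypeR R) \_ D01) p.
have mG : measurable_fun setT G.
  exact: ((measurable_restrictT _ mD).1 mSh).
have GE y t : 0 <= t <= 1 -> G (y, t) = Sh y t.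
  by move=> t01; rewrite /G patchE mem_set.
pose I01 : set (measurableTypeR R) := [set t | 0 <= t <= 1].
have leb1 : lebesgue_measure I01 = 1%E.
  have -> : I01 = `[0%R, 1%R]%classic by apply/seteqP; split => t /=; rewrite in_itv.
  by rewrite lebesgue_measure_itv/= lte_fin ltr01 oppr0 adde0.
have s_risk S : sobolev_ball k r S -> (risk Q Sh S <= s)%E.
  move=> hS; apply: (@le_trans _ _ (robust_risk (noise_family P w Lj tau Y ctau lo hi n) Sh S)).
    by apply: ereal_sup_ubound; exists Q.
  by apply: ereal_sup_ubound; exists S.
(* The zero signal is in the ball. Nonnegativity allows the number of good signals to be replaced by
   [#|T|] at the end. *)
have s0 : (0 <= s)%E.
  apply: (@le_trans _ _ (risk Q Sh (@tpoly R N (fun=> 0%R)))); last first.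
    apply: s_risk; apply: tpoly_sobolev; rewrite big1 ?mulr0// => l _.
    by rewrite expr0n/= addr0 mulr0.
  by apply: integral_ge0 => y _; apply: integral_ge0 => t _; rewrite lee_fin sqr_ge0.
pose X (o : T) om : path_space R n := noisy w sigma (fun u =>
  \sum_p coef o p * trig_prim (nat_of_ord p.1, p.2) (Num.max u 0)) om.
have mX o : measurable_fun setT (X o) by exact: measurable_noisy_path.
have mS (o : T) : measurable_fun setT (tpoly (coef o)).
  by apply: continuous_measurable_fun; exact: tpoly_continuous.
have mS2 d' (T' : measurableType d') (o : T) :
    measurable_fun setT (fun q : T' * measurableTypeR R => tpoly (coef o) q.2).
  exact: (measurableT_comp (mS o) measurable_snd).
have mI2 d' (T' : measurableType d') :
    measurable_fun setT (fun q : T' * measurableTypeR R => \1_I01 q.2 : R).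
  exact: (measurableT_comp (measurable_indic mI) measurable_snd).
have mclip : measurable_fun setT (clip B).
  by apply: measurable_maxr => //; exact: measurable_minr.
pose Z (o : T) (q : Omega * measurableTypeR R) : \bar R :=
  (\1_I01 q.2 * (clip B (G (X o q.1, q.2)) - tpoly (coef o) q.2) ^+ 2)%:E.
have Z0 o q : (0 <= Z o q)%E by rewrite lee_fin mulr_ge0 ?sqr_ge0.
have mZ o : measurable_fun setT (Z o).
  apply/measurable_EFinP/measurable_funM; first exact: mI2.
  apply: measurable_funX; apply: measurable_funB; last exact: mS2.
  apply: (measurableT_comp mclip); apply: (measurableT_comp mG).
  apply: measurable_fun_pair; last exact: measurable_snd.
  exact: (measurableT_comp (mX o) measurable_fst).
pose good (o : T) := \sum_p sobolev_weight k p * energy R (o p) <= r.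
have good_le o : good o -> (\int[lebesgue_measure]_t \int[P]_om Z o (om, t) <= s)%E.
  move=> /good_sobolev/s_risk; apply: le_trans.
  (* The Bayes bound holds time by time, whereas the risk integrates over time first. *)
  rewrite -(fubini_tonelli (m1 := P) (m2 := lebesgue_measure) (Z o))//.
  pose W (q : path_space R n * measurableTypeR R) : \bar R :=
    (\1_I01 q.2 * (G (observation (tpoly (coef o)) q.1, q.2) - tpoly (coef o) q.2) ^+ 2)%:E.
  have W0 q : (0 <= W q)%E by rewrite lee_fin mulr_ge0 ?sqr_ge0.
  have mW : measurable_fun setT W.
    apply/measurable_EFinP/measurable_funM; first exact: mI2.
    apply: measurable_funX; apply: measurable_funB; last exact: mS2.
    apply: (measurableT_comp mG).
    apply: measurable_fun_pair; last exact: measurable_snd.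
    exact: (measurableT_comp (measurable_observation _) measurable_fst).
  have mF := measurable_fun_fubini_tonelli_F (m2 := lebesgue_measure) W mW W0.
  have -> : risk Q Sh (tpoly (coef o)) = (\int[Q]_y \int[lebesgue_measure]_t W (y, t))%E.
    apply: eq_integral => y _; rewrite integral_mkcond; apply: eq_integral => t _.
    rewrite patchE /W/= indicE.
    have -> : (t \in I01) = (t \in `[0%R, 1%R]%classic).
      by apply/idP/idP; rewrite !inE /I01 /= ?in_itv.
    case: ifPn => t01; last by rewrite mul0r.
    by rewrite mul1r GE//; move: t01; rewrite inE/= in_itv.
  rewrite QE//; last by move=> y; exact: integral_ge0.
  apply: ge0_le_integral => //.
  - by move=> om _; exact: integral_ge0.
  - exact: (measurable_fun_fubini_tonelli_F (m2 := lebesgue_measure) (Z o) (mZ o) (Z0 o)).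
  - by apply: (measurableT_comp mF); exact: measurable_noisy_path.
  move=> om _; apply: ge0_le_integral => //.
  - exact: (measurableT_comp (mZ o) (pair1_measurable om)).
  - exact: (measurableT_comp mW (pair1_measurable _)).
  move=> t _; rewrite /W /Z/= lee_fin ler_wpM2l// observation_tpoly.
  by apply: clip_sqr_le; exact: tpoly_random_coef_le.
pose c := V - 4 * B ^+ 2 * eps.
have mZP o : measurable_fun setT (fun t => \int[P]_om Z o (om, t))%E.
  exact: (measurable_fun_fubini_tonelli_G (m1 := P) (Z o) (mZ o) (Z0 o)).
pose gs := [seq o <- index_enum T | good o].
have key t : ((\1_I01 t * (#|{: T}|%:R * c))%:E <= \sum_(o <- gs) \int[P]_om Z o (om, t))%E.
  rewrite /gs big_filter.
  have [t01|t01] := boolP (t \in I01); last first.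
    by rewrite indicE (negbTE t01) mul0r; apply: sume_ge0 => o _; exact: integral_ge0.
  rewrite indicE t01 mul1r.
  have mGt : measurable_fun setT (fun y : path_space R n => clip B (G (y, t))).
    by apply: (measurableT_comp mclip); exact: (measurableT_comp mG (pair2_measurable t)).
  have ZE o : (\int[P]_om Z o (om, t) =
      \int[P]_om ((clip B (G (X o om, t)) - tpoly (coef o) t) ^+ 2)%:E)%E.
    by apply: eq_integral => om _; rewrite /Z/= indicE t01 mul1r.
  have := array_bayes hw n0 sigma0 N m0 x0 t mGt (fun y => clip_le (G (y, t)) B0).
  rewrite (eq_bigr (fun o => \int[P]_om Z o (om, t))%E) => [|o _]; last by rewrite ZE.
  rewrite (bigID good)/=.
  have : (\sum_(o | ~~ good o) \int[P]_om Z o (om, t) <= (#|{: T}|%:R * (4 * B ^+ 2 * eps))%:E)%E.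
    (* The clipped estimator and the signal both lie in [[- B, B]]. *)
    apply: (@le_trans _ _ (\sum_(o | ~~ good o) (4 * B ^+ 2)%:E)%E).
      apply: lee_sum => o _; rewrite ZE.
      apply: (@le_trans _ _ (\int[P]_om (4 * B ^+ 2)%:E)%E); last first.
        by rewrite integral_cst// [X in (_ * X)%E](@probability_setT _ _ _ P) mule1.
      apply: ge0_le_integral => //.
      - by move=> om _; rewrite lee_fin sqr_ge0.
      - apply/measurable_EFinP/measurable_funX/measurable_funB => //.
        exact: (measurableT_comp mGt (mX o)).
      move=> om _; rewrite lee_fin.
      have := clip_le (G (X o om, t)) B0.
      have := tpoly_random_coef_le n sigma x o t; rewrite -/B -/(coef o).
      move: (clip B _) (tpoly _ _) => a b.
      rewrite !ler_norml => /andP[b1 b2] /andP[a1 a2].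
      have -> : 4 * B ^+ 2 = (2 * B) ^+ 2 by ring.
      rewrite -[leLHS]real_normK ?num_real// lerXn2r ?nnegrE ?mulr_ge0//.
      by rewrite ler_norml; lra.
    rewrite sumEFin lee_fin sumr_const -[_ *+ _]mulr_natl.
    rewrite (_ : #|{: T}|%:R * _ = eps * #|{: T}|%:R * (4 * B ^+ 2)); last by ring.
    rewrite ler_wpM2r ?mulr_ge0 ?sqr_ge0//; apply: le_trans hbad.
    rewrite le_eqVlt; apply/orP; left; apply/eqP; congr (_%:R).
    by apply: eq_card => o; rewrite !inE unfold_in /= /good -ltNge.
  move=> hb ha; rewrite /c mulrBr EFinB leeBlDr//.
  by apply: le_trans ha _; rewrite leeD2l.
have T0 : 0 < #|{: T}|%:R :> R.
  rewrite ltr0n; apply/card_gt0P; exists [ffun=> [ffun=> true]]; by [].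
have : ((#|{: T}|%:R * c)%:E <= #|{: T}|%:R%:E * s)%E.
  apply: (@le_trans _ _ (\int[lebesgue_measure]_t (\1_I01 t * (#|{: T}|%:R * c))%:E)%E).
    under eq_integral do rewrite EFinM muleC.
    rewrite ge0_integralZl//=; [|by apply/measurable_EFinP/measurable_indic|by rewrite lee_fin mulr_ge0// ltW].
    rewrite integral_indic// setIT.
    by rewrite [X in (_ * X)%E]leb1 mule1.
  apply: (@le_trans _ _ (\int[lebesgue_measure]_t \sum_(o <- gs) \int[P]_om Z o (om, t))%E).
    apply: ge0_le_integral => //.
    - by move=> t _; rewrite lee_fin mulr_ge0// mulr_ge0// ltW.
    - by apply/measurable_EFinP/measurable_funM => //; exact: measurable_indic.
    - exact: emeasurable_sum.
  rewrite ge0_integral_sum//; last by move=> o t _; exact: integral_ge0.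
  apply: (@le_trans _ _ (\sum_(o | good o) s)%E).
    by rewrite /gs big_filter; apply: lee_sum => o; exact: good_le.
  case: s s0 {s_risk good_le} => [a|_|//]; last by rewrite gt0_muley ?leey// lte_fin.
  rewrite lee_fin => a0; rewrite sumEFin -EFinM lee_fin sumr_const -[_ *+ _]mulr_natl.
  by rewrite ler_wpM2r// ler_nat max_card.
by rewrite EFinM lee_pmul2l.
Qed.

End minimax.

(** * Power sums, Pinsker's constant and large-parameter estimates *)

Section asymptotics.
Context (R : realType).
Implicit Types (q k N m : nat).

(** Factor the difference of powers and bound each factor. Telescoped, this compares a power sum
    with its integral. *)
Lemma succ_pow_bounds (a : R) q : 0 <= a ->
  q.+1%:R * a ^+ q <= (a + 1) ^+ q.+1 - a ^+ q.+1 <= q.+1%:R * (a + 1) ^+ q.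
Proof.
move=> a0; rewrite subrXX addrC addKr mul1r.
have a1 : a <= a + 1 by rewrite lerDl.
have a10 : 0 <= a + 1 by rewrite addr_ge0.
apply/andP; split.
  rewrite -[q.+1 in leLHS]card_ord mulr_natl -sumr_const; apply: ler_sum => i _.
  rewrite -{1}(subnK (leq_ord i)) exprD /= ler_wpM2r ?exprn_ge0//.
  by rewrite lerXn2r ?nnegrE.
rewrite -[q.+1 in leRHS]card_ord mulr_natl -sumr_const; apply: ler_sum => i _.
rewrite -[in leRHS](subnK (leq_ord i)) exprD /= ler_wpM2l ?exprn_ge0//.
by rewrite lerXn2r ?nnegrE.
Qed.

Lemma sum_pow_le q N :
  \sum_(l < N) l.+1%:R ^+ q <= N%:R ^+ q.+1 / q.+1%:R + N%:R ^+ q :> R.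
Proof.
have q0 : 0 < q.+1%:R :> R by rewrite ltr0n.
elim: N => [|N IH]; first by rewrite big_ord0 expr0n/= mul0r add0r exprn_ge0.
rewrite big_ord_recr/= lerD2r; apply: le_trans IH _.
have /andP[h _] := @succ_pow_bounds N%:R q (ler0n _ _); rewrite natr1 in h.
by rewrite -lerBrDl -mulrBl ler_pdivlMr// mulrC.
Qed.

Lemma sum_pow_ge q N :
  N%:R ^+ q.+1 / q.+1%:R <= \sum_(l < N) l.+1%:R ^+ q :> R.
Proof.
have q0 : 0 < q.+1%:R :> R by rewrite ltr0n.
elim: N => [|N IH]; first by rewrite big_ord0 expr0n/= mul0r.
rewrite big_ord_recr/=; apply: le_trans (lerD IH (lexx _)).
have /andP[_ h] := @succ_pow_bounds N%:R q (ler0n _ _); rewrite natr1 in h.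
by rewrite -lerBlDl -mulrBl ler_pdivrMr// mulrC.
Qed.

(* The signal-to-noise ratio v and the cutoff N of Pinsker's weights are related
   by N ^+ (2 k + 1) = pinsker_scale k r * v. *)
Definition pinsker_scale k (r : R) : R :=
  r * k.+1%:R * (k.*2.+1)%:R / (2 * k%:R * (2 * pi) ^+ k.*2).

Lemma root_powR (a : R) q : 0 < a -> (0 < q)%N -> (a `^ (1 / q%:R)) ^+ q = a.
Proof.
move=> a0 q0; rewrite -powR_mulrn ?powR_ge0// -powRrM div1r mulVf ?powRr1 ?ltW//.
by rewrite pnatr_eq0 -lt0n.
Qed.

Lemma powR_root (a : R) q j : 0 < a -> (0 < q)%N ->
  a `^ (j%:R / q%:R) = (a `^ (1 / q%:R)) ^+ j.
Proof.
move=> a0 q0; rewrite -powR_mulrn ?powR_ge0// -powRrM; congr (_ `^ _).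
by rewrite div1r mulrC.
Qed.

Lemma pinsker_scale_gt0 k r : (1 <= k)%N -> 0 < r -> 0 < pinsker_scale k r.
Proof.
move=> k1 r0; rewrite /pinsker_scale divr_gt0//.
  by rewrite !mulr_gt0// ltr0n.
by rewrite !mulr_gt0// ?ltr0n// exprn_gt0// mulr_gt0// pi_gt0.
Qed.

(** The right-hand side is what the prior delivers: its risk is about [2 / v * N * k / (k + 1)] with
    [N] tied to [v] by [pinsker_scale], and the power of [v] cancels the normalization. The proof
    compares powers of order [2 k + 1]. *)
Lemma pinsker_constantE k r : (1 <= k)%N -> 0 < r ->
  pinsker_constant k r =
  2 * pinsker_scale k r `^ (1 / (k.*2.+1)%:R) * (k%:R / k.+1%:R).
Proof.
move=> k1 r0; have c0 := pinsker_scale_gt0 k1 r0.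
have kR : 0 < k%:R :> R by rewrite ltr0n.
have k1R : 0 < k.+1%:R :> R by rewrite ltr0n.
have pR : 0 < pi :> R := pi_gt0 R.
have d0 : 0 < (k.*2.+1)%:R * r by rewrite mulr_gt0// ltr0n.
have e0 : 0 < k%:R / (k.+1%:R * pi) :> R by rewrite divr_gt0// mulr_gt0.
have p0 : (0 < k.*2.+1)%N by [].
apply: (@pexpIrn _ k.*2.+1) => //.
- by rewrite nnegrE mulr_ge0// powR_ge0.
- by rewrite nnegrE mulr_ge0// ?divr_ge0// mulr_ge0// powR_ge0.
rewrite /pinsker_constant !exprMn root_powR// powR_root// -exprM mulnC exprM root_powR//.
rewrite root_powR// /pinsker_scale !exprMn !exprVn !exprMn !exprS.
by field; rewrite !gt_eqF// ?exprn_gt0// mulr_gt0.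
Qed.

(** With [y = x l / m], the factor is [1 + m y] up to terms of order [m y^2 = y * x l], which
    [dl * x l] absorbs once [m] is a large multiple of [X / dl]. *)
Lemma variance_factor_le m (x : nat -> R) l (X dl : R) :
  (0 < m)%N -> 0 <= x l -> x l <= X -> 0 < dl -> 2 * X <= m%:R -> 3 * X / dl <= m%:R ->
  variance_factor m x l <= (1 + x l) * (1 + dl).
Proof.
move=> m0 xl0 xX dl0 m1 m2; have mR : 0 < m%:R :> R by rewrite ltr0n.
rewrite /variance_factor; set y := x l / m%:R.
have y0 : 0 <= y by rewrite divr_ge0.
have my : m%:R * y = x l by rewrite /y; field; rewrite gt_eqF.
have y1 : y <= 1 / 2 by rewrite ler_pdivrMr//; lra.
have e1 := expR_le_quadratic (introT andP (conj y0 y1)).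
have e2 := expR_ge1Dx (- y).
have m11 : 1 <= m%:R :> R by rewrite ler1n.
have h : (m%:R - 1) * ((expR y - expR (- y)) / 2) <= (m%:R - 1) * (y + y ^+ 2).
  by apply: ler_wpM2l; lra.
have xy : 3 * y * x l <= dl * x l.
  apply: ler_wpM2r => //; rewrite /y mulrA ler_pdivrMr//.
  move: m2; rewrite ler_pdivrMr// => m2.
  have : 3 * x l <= 3 * X by lra.
  lra.
have y2 : 0 <= y ^+ 2 by rewrite sqr_ge0.
have y3 : y ^+ 2 <= m%:R * y ^+ 2 by rewrite ler_peMl.
have my2 : m%:R * y ^+ 2 = y * x l by rewrite -my; ring.
have dx : 0 <= dl * x l by rewrite mulr_ge0// ltW.
by move: h xy; rewrite mulrBl mulrDl !mulrDr; lra.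
Qed.

(** The derivative of order [k] dominates: each of the [k] lower terms is at most [freq R l ^+ k.*2]
    divided by [freq R l ^+ 2], itself at least [k / dl]. *)
Lemma sobolev_freq_le k (l : nat) (dl : R) : (1 <= k)%N -> 0 < dl ->
  k%:R / dl <= l.+1%:R ^+ 2 ->
  \sum_(j < k.+1) freq R l ^+ j.*2 <= (1 + dl) * freq R l ^+ k.*2.
Proof.
move=> k1 dl0 hl; have f1 : 1 <= freq R l.
  rewrite /freq; apply: (@le_trans _ _ (2 * 1 * 1)); first by lra.
  apply: ler_pM => //; last by rewrite ler1n.
  by rewrite ler_pM2l// (le_trans _ (pi_ge2 R))// ler1n.
have f0 : 0 < freq R l := freq_gt0 R l.
rewrite big_ord_recr/= mulrDl mul1r addrC lerD2l.
case: k k1 hl => // k _ hl.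
apply: (@le_trans _ _ (\sum_(j < k.+1) freq R l ^+ k.*2)).
  by apply: ler_sum => j _; apply: ler_weXn2l => //; rewrite leq_double -ltnS.
rewrite sumr_const card_ord -mulr_natl doubleS 2!exprS mulrA mulrA.
rewrite ler_wpM2r ?exprn_ge0 ?(ltW f0)//.
move: hl; rewrite ler_pdivrMr// => hl; apply: le_trans hl _.
rewrite mulrC -mulrA ler_pM2l// -expr2 lerXn2r ?nnegrE ?ler0n ?(ltW f0)//.
rewrite /freq ler_peMl ?ler0n//.
by have := pi_ge2 R; lra.
Qed.

End asymptotics.

(** * Choice of the prior *)

Section parameters.
Context (R : realType).
Variables (k : nat) (r dl : R).
Hypotheses (k1 : (1 <= k)%N) (r0 : 0 < r) (dl0 : 0 < dl) (dl1 : dl <= 1 / 10).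

(* Pinsker's weights, without the low frequencies where they are unbounded. *)
Definition signal (N l : nat) : R :=
  if (dl * N%:R <= l.+1%:R) && (l < N)%N then (N%:R / l.+1%:R) ^+ k - 1 else 0.

Let kR : 0 < k%:R :> R. Proof. by rewrite ltr0n. Qed.
Let piR : 0 < 2 * pi :> R. Proof. by rewrite mulr_gt0// pi_gt0. Qed.

Lemma signal_ge0 N l : 0 <= signal N l.
Proof.
rewrite /signal; case: ifP => // /andP[_ lN].
by rewrite subr_ge0 exprn_ege1// ler_pdivlMr// mul1r ler_nat.
Qed.

(** The bound is uniform in [N] thanks to the removal of the low frequencies; it lets [m] be fixed
    before [N]. *)
Lemma signal_le N l : signal N l <= dl^-1 ^+ k.
Proof.
rewrite /signal; case: ifP => [/andP[dN lN]|_]; last by rewrite exprn_ge0// invr_ge0 ltW.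
apply: (@le_trans _ _ ((N%:R / l.+1%:R) ^+ k)); first by rewrite gerBl.
have N0 : 0 < N%:R :> R by rewrite ltr0n (leq_trans _ lN).
rewrite lerXn2r ?nnegrE ?invr_ge0 ?(ltW dl0) ?divr_ge0//.
by rewrite ler_pdivrMr// mulrC ler_pdivlMr// mulrC.
Qed.

Lemma signal_pow_le N l : (l < N)%N ->
  signal N l * l.+1%:R ^+ k.*2 <= N%:R ^+ k * l.+1%:R ^+ k - l.+1%:R ^+ k.*2.
Proof.
move=> lN; have -> : N%:R ^+ k * l.+1%:R ^+ k - l.+1%:R ^+ k.*2 =
    ((N%:R / l.+1%:R) ^+ k - 1) * l.+1%:R ^+ k.*2 :> R.
  rewrite mulrBl mul1r expr_div_n -addnn exprD; congr (_ - _).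
  by field; rewrite ?gt_eqF// ?exprn_gt0.
rewrite ler_wpM2r ?exprn_ge0// /signal; case: ifP => // _.
by rewrite subr_ge0 exprn_ege1// ler_pdivlMr// mul1r ler_nat.
Qed.

(** The constant is [1 / (k + 1) - 1 / (2 k + 1)], from the two power sums, and [N^-1] is the
    discretization error. This sum is what the prior spends of the Sobolev radius. *)
Lemma sum_signal_pow_le N : (0 < N)%N ->
  \sum_(l < N) signal N l * l.+1%:R ^+ k.*2 <=
  N%:R ^+ k.*2.+1 * (k%:R / (k.+1%:R * (k.*2.+1)%:R) + N%:R^-1).
Proof.
move=> N0; have NR : 0 < N%:R :> R by rewrite ltr0n.
apply: (@le_trans _ _ (\sum_(l < N) (N%:R ^+ k * l.+1%:R ^+ k - l.+1%:R ^+ k.*2))).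
  by apply: ler_sum => l _; exact: signal_pow_le.
rewrite sumrB -mulr_sumr; have h1 := sum_pow_le R k N; have h2 := sum_pow_ge R k.*2 N.
have h3 := ler_wpM2l (exprn_ge0 k (ltW NR)) h1.
apply: le_trans (lerB h3 h2) _; rewrite le_eqVlt; apply/orP; left; apply/eqP.
have -> : (k.*2.+1)%:R = k%:R + k.+1%:R :> R by rewrite -natrD -addnn addnS.
have -> : k.+1%:R = k%:R + 1 :> R by rewrite natr1.
rewrite -addnn !exprS exprD; field.
by rewrite !gt_eqF//; lra.
Qed.

(** A frequency that is kept contributes exactly [1 - (l / N)^k], and at most [dl * N] frequencies
    are removed. *)
Lemma sum_signal_ratio_ge N : (0 < N)%N ->
  N%:R * (k%:R / k.+1%:R - N%:R^-1 - dl) <=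
  \sum_(l < N) signal N l / (1 + signal N l).
Proof.
move=> N0; have NR : 0 < N%:R :> R by rewrite ltr0n.
apply: (@le_trans _ _ (\sum_(l < N) (1 - l.+1%:R ^+ k / N%:R ^+ k - (l.+1%:R <= dl * N%:R)%R%:R))).
  rewrite !sumrB sumr_const card_ord -mulr_suml.
  have h1 := sum_pow_le R k N.
  have h2 : (\sum_(l < N) l.+1%:R ^+ k) / N%:R ^+ k <= N%:R / k.+1%:R + 1 :> R.
    rewrite ler_pdivrMr ?exprn_gt0//; apply: le_trans h1 _.
    by rewrite mulrDl mul1r lerD2r exprS mulrAC.
  have dN : 0 <= dl * N%:R by rewrite mulr_ge0// ltW.
  have dN1 : dl * N%:R < N.+1%:R.
    rewrite -natr1; have : dl * N%:R <= 1 * N%:R by apply: ler_wpM2r => //; move: dl1; lra.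
    by lra.
  have /andP[_ h3] := count_below dN dN1.
  have -> : N%:R * (k%:R / k.+1%:R - N%:R^-1 - dl) = N%:R - (N%:R / k.+1%:R + 1) - dl * N%:R.
    have -> : k.+1%:R = k%:R + 1 :> R by rewrite natr1.
    by field; rewrite !gt_eqF//; have := kR; lra.
  by apply: lerB => //; apply: lerB.
apply: ler_sum => l _; rewrite /signal ltn_ord andbT.
have [ge|lt] := boolP (dl * N%:R <= l.+1%:R).
  apply: (@le_trans _ _ (1 - l.+1%:R ^+ k / N%:R ^+ k)); first by rewrite gerBl.
  have -> : 1 + ((N%:R / l.+1%:R) ^+ k - 1) = (N%:R / l.+1%:R) ^+ k :> R by ring.
  rewrite expr_div_n le_eqVlt; apply/orP; left; apply/eqP.
  by field; rewrite !expf_neq0// gt_eqF.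
rewrite mul0r; have -> : (l.+1%:R <= dl * N%:R) = true by rewrite ltW// ltNge.
have : 0 <= l.+1%:R ^+ k / N%:R ^+ k :> R by rewrite divr_ge0// exprn_ge0.
by rewrite /=; lra.
Qed.

(** [pinsker_scale] slightly deflated. The two factors [1 + dl] pay for the lower derivatives and
    for the term [N^-1] of the power sums; [1 - dl] leaves the margin [dl * r] used by Chernoff's
    inequality. *)
Definition radius_scale : R := pinsker_scale k r * (1 - dl) / (1 + dl) ^+ 2.

Definition weight (N : nat) (v : R) (l : nat) : R :=
  (\sum_(j < k.+1) freq R l ^+ j.*2) * signal N l / v.

Lemma weight_ge0 N v l : 0 < v -> 0 <= weight N v l.
Proof.
move=> v0; rewrite divr_ge0 ?(ltW v0)// mulr_ge0 ?signal_ge0// sumr_ge0// => j _.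
by rewrite exprn_ge0// ltW// freq_gt0.
Qed.

Lemma weight_le N v l : 0 < v -> k%:R / dl <= (dl * N%:R) ^+ 2 ->
  weight N v l <= (1 + dl) * (2 * pi) ^+ k.*2 * (signal N l * l.+1%:R ^+ k.*2) / v.
Proof.
move=> v0 hN; rewrite /weight ler_pM2r ?invr_gt0//.
have [s0|s0] := eqVneq (signal N l) 0; first by rewrite s0 !(mulr0, mul0r).
have dN : dl * N%:R <= l.+1%:R.
  by move: s0; rewrite /signal; case: ifP => [/andP[]//|_]; rewrite eqxx.
have dN0 : 0 <= dl * N%:R by rewrite mulr_ge0// ltW.
have := @sobolev_freq_le R k l dl k1 dl0.
have -> : k%:R / dl <= l.+1%:R ^+ 2.
  by apply: le_trans hN _; rewrite lerXn2r ?nnegrE.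
move=> /(_ isT)/(ler_wpM2r (signal_ge0 N l)) h; apply: le_trans h _.
by rewrite /freq exprMn le_eqVlt; apply/orP; left; apply/eqP; ring.
Qed.

(** Makes explicit that [expR (g * N)] outgrows [N ^+ 2], the order of the squared bound on the
    signals. *)
Let cube_bound (x : R) : 0 <= x -> x ^+ 3 <= 27 * expR x.
Proof.
move=> x0; have x3 : 0 <= x / 3 by rewrite divr_ge0.
have e : x / 3 <= expR (x / 3) by have := expR_ge1Dx (x / 3); lra.
have -> : expR x = expR (x / 3) ^+ 3 by rewrite -expRM_natl; congr expR; field.
have : (x / 3) ^+ 3 <= expR (x / 3) ^+ 3 by rewrite lerXn2r ?nnegrE ?expR_ge0.
by rewrite expr_div_n; lra.
Qed.

(** [m] and [N0] are fixed from [k], [r] and [dl] before [N] and [v] appear. The three conclusions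
    are the probability of leaving the ball, the Bayes value, and the cost of the signals outside
    the ball. *)
Lemma prior_parameters : exists m N0 : nat, (0 < m)%N /\
  forall (N : nat) (v : R), (N0 <= N)%N -> 1 <= v ->
  N%:R ^+ k.*2.+1 <= radius_scale * v -> exists eps : R,
  [/\ #|[pred o : array ('I_N * bool)%type m |
         r < \sum_(p : 'I_N * bool) weight N v p.1 * energy R (o p)]|%:R
       <= eps * #|{: array ('I_N * bool)%type m}|%:R,
     2 * N%:R / (v * (1 + dl)) * (k%:R / k.+1%:R - 2 * dl) <=
       \sum_(l < N) 2 * signal N l / v / variance_factor m (signal N) l
   & 4 * (\sum_(e : 'I_N * bool * 'I_m) Num.sqrt (2 * (signal N e.1.1 / m%:R) / v)) ^+ 2 * eps
      <= dl / v].
Proof.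
have c0 := pinsker_scale_gt0 k1 r0.
have dlp := dl0; have dl10 := dl1; have rp := r0.
(* This constant and the next ones are introduced by an equation, hence opaque: [lra] and [field]
   see atoms. *)
have [X XE] : exists c : R, c = dl^-1 ^+ k by eexists.
have X0 : 0 < X by rewrite XE exprn_gt0// invr_gt0.
(* Large enough for both size conditions of [variance_factor_le]. *)
pose m := (Num.truncn (2 * X + 3 * X / dl)).+1.
have mX : 2 * X + 3 * X / dl < m%:R by exact: truncnS_gt.
have m0 : (0 < m)%N by [].
have mR : 0 < m%:R :> R by rewrite ltr0n.
have X3 : 0 < 3 * X / dl by rewrite divr_gt0// mulr_gt0.
have [C1 C1E] : exists c : R, c = 2 * (2 * pi) ^+ k.*2 * pinsker_scale k r by eexists.
have C10 : 0 < C1 by rewrite C1E; apply: mulr_gt0 => //; apply: mulr_gt0 => //; exact: exprn_gt0.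
(* The Chernoff parameter will be [y = th * N]. The weights are at most [C1 / N], so [y] times a
   weight times [m] is at most [dl / 4], within the range of [energy_tail]. *)
have [th thE] : exists c : R, c = dl / (4 * m%:R * C1) by eexists.
have th0 : 0 < th by rewrite thE divr_gt0// !mulr_gt0.
(* Rate of decay: the margin contributes [- th * r * dl] per unit of [N], and by the choice of [th]
   the quadratic term gives back at most half of it. *)
have [g gE] : exists c : R, c = th * r * dl / 2 by eexists.
have g0 : 0 < g by rewrite gE divr_gt0// !mulr_gt0.
have [ck ckE] : exists c : R, c = k%:R / (k.+1%:R * (k.*2.+1)%:R) by eexists.
have ck0 : 0 < ck by rewrite ckE divr_gt0// mulr_gt0// ltr0n.
(* From this size of [N] on, [cube_bound] at [g * N] makes the cost of the signals outside the ball
   at most [dl / v]. *)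
have [q qE] : exists c : R, c = 27 * (32 * (m%:R * X)) / (g ^+ 3 * dl) by eexists.
(* Every requirement on [N] is a lower bound by a positive number, so their sum meets them all. *)
have [bnd bndE] : exists c : R, c = 1 + 1 / dl + 1 / (dl * ck) + (k%:R / dl) / dl ^+ 2 + q by eexists.
exists m, (Num.truncn bnd).+1; split => // N v Nbig v1 Nv.
have v0 : 0 < v by lra.
have Nbnd : bnd <= N%:R.
  by apply: ltW; apply: lt_le_trans (truncnS_gt _) _; rewrite ler_nat.
have p1 : 0 < 1 / dl by rewrite divr_gt0.
have p2 : 0 < 1 / (dl * ck) by rewrite divr_gt0// mulr_gt0.
have p3 : 0 < (k%:R / dl) / dl ^+ 2 by rewrite !divr_gt0// exprn_gt0.
have p4 : 0 < q by rewrite qE divr_gt0// ?mulr_gt0// ?mulr_gt0// ?mulr_gt0// exprn_gt0.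
have N1 : 1 <= N%:R :> R by move: Nbnd; rewrite bndE; lra.
have NR : 0 < N%:R :> R by lra.
have N0 : (0 < N)%N by move: NR; rewrite ltr0n.
have Ninv1 : N%:R^-1 <= dl.
  rewrite -[dl]invrK lef_pV2 ?posrE ?invr_gt0//.
  by move: Nbnd; rewrite bndE -div1r; lra.
have Ninv2 : N%:R^-1 <= dl * ck.
  rewrite -[dl * ck]invrK lef_pV2 ?posrE ?invr_gt0 ?mulr_gt0//.
  by move: Nbnd; rewrite bndE -[(dl * ck)^-1]div1r; lra.
have Nk : k%:R / dl <= (dl * N%:R) ^+ 2.
  have : (k%:R / dl) / dl ^+ 2 <= N%:R by move: Nbnd; rewrite bndE; lra.
  rewrite ler_pdivrMr ?exprn_gt0// => h; apply: le_trans h _.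
  by rewrite exprMn mulrC ler_wpM2l ?exprn_ge0 ?(ltW dl0)// expr2 ler_peMl ?ler0n.
pose L := ('I_N * bool)%type.
have w0 l := weight_ge0 N l v0.
have wle l := weight_le l v0 Nk.
have scale1 : radius_scale <= pinsker_scale k r.
  rewrite /radius_scale ler_pdivrMr ?exprn_gt0 ?addr_gt0//.
  rewrite ler_pM2l//; apply: (@le_trans _ _ 1); first by rewrite gerBl ltW.
  by rewrite exprn_ege1// lerDl ltW.
have N2k : N%:R ^+ k.*2 / v <= pinsker_scale k r / N%:R.
  rewrite ler_pdivrMr// mulrAC ler_pdivlMr// -exprSr.
  by apply: le_trans Nv _; rewrite ler_pM2r.
have wmax l : weight N v l <= C1 / N%:R.
  apply: le_trans (wle l) _.
  have [lN|Nl] := ltnP l N; last first.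
    by rewrite /signal ltnNge Nl andbF !(mul0r, mulr0) divr_ge0// ltW.
  have s1 : signal N l * l.+1%:R ^+ k.*2 <= N%:R ^+ k.*2.
    apply: le_trans (signal_pow_le lN) _.
    apply: (@le_trans _ _ (N%:R ^+ k * l.+1%:R ^+ k)); first by rewrite gerBl exprn_ge0.
    by rewrite -addnn exprD ler_wpM2l ?exprn_ge0// lerXn2r ?nnegrE ?ler_nat.
  apply: (@le_trans _ _ (2 * (2 * pi) ^+ k.*2 * (N%:R ^+ k.*2 / v))); last first.
    by rewrite C1E -[leRHS]mulrA ler_wpM2l// mulr_ge0// exprn_ge0// ltW.
  rewrite [leRHS]mulrA ler_pM2r ?invr_gt0//.
  apply: ler_pM => //.
  - by rewrite mulr_ge0 ?exprn_ge0 ?(ltW piR)//; lra.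
  - by rewrite mulr_ge0 ?signal_ge0 ?exprn_ge0.
  - by rewrite ler_wpM2r ?exprn_ge0 ?(ltW piR)//; lra.
have wsum : \sum_(p : L) weight N v p.1 <= (1 - dl) * r.
  rewrite sum_pair_bool/=; apply: (@le_trans _ _ (\sum_(l < N)
     2 * ((1 + dl) * (2 * pi) ^+ k.*2 / v) * (signal N l * l.+1%:R ^+ k.*2))).
    apply: ler_sum => l _; have := wle l => h.
    rewrite (_ : 2 * _ * _ = 2 * ((1 + dl) * (2 * pi) ^+ k.*2 * (signal N l * l.+1%:R ^+ k.*2) / v)); last by ring.
    by lra.
  rewrite -mulr_sumr.
  have pk0 : 0 < 2 * ((1 + dl) * (2 * pi) ^+ k.*2 / v).
    by rewrite mulr_gt0// divr_gt0// mulr_gt0 ?exprn_gt0//; lra.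
  apply: le_trans (ler_wpM2l (ltW pk0) (sum_signal_pow_le N0)) _.
  rewrite -ckE.
  have ckd : ck + N%:R^-1 <= (1 + dl) * ck by lra.
  have ck1 : 0 <= ck + N%:R^-1 by rewrite addr_ge0 ?invr_ge0 ?(ltW ck0) ?(ltW NR).
  have sv0 : 0 <= radius_scale * v by apply: le_trans Nv; rewrite exprn_ge0.
  have := ler_pM (exprn_ge0 _ (ltW NR)) ck1 Nv ckd.
  move=> /(ler_wpM2l (ltW pk0)) h; apply: le_trans h _.
  rewrite le_eqVlt; apply/orP; left; apply/eqP.
  rewrite /radius_scale /pinsker_scale ckE; field.
  rewrite !gt_eqF// ?ltr0n// ?exprn_gt0//; lra.
have [y yE] : exists c : R, c = th * N%:R by eexists.
have y0 : 0 < y by rewrite yE mulr_gt0.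
have ym (p : L) : y * weight N v p.1 * m%:R <= 1 / 2.
  apply: (@le_trans _ _ (y * (C1 / N%:R) * m%:R)).
    by rewrite ler_pM2r// ler_pM2l.
  rewrite (_ : _ * _ = dl / 4); first by lra.
  by rewrite yE thE; field; rewrite !gt_eqF.
exists (expR (- (g * N%:R))); split.
- apply: le_trans (energy_tail m0 r (fun p : L => w0 p.1) (ltW y0) ym) _.
  rewrite mulrC ler_wpM2r// ler_expR.
  have h2 : \sum_(p : L) weight N v p.1 ^+ 2 <= C1 / N%:R * r.
    apply: (@le_trans _ _ (C1 / N%:R * \sum_(p : L) weight N v p.1)).
      by rewrite mulr_sumr; apply: ler_sum => p _; rewrite expr2 ler_wpM2r.
    rewrite ler_wpM2l ?divr_ge0 ?(ltW C10)//; apply: le_trans wsum _.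
    by rewrite ler_piMl ?(ltW r0)//; lra.
  have h1 : y * (\sum_(p : L) weight N v p.1 - r) <= y * (- (dl * r)).
    by rewrite ler_pM2l//; move: wsum; rewrite mulrBl mul1r; lra.
  have h3 : 2 * y ^+ 2 * m%:R * (\sum_(p : L) weight N v p.1 ^+ 2) <=
            2 * y ^+ 2 * m%:R * (C1 / N%:R * r).
    by apply: ler_wpM2l => //; apply: mulr_ge0 => //; apply: mulr_ge0 => //; exact: sqr_ge0.
  apply: le_trans (lerD h1 h3) _.
  rewrite le_eqVlt; apply/orP; left; apply/eqP.
  by rewrite yE gE thE; field; rewrite !gt_eqF.
- apply: (@le_trans _ _ (2 / (v * (1 + dl)) * \sum_(l < N) signal N l / (1 + signal N l))).
    rewrite (_ : 2 * N%:R / (v * (1 + dl)) * (k%:R / k.+1%:R - 2 * dl) =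
       2 / (v * (1 + dl)) * (N%:R * (k%:R / k.+1%:R - 2 * dl))); last by ring.
    rewrite ler_wpM2l//; first by rewrite divr_ge0// mulr_ge0//; lra.
    apply: le_trans (sum_signal_ratio_ge N0); rewrite ler_pM2l//.
    rewrite (_ : k%:R / k.+1%:R - 2 * dl = k%:R / k.+1%:R - dl - dl); last by ring.
    by rewrite lerD2r lerB.
  rewrite mulr_sumr; apply: ler_sum => l _.
  have s0 := signal_ge0 N l; have D0 := variance_factor_gt0 m0 (signal_ge0 N) l.
  have Dle := @variance_factor_le R m (signal N) l X dl m0 s0 _ dl0.
  have {Dle} Dl : variance_factor m (signal N) l <= (1 + signal N l) * (1 + dl).
    by apply: Dle; rewrite ?XE ?signal_le -?XE//; lra.
  have s1 : 0 < 1 + signal N l by lra.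
  have d1 : 0 < 1 + dl by lra.
  rewrite (_ : 2 / (v * (1 + dl)) * _ = 2 * signal N l / v * ((1 + signal N l) * (1 + dl))^-1); last first.
    by field; rewrite !gt_eqF.
  rewrite ler_wpM2l ?divr_ge0 ?mulr_ge0 ?(ltW v0)//.
  by rewrite lef_pV2 ?posrE ?mulr_gt0.
have [a aE] : exists c : R, c = Num.sqrt (2 * (X / m%:R) / v) by eexists.
have a2 : a ^+ 2 = 2 * (X / m%:R) / v.
  by rewrite aE sqr_sqrtr// divr_ge0 ?(ltW v0)// mulr_ge0// divr_ge0 ?(ltW X0) ?ltW.
have B1 : \sum_(e : L * 'I_m) Num.sqrt (2 * (signal N e.1.1 / m%:R) / v) <= 2 * N%:R * m%:R * a.
  apply: (@le_trans _ _ (\sum_(e : L * 'I_m) a)).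
    apply: ler_sum => e _; rewrite aE; apply: ler_wsqrtr.
    by rewrite ler_pM2r ?invr_gt0// ler_pM2l// ler_pM2r ?invr_gt0// XE signal_le.
  rewrite sumr_const !card_prod !card_ord card_bool -[_ *+ (N * 2 * m)]mulr_natl.
  by rewrite le_eqVlt; apply/orP; left; apply/eqP; rewrite !natrM; ring.
have B2 : (\sum_(e : L * 'I_m) Num.sqrt (2 * (signal N e.1.1 / m%:R) / v)) ^+ 2 <= 8 * N%:R ^+ 2 * m%:R * X / v.
  apply: (@le_trans _ _ ((2 * N%:R * m%:R * a) ^+ 2)).
    rewrite lerXn2r ?nnegrE//.
      by apply: sumr_ge0 => e _; exact: sqrtr_ge0.
    by rewrite aE mulr_ge0 ?sqrtr_ge0.
  rewrite exprMn a2 le_eqVlt; apply/orP; left; apply/eqP; field.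
  by rewrite !gt_eqF.
apply: (@le_trans _ _ (4 * (8 * N%:R ^+ 2 * m%:R * X / v) * expR (- (g * N%:R)))).
  by rewrite ler_wpM2r ?expR_ge0// ler_pM2l.
rewrite (_ : 4 * _ * _ = 32 * N%:R ^+ 2 * m%:R * X * expR (- (g * N%:R)) / v); last by ring.
rewrite ler_pM2r ?invr_gt0// expRN ler_pdivrMr ?expR_gt0//.
have gN0 : 0 <= g * N%:R by rewrite mulr_ge0// ltW.
have := cube_bound gN0; rewrite exprMn => e3.
have : 27 * (32 * (m%:R * X)) <= N%:R * (g ^+ 3 * dl).
  by rewrite -ler_pdivrMr ?mulr_gt0 ?exprn_gt0// -qE; move: Nbnd; rewrite bndE; lra.
move=> /(ler_wpM2l (exprn_ge0 2 (ltW NR))) h.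
have h' := ler_wpM2l (ltW dl0) e3.
rewrite -(@ler_pM2l _ 27)//; apply: (@le_trans _ _ (N%:R ^+ 2 * (27 * (32 * (m%:R * X))))).
  by rewrite le_eqVlt; apply/orP; left; apply/eqP; ring.
apply: le_trans h _; have -> : N%:R ^+ 2 * (N%:R * (g ^+ 3 * dl)) = dl * (g ^+ 3 * N%:R ^+ 3) by ring.
by apply: le_trans h' _; rewrite le_eqVlt; apply/orP; left; apply/eqP; ring.
Qed.

End parameters.

(** * Passage to the limit *)

Section limit_inferior.
Context (R : realType).

Lemma le_limn_einf (u : nat -> \bar R) (l : R) :
  (forall e : R, 0 < e -> \forall n \near \oo, ((l - e)%:E <= u n)%E) ->
  (l%:E <= limn_einf u)%E.
Proof.
move=> h; apply/lee_addgt0Pr => e e0; rewrite -leeBlDr// -EFinB limn_einf_lim.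
apply: lime_ge; first exact: is_cvg_einfs.
have [n _ hn] := h e e0; exists n => // j /= nj.
by apply: le_ereal_inf_tmp => _ [i /= ji <-]; apply: hn; exact: leq_trans ji.
Qed.

(* The bound of the prior, with the frequency cutoff N = floor (h s), where
   s ^+ (2 k + 1) = v and h ^+ (2 k + 1) = radius_scale. *)
Lemma pinsker_parameters (k : nat) (r e : R) : (1 <= k)%N -> 0 < r -> 0 < e ->
  e <= pinsker_constant k r ->
  exists v0 : R, 0 < v0 /\ forall v, v0 <= v ->
  exists (N m : nat) (x : nat -> R) (eps : R),
  [/\ (0 < m)%N, forall l, 0 <= x l,
     #|[pred o : array ('I_N * bool)%type m |
         r < \sum_(p : 'I_N * bool)
              (\sum_(j < k.+1) freq R p.1 ^+ j.*2) * x p.1 / v * energy R (o p)]|%:R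
       <= eps * #|{: array ('I_N * bool)%type m}|%:R &
     let c := \sum_(l < N) 2 * x l / v / variance_factor m x l
        - 4 * (\sum_(e : 'I_N * bool * 'I_m) Num.sqrt (2 * (x e.1.1 / m%:R) / v)) ^+ 2 * eps in
     0 <= c /\ pinsker_constant k r - e <= v `^ ((k.*2)%:R / (k.*2.+1)%:R) * c].
Proof.
move=> k1 r0 e0 erho; have c0 := pinsker_scale_gt0 k1 r0.
have rhoE := pinsker_constantE k1 r0.
have p0 : (0 < k.*2.+1)%N by [].
move: rhoE; set rho := pinsker_constant k r => rhoE.
have [h0 h0E] : exists c, c = pinsker_scale k r `^ (1 / (k.*2.+1)%:R) by eexists.
have h00 : 0 < h0 by rewrite h0E powR_gt0.
have [q qE] : exists c : R, c = k%:R / k.+1%:R by eexists.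
have qhalf : 1 / 2 <= q.
  rewrite qE ler_pdivlMr ?ltr0n// (_ : k.+1%:R = k%:R + 1 :> R) ?natr1//.
  have : 1 <= k%:R :> R by rewrite ler1n.
  by lra.
have q1 : q <= 1 by rewrite qE ler_pdivrMr ?ltr0n// mul1r ler_nat.
(* The final loss is at most [14 * h0 * dl + dl]: the factors [1 - 5 * dl] and [q - 2 * dl] of the
   main term [2 * h0 * q] cost 14, as [q <= 1], and the signals outside the ball cost the last [dl].
   The bound 1/10 keeps [q - 2 * dl] positive. *)
have [dl dlE] : exists c : R, c = Num.min (1 / 10) (e / (14 * h0 + 1)) by eexists.
have hh : 0 < 14 * h0 + 1 by lra.
have dl0 : 0 < dl by rewrite dlE lt_min !divr_gt0.
have dl1 : dl <= 1 / 10 by rewrite dlE ge_min lexx.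
have dle : dl * (14 * h0 + 1) <= e.
  by rewrite -ler_pdivlMr// dlE ge_min lexx orbT.
have [m [N0 [m0 hN]]] := prior_parameters k1 r0 dl0 dl1.
have [f fE] : exists c : R, c = (1 - dl) / (1 + dl) ^+ 2 by eexists.
have d1 : 0 < 1 + dl by lra.
have d2 : 0 < 1 - dl by lra.
have f0 : 0 < f by rewrite fE divr_gt0// exprn_gt0.
have f1 : f <= 1.
  rewrite fE ler_pdivrMr ?exprn_gt0// mul1r.
  apply: (@le_trans _ _ 1); first by lra.
  by rewrite exprn_ege1//; lra.
have ks : radius_scale k r dl = pinsker_scale k r * f.
  by rewrite /radius_scale fE mulrA.
have ks0 : 0 < radius_scale k r dl by rewrite ks mulr_gt0.
have [h hE] : exists c, c = radius_scale k r dl `^ (1 / (k.*2.+1)%:R) by eexists.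
have hp : 0 < h by rewrite hE powR_gt0.
have hpow : h ^+ k.*2.+1 = radius_scale k r dl by rewrite hE root_powR.
have h0pow : h0 ^+ k.*2.+1 = pinsker_scale k r by rewrite h0E root_powR.
(* Since [f <= 1], a power of [f] is at most [f], which avoids extracting its root. *)
have h0h : h0 * f <= h.
  rewrite -(@ler_pXn2r _ k.*2.+1) ?nnegrE ?(ltW hp)//; last by rewrite mulr_ge0 ?ltW.
  rewrite exprMn hpow h0pow ks ler_pM2l//.
  by rewrite exprS ler_piMr ?(ltW f0)// exprn_ile1// ltW.
(* It ensures [N0 <= N] and [1 <= dl * (h * s)], so that taking the integer part loses at most a
   factor [1 - dl]; the leading 1 gives [1 <= v]. *)
have [S0 S0E] : exists c : R, c = 1 + (N0.+1%:R + 1 / dl) / h by eexists.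
have S01 : 1 <= S0.
  by rewrite S0E lerDl divr_ge0 ?(ltW hp)// addr_ge0// divr_ge0// ltW.
exists (S0 ^+ k.*2.+1); split; first by rewrite exprn_gt0//; lra.
move=> v vS.
have v0 : 0 < v by apply: lt_le_trans vS; rewrite exprn_gt0//; lra.
have v1 : 1 <= v by apply: le_trans vS; rewrite exprn_ege1.
have [s sE] : exists c, c = v `^ (1 / (k.*2.+1)%:R) by eexists.
have s0 : 0 < s by rewrite sE powR_gt0.
have spow : s ^+ k.*2.+1 = v by rewrite sE root_powR.
have sS : S0 <= s.
  rewrite -(@ler_pXn2r _ k.*2.+1) ?nnegrE ?(ltW s0)//; last by lra.
  by rewrite spow.
have hs : N0.+1%:R + 1 / dl <= h * s.
  rewrite [h * s]mulrC -ler_pdivrMr//; apply: le_trans sS; rewrite S0E; lra.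
have dlinv : 0 < 1 / dl by rewrite divr_gt0.
have hs0 : 0 <= h * s by rewrite mulr_ge0 ?ltW.
pose N := Num.truncn (h * s).
have /andP[Nle Ngt] := truncn_itv hs0.
rewrite -/N -natr1 in Nle Ngt.
have NN0 : (N0 <= N)%N.
  by rewrite truncn_ge_nat//; move: hs; rewrite -natr1; lra.
have Npow : N%:R ^+ k.*2.+1 <= radius_scale k r dl * v.
  by rewrite -hpow -spow -exprMn lerXn2r ?nnegrE.
have Nlow : (1 - dl) * (h * s) <= N%:R.
  have : 1 <= dl * (h * s).
    rewrite mulrC -ler_pdivrMr//; apply: le_trans hs; rewrite lerDr.
    exact: ler0n.
  by lra.
have [eps [hbad hV herr]] := hN N v NN0 v1 Npow.
exists N, m, (signal k dl N), eps; split => //.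
  by move=> l; exact: signal_ge0.
move: hV herr; set V := \sum_(l < N) _; set err := 4 * _ * eps => hV herr c.
have cE : c = V - err by [].
have key : rho - e <= v `^ ((k.*2)%:R / (k.*2.+1)%:R) * c.
  rewrite powR_root// -sE cE mulrBr.
  have sv : s ^+ k.*2 / v = s^-1 by rewrite -spow exprS; field; rewrite !gt_eqF// exprn_gt0.
  have s2k : 0 <= s ^+ k.*2 by rewrite exprn_ge0// ltW.
  have s1 : s^-1 <= 1 by rewrite invf_le1//; lra.
  have e1 : s ^+ k.*2 * err <= dl.
    apply: le_trans (ler_wpM2l s2k herr) _.
    by rewrite mulrCA sv ler_piMr// ltW.
  have q2 : 0 < q - 2 * dl by lra.
  have e2 : 2 * (h0 * f) * (1 - dl) / (1 + dl) * (q - 2 * dl) <= s ^+ k.*2 * V.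
    apply: le_trans (ler_wpM2l s2k hV); rewrite -qE [leRHS]mulrA ler_pM2r//.
    rewrite (_ : s ^+ k.*2 * _ = 2 / (1 + dl) * N%:R * (s ^+ k.*2 / v)); last first.
      by field; rewrite !gt_eqF.
    rewrite sv ler_pdivlMr//.
    rewrite (_ : 2 * (h0 * f) * (1 - dl) / (1 + dl) * s =
       2 / (1 + dl) * ((1 - dl) * (h0 * f * s))); last by field; rewrite gt_eqF.
    rewrite ler_pM2l ?divr_gt0//; apply: le_trans Nlow.
    by rewrite ler_pM2l// ler_pM2r.
  have e3 : 1 - 5 * dl <= f * (1 - dl) / (1 + dl).
    have -> : f * (1 - dl) / (1 + dl) = (1 - dl) ^+ 2 / (1 + dl) ^+ 3.
      by rewrite fE; field; rewrite gt_eqF.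
    rewrite ler_pdivlMr ?exprn_gt0// -subr_ge0.
    rewrite (_ : _ - _ = dl ^+ 2 * (13 + 14 * dl + 5 * dl ^+ 2)); last by ring.
    by rewrite mulr_ge0 ?sqr_ge0// !addr_ge0// mulr_ge0 ?sqr_ge0 ?ltW.
  have e4 : 2 * h0 * (1 - 5 * dl) * (q - 2 * dl) <= s ^+ k.*2 * V.
    apply: le_trans e2; rewrite ler_pM2r//.
    rewrite (_ : 2 * (h0 * f) * (1 - dl) / (1 + dl) = 2 * h0 * (f * (1 - dl) / (1 + dl))); last first.
      by field; rewrite gt_eqF.
    by rewrite ler_pM2l// mulr_gt0.
  have e5 : 2 * h0 * q - 14 * h0 * dl <= 2 * h0 * (1 - 5 * dl) * (q - 2 * dl).
    rewrite -subr_ge0 (_ : _ - _ = h0 * dl * (10 * (1 - q) + 20 * dl)); last by ring.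
    by rewrite mulr_ge0//; [rewrite mulr_ge0 ?ltW|lra].
  have rhoE' : rho = 2 * h0 * q by rewrite rhoE h0E qE.
  by move: dle; rewrite mulrDr mulr1 rhoE'; lra.
split => //.
have vp : 0 < v `^ ((k.*2)%:R / (k.*2.+1)%:R) by rewrite powR_gt0.
by rewrite -(pmulr_rge0 _ vp) (le_trans _ key)// subr_ge0.
Qed.

End limit_inferior.

Theorem theorem4p5 (R : realType) (d : measure_display)
  (Omega : measurableType d) (P : probability Omega R)
  (Pi : {measure set (measurableTypeR R) -> \bar R})
  (eta nuY : probability (measurableTypeR R) R) (ctau : R)
  (w Lj : R -> {RV P >-> R}) (tau Y : nat -> {RV P >-> R})
  (k : nat) (r : R) (lo hi : nat -> R)
  (Pi2 : (\int[Pi]_x (x ^+ 2)%:E = 1)%E)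
  (Pi8 : (\int[Pi]_x (x ^+ 8)%:E < +oo)%E)
  (eta_pos : eta `]-oo, 0]%classic = 0%E)
  (eta_int : eta.-integrable setT (fun x => x%:E))
  (eta_mean : (\int[eta]_x x%:E = ctau%:E)%E)
  (Y1 : (\int[nuY]_x x%:E = 0)%E)
  (Y2 : (\int[nuY]_x (x ^+ 2)%:E = 1)%E)
  (Y4 : (\int[nuY]_x (x ^+ 4)%:E < +oo)%E)
  (hw : standard_brownian w)
  (hL : compensated_jump_integral Pi Lj)
  (htau : iid_with_law tau eta)
  (hY : iid_with_law Y nuY)
  (hind : independent4 P
     (sigma_generated `[0, +oo[%classic w)
     (sigma_generated `[0, +oo[%classic Lj)
     (sigma_generated `[0, +oo[%classic (renewal_count tau))
     (sigma_generated setT Y))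
  (hk : (1 <= k)%N) (hr : 0 < r)
  (hlohi : forall n, (0 < n)%N -> 0 < lo n <= hi n)
  (hlo : forall e : R, 0 < e -> n%:R `^ e * lo n @[n --> \oo] --> +oo)
  (hhi : forall e : R, 0 < e -> hi n / n%:R `^ e @[n --> \oo] --> (0 : R)) :
  ((pinsker_constant k r)%:E <=
   limn_einf (fun n : nat =>
     ((n%:R / hi n) `^ ((k.*2)%:R / (k.*2.+1)%:R))%:E *
     ereal_inf [set ereal_sup
         [set robust_risk (noise_family P w Lj tau Y ctau (lo n) (hi n) n) Sh S
         | S in sobolev_ball k r]
       | Sh in estimators R n]))%E.
Proof.
set rho := pinsker_constant k r.
have rho0 : 0 < rho.
  rewrite /rho pinsker_constantE// mulr_gt0 ?divr_gt0 ?ltr0n//.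
  by rewrite mulr_gt0 ?powR_gt0 ?pinsker_scale_gt0.
apply: le_limn_einf => e e0.
(* [pinsker_parameters] takes an error of at most [rho], so that the lower bound it returns is
   nonnegative. *)
pose e' := Num.min e rho.
have e'0 : 0 < e' by rewrite lt_min e0.
have e'rho : e' <= rho by rewrite ge_min lexx orbT.
have [v0 [v00 hv]] := pinsker_parameters hk hr e'0 e'rho.
(* At exponent 1, the growth condition on [hi] says that [n / hi n] tends to infinity, hence
   eventually exceeds [v0]. *)
have := hhi 1 ltr01 => /cvgrPdist_le/(_ v0^-1); rewrite invr_gt0 => /(_ v00) hh.
near=> n.
have n0 : (0 < n)%N by near: n; exact: nbhs_infty_gt.
have nR : 0 < n%:R :> R by rewrite ltr0n.
have /andP[lo0 lohi] := hlohi n n0.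
have hi0 : 0 < hi n by exact: lt_le_trans lohi.
have hn : `|0 - hi n / n%:R `^ 1| <= v0^-1 by near: n; exact: hh.
have vn : v0 <= n%:R / hi n.
  rewrite -lef_pV2 ?posrE ?divr_gt0// invf_div.
  by move: hn; rewrite sub0r normrN powRr1 ?ler0n// ger0_norm// divr_ge0// ltW.
pose sigma := Num.sqrt (hi n).
have sigma0 : 0 < sigma by rewrite sqrtr_gt0.
have sigma2 : sigma ^+ 2 = hi n by rewrite sqr_sqrtr// ltW.
rewrite -{1}sigma2 in vn.
have [N [m [x [eps [m0 x0 hbad]]]]] := hv _ vn.
set c := (X in let _ := X in _) => -[c0 hc].
apply: (@le_trans _ _ (rho - e')%:E); first by rewrite lee_fin lerD2l lerN2 ge_min lexx.
apply: (@le_trans _ _ (((n%:R / hi n) `^ ((k.*2)%:R / (k.*2.+1)%:R))%:E * c%:E)%E).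
  by rewrite -EFinM lee_fin -{1}sigma2.
rewrite lee_wpmul2l ?lee_fin ?powR_ge0//.
apply: le_ereal_inf_tmp => _ [Sh mSh <-].
exact: (minimax_lower_bound hw n0 sigma0 _ _ _ _ lohi sigma2 m0 x0 (ltW hr) mSh hbad c0).
Unshelve. all: by end_near. Qed.
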